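(* Let $D>1$ be an integer, let $b=b(D)$ be the smallest divisor of $D$ that is greater than $1$, and suppose $\gamma$ is a real number such that $$\gamma<\begin{cases}\dfrac{1}{D(b+1)} & \text{if } b\leq 3,\\[2mm] \dfrac{1}{2D(b+1)}+\dfrac{1}{Db^2(b+1)} & \text{otherwise.}\end{cases}$$ Then there exist infinitely many number fields $L\subset\overline{\mathbb{Q}}$ of degree $D=[L:\mathbb{Q}]$ satisfying $$\delta(L)>|\Delta_L|^{\gamma}.$$
   Context: Fix an algebraic closure $\overline{\mathbb{Q}}$ of $\mathbb{Q}$; every number field is regarded as a subfield of $\overline{\mathbb{Q}}$. $H(\cdot)$ denotes the absolute multiplicative Weil height on $\overline{\mathbb{Q}}$, i.e. $H(\alpha)=\prod_v \max\{1,|\alpha|_v\}^{[K_v:\mathbb{Q}_v]/[K:\mathbb{Q}]}$ for any number field $K$ containing $\alpha$, with $v$ running over the places of $K$ and $|\cdot|_v$ extending the standard absolute values on $\mathbb{Q}$. For a number field $L$, $\Delta_L$ is its (absolute) discriminant, and $\delta(L)=\inf\{H(\alpha) : L=\mathbb{Q}(\alpha)\}$ is the smallest height of a generator of $L$ over $\mathbb{Q}$ (the infimum is attained). *)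

(* Defs.v *)
From HB Require Import structures.
From mathcomp Require Import all_boot all_order all_algebra all_field.
From mathcomp Require Import boolp classical_sets functions cardinality fsbigop.
From mathcomp Require Import reals topology normedtype exp.
Set Implicit Arguments.
Unset Strict Implicit.
Unset Printing Implicit Defensive.
Import Order.TTheory GRing.Theory Num.Theory.
Import numFieldNormedType.Exports.
Local Open Scope classical_set_scope.
Local Open Scope ring_scope.

(* Throughout, a number field is a [K : fieldExtType rat] (finite-dimensional
   by construction) of degree [\dim {:K}]; [algC] is the algebraic closure of
   the rationals, and the number fields inside it are the images of ring
   morphisms [K -> algC]. *)

Section Places.
Variables (R : realType) (K : fieldExtType rat).
Implicit Types (v : K -> R) (u : nat -> K).

Record is_absolute_value v : Prop := IsAbsoluteValue {
  absv_ge0 : forall x, 0 <= v x;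
  absv_eq0 : forall x, v x = 0 <-> x = 0;
  absvM : forall x y, v (x * y) = v x * v y;
  absv_triangle : forall x y, v (x + y) <= v x + v y }.

Definition real_abs (q : rat) : R := ratr `|q|.

Definition padic_abs (p : nat) (q : rat) : R :=
  if q == 0 then 0
  else p%:R ^+ logn p `|denq q|%N / p%:R ^+ logn p `|numq q|%N.

(* Two absolute values are equivalent iff one is a positive power of the other,
   so each place contains exactly one absolute value that extends a standard
   absolute value of the rationals; a place is identified with it. *)
Definition places : set (K -> R) :=
  [set v | is_absolute_value v /\
     ((forall q : rat, v q%:A = real_abs q) \/
      (exists2 p, prime p & forall q : rat, v q%:A = padic_abs p q))].

Definition cauchy_for v u : Prop :=
  forall e : R, 0 < e ->
    exists N, forall m n, (N <= m)%N -> (N <= n)%N -> v (u m - u n) < e.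

Definition null_for v u : Prop := (fun n => v (u n)) @ \oo --> (0 : R).

(* The completion K_v is the ring of Cauchy sequences modulo null sequences,
   and Q_v is its subfield of classes of Cauchy sequences of rationals.
   [completion_basis v e] says that the classes of e_0, ..., e_(d-1) form a
   basis of K_v over Q_v. *)
Definition rat_cauchy_for v (c : nat -> rat) : Prop :=
  cauchy_for v (fun n => (c n)%:A).

Definition completion_basis v (d : nat) (e : 'I_d -> nat -> K) : Prop :=
  [/\ forall i, cauchy_for v (e i),
      forall u, cauchy_for v u ->
        exists2 c : 'I_d -> nat -> rat, (forall i, rat_cauchy_for v (c i)) &
          null_for v (fun n => u n - \sum_(i < d) c i n *: e i n)
    & forall c : 'I_d -> nat -> rat, (forall i, rat_cauchy_for v (c i)) ->
        null_for v (fun n => \sum_(i < d) c i n *: e i n) ->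
        forall i, null_for v (fun n => (c i n)%:A)].

(* [K_v : Q_v] *)
Definition local_degree v : nat :=
  xget 0%N [set d | exists e : 'I_d -> nat -> K, completion_basis v e].

(* All but finitely many factors are 1, so the finitely supported product
   is the product over all places. *)
Definition weil_height (a : K) : R :=
  \big[*%R/1]_(v \in places)
     (Num.max 1 (v a) `^ ((local_degree v)%:R / (\dim {:K})%:R)).

(* The height of a does not depend on the number field containing a, so the
   heights of generators of K are computed in K itself. *)
Definition delta : R :=
  inf [set weil_height a | a in [set a : K | <<1; a>>%VS = {:K}%VS]].

End Places.

Section Discriminant.
Variable K : fieldExtType rat.

(* Row i of this matrix lists the coordinates of a * e_i, where e is a basis
   of K over the rationals. *)
Definition field_trace (a : K) : rat :=
  \tr (\matrix_(i < \dim {:K}, j < \dim {:K})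
         coord (vbasis {:K}) j (a * (vbasis {:K})`_i)).

Definition ring_of_integers : set K :=
  [set x | integralOver (intr : int -> K) x].

Definition integral_basis (w : (\dim {:K}).-tuple K) : Prop :=
  [/\ basis_of {:K} w,
      forall i, ring_of_integers (tnth w i)
    & forall x, ring_of_integers x ->
        exists z : 'I_(\dim {:K}) -> int, x = \sum_i (tnth w i) *~ z i].

Definition basis_discriminant (w : (\dim {:K}).-tuple K) : rat :=
  \det (\matrix_(i < \dim {:K}, j < \dim {:K})
          field_trace (tnth w i * tnth w j)).

(* The value is the same for every integral basis; it is an integer, here
   kept as a rational number. *)
Definition discriminant : rat :=
  xget 0 [set basis_discriminant w | w in integral_basis].

End Discriminant.

(* Main.v *)
Require Import Defs.
From HB Require Import structures.
From mathcomp Require Import all_boot all_order all_algebra all_field.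
From mathcomp Require Import boolp classical_sets functions cardinality fsbigop.
From mathcomp Require Import reals topology normedtype exp.
From mathcomp Require Import sequences complex cyclic perm.
From mathcomp Require Import zify ring lra.
Set Implicit Arguments.
Unset Strict Implicit.
Unset Printing Implicit Defensive.
Import Order.TTheory GRing.Theory Num.Theory.
Local Open Scope classical_set_scope.
Local Open Scope ring_scope.

(** The fields are L = Q(theta) with theta ^ D = 2 p ^ m, where D = m b and p is a
    large prime. Put eta = theta ^ b / p. Then eta ^ m = 2, so L contains the field
    K = Q(eta), which is the same for all p up to isomorphism, and L is K with a
    b-th root of p eta adjoined. At p the field K is unramified and L / K is totally
    and tamely ramified of degree b.

    The products of the powers of eta and theta show that the discriminant of L is
    at most a constant times p ^ (m (b - 1)) ([radical_discriminant]). On the other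
    hand let alpha generate L. The product of the differences alpha - alpha' over
    the other conjugates alpha' of alpha over K is a nonzero element of L; apply the
    product formula to its norm. At any place a difference of conjugates is bounded
    by max(1, |alpha|) max(1, |alpha'|), up to a factor 2 at the archimedean place,
    and at p ramification gives an additional factor p ^ (-1 / b)
    ([ramified_bound]). Altogether
    H(alpha) ^ (2 D (b - 1)) is at least p ^ (m (b - 1)) / 2 ^ (D (b - 1))
    ([generator_height]): this is Silverman's inequality relative to K. So delta(L)
    is at least a constant times the power 1 / (2 D (b - 1)) of the discriminant, and
    this exponent is not smaller than the bounds on gamma ([exponent_bound]).
    Different primes give different fields because p is unramified in the field
    attached to another prime ([radical_subfield_inj]).

    To bound the height, which is a product over all places, from below, one needs
    enough places and a lower bound for their local degrees. The p-adic absolute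
    values extend to the algebraic numbers ([padic_absval_exists]): a maximal
    subring omitting 1/p is a valuation ring, and its valuation is real-valued
    because a power of every algebraic number is a power of p up to a unit. The
    places are then obtained from the embeddings of L, and the local degree at a
    place is at least the number of embeddings that induce it ([local_degree_ge]). *)


(** * Absolute values on a field *)

(** The predicate [is_absolute_value] is about number fields; this copy of it
    also applies to the algebraically closed fields that they embed in. *)
Record absval (R : realType) (F : fieldType) (v : F -> R) : Prop := Absval {
  av_ge0 : forall x, 0 <= v x;
  av_eq0 : forall x, v x = 0 <-> x = 0;
  avM : forall x y, v (x * y) = v x * v y;
  avD : forall x y, v (x + y) <= v x + v y }.

Definition ultrametric (R : realType) (F : fieldType) (v : F -> R) : Prop :=
  forall x y, v (x + y) <= Num.max (v x) (v y).

Section AbsvalTheory.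
Variables (R : realType) (F : fieldType) (v : F -> R).
Hypothesis av : absval v.

Lemma av0 : v 0 = 0. Proof. exact/(av_eq0 av). Qed.
Lemma av_gt0 x : x != 0 -> 0 < v x.
Proof.
move=> x0; rewrite lt_neqAle (av_ge0 av) andbT eq_sym.
by apply: contraNneq x0 => /(av_eq0 av) ->.
Qed.
Lemma av1 : v 1 = 1.
Proof.
have /gt_eqF/negbT n0 := av_gt0 (oner_neq0 F).
by apply: (mulfI n0); rewrite -(avM av) !mulr1.
Qed.
Lemma avN x : v (- x) = v x.
Proof.
have : v (- x) ^+ 2 = v x ^+ 2 by rewrite !expr2 -!(avM av) mulrNN.
by move/eqP; rewrite eqrXn2 ?(av_ge0 av) // => /eqP.
Qed.
Lemma avB x y : v (x - y) <= v x + v y.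
Proof. by rewrite -(avN y); apply: (avD av). Qed.
Lemma av_lerB x y : v x - v y <= v (x - y).
Proof. by rewrite lerBlDr -{1}(subrK y x); apply: (avD av). Qed.
Lemma avX x n : v (x ^+ n) = v x ^+ n.
Proof. by elim: n => [|n IHn]; rewrite ?av1 // !exprS (avM av) IHn. Qed.
Lemma avV x : v x^-1 = (v x)^-1.
Proof.
have [->|x0] := eqVneq x 0; first by rewrite invr0 av0 invr0.
have n0 : v x != 0 by rewrite gt_eqF ?av_gt0.
by apply: (mulfI n0); rewrite -(avM av) !divff // av1.
Qed.
Lemma av_div x y : v (x / y) = v x / v y.
Proof. by rewrite (avM av) avV. Qed.
Lemma av_prod I (r : seq I) (P : pred I) (f : I -> F) :
  v (\prod_(i <- r | P i) f i) = \prod_(i <- r | P i) v (f i).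
Proof. by elim/big_rec2: _ => [|i x y _ <-]; rewrite ?av1 // (avM av). Qed.
Lemma av_sum I (r : seq I) (P : pred I) (f : I -> F) :
  v (\sum_(i <- r | P i) f i) <= \sum_(i <- r | P i) v (f i).
Proof.
elim/big_rec2: _ => [|i x y _ h]; first by rewrite av0.
by apply: (le_trans (avD av _ _)); rewrite lerD2l.
Qed.

Section Ultrametric.
Hypothesis um : ultrametric v.

Lemma um_sum I (r : seq I) (P : pred I) (f : I -> F) (c : R) :
  0 <= c -> (forall i, P i -> v (f i) <= c) -> v (\sum_(i <- r | P i) f i) <= c.
Proof.
move=> c0 fc; elim/big_rec: _ => [|i x Pi xc]; first by rewrite av0.
by apply: (le_trans (um _ _)); rewrite ge_max fc.
Qed.

Lemma um_nat n : v n%:R <= 1.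
Proof.
elim: n => [|n IHn]; first by rewrite av0 ler01.
by rewrite -natr1; apply: (le_trans (um _ _)); rewrite ge_max IHn av1 lexx.
Qed.

Lemma um_int (z : int) : v z%:~R <= 1.
Proof. by case: z => n; rewrite ?NegzE ?intrN ?avN; apply: um_nat. Qed.

Lemma umB x y : v (x - y) <= Num.max (v x) (v y).
Proof. by rewrite -(avN y); apply: um. Qed.

Lemma um_strict x y : v x < v y -> v (x + y) = v y.
Proof.
move=> xy; apply/eqP; rewrite eq_le; apply/andP; split.
  by apply: (le_trans (um _ _)); rewrite ge_max lexx (ltW xy).
have := umB (x + y) x; rewrite addrAC subrr add0r le_max => /orP[] //.
by rewrite leNgt xy.
Qed.

(** The largest of several terms of pairwise distinct absolute value cannot
    be cancelled by the others. *)
Lemma um_sum_distinct n (t : 'I_n -> F) :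
  (forall i j, i != j -> t i != 0 -> v (t i) <> v (t j)) ->
  forall i, v (t i) <= v (\sum_j t j).
Proof.
move=> dist i0.
have [i imax] : exists i, forall j, v (t j) <= v (t i).
  by case: (arg_maxP (fun i => v (t i)) (isT : predT i0)) => i _ h; exists i => j; apply: h.
apply: (le_trans (imax i0)).
have [ti0|ti0] := eqVneq (t i) 0; first by rewrite ti0 av0 (av_ge0 av).
rewrite (bigD1 i) //= addrC um_strict //.
have [w [w0 wi wle]] : exists w, [/\ 0 <= w, w < v (t i) &
    forall j, j != i -> v (t j) <= w].
  exists (\big[Num.max/0]_(j | j != i) v (t j)); split.
  - by elim/big_rec: _ => // j x _ x0; rewrite le_max x0 orbT.
  - elim/big_rec: _ => [|j x ji xlt]; first by rewrite av_gt0.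
    rewrite gt_max xlt andbT lt_neqAle imax andbT.
    by apply/eqP => e; apply: (dist i j) => //; rewrite eq_sym.
  - by move=> j ji; rewrite (bigD1 j) //= le_max lexx.
by apply: (le_lt_trans _ wi); apply: um_sum.
Qed.

End Ultrametric.
End AbsvalTheory.

(** * Subrings maximal among those omitting 1/p *)

Section MaximalOrder.
Variables (F : fieldType) (p : nat).
Hypothesis p_neq0 : p%:R != 0 :> F.
Implicit Types (A : set F) (x y : F).

Definition subring1 A : Prop :=
  [/\ A 1, forall x y, A x -> A y -> A (x - y) &
      forall x y, A x -> A y -> A (x * y)].

Definition avoids_inv A : Prop := subring1 A /\ ~ A p%:R^-1.

Section Subring.
Variable A : set F.
Hypothesis A_ring : subring1 A.

Lemma subring1_1 : A 1. Proof. by case: A_ring. Qed.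
Lemma subring1B x y : A x -> A y -> A (x - y).
Proof. by case: A_ring => _ h _; apply: h. Qed.
Lemma subring1M x y : A x -> A y -> A (x * y).
Proof. by case: A_ring => _ _ h; apply: h. Qed.
Lemma subring1_0 : A 0.
Proof. by rewrite -(subrr 1); apply: subring1B; apply: subring1_1. Qed.
Lemma subring1N x : A x -> A (- x).
Proof. by move=> Ax; rewrite -sub0r; apply: subring1B => //; apply: subring1_0. Qed.
Lemma subring1D x y : A x -> A y -> A (x + y).
Proof. by move=> Ax Ay; rewrite -[y]opprK; apply: subring1B => //; apply: subring1N. Qed.
Lemma subring1X x n : A x -> A (x ^+ n).
Proof.
move=> Ax; elim: n => [|n IHn]; first exact: subring1_1.
by rewrite exprS; apply: subring1M.
Qed.
Lemma subring1_sum I (r : seq I) (P : pred I) (f : I -> F) :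
  (forall i, P i -> A (f i)) -> A (\sum_(i <- r | P i) f i).
Proof.
move=> Af; elim/big_rec: _ => [|i x Pi Ax]; first exact: subring1_0.
by apply: subring1D => //; apply: Af.
Qed.
Lemma subring1_nat n : A n%:R.
Proof.
elim: n => [|n IHn]; first exact: subring1_0.
by rewrite -natr1; apply: subring1D => //; apply: subring1_1.
Qed.

Definition adjoin (x : F) : set F :=
  [set y | exists2 q : {poly F}, (forall i, A q`_i) & y = q.[x]].

Lemma adjoin_ring x : subring1 (adjoin x).
Proof.
split.
- exists 1; last by rewrite hornerC.
  by move=> i; rewrite coef1; case: (i == 0)%N; [apply: subring1_1|apply: subring1_0].
- move=> _ _ [q Aq ->] [r Ar ->]; exists (q - r); last by rewrite !hornerE.
  by move=> i; rewrite coefB; apply: subring1B.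
- move=> _ _ [q Aq ->] [r Ar ->]; exists (q * r); last by rewrite !hornerE.
  by move=> i; rewrite coefM; apply: subring1_sum => j _; apply: subring1M.
Qed.

Lemma sub_adjoin x : A `<=` adjoin x.
Proof.
move=> a Aa; exists a%:P; last by rewrite hornerC.
by move=> i; rewrite coefC; case: (i == 0)%N => //; apply: subring1_0.
Qed.

Lemma adjoin_gen x : adjoin x x.
Proof.
exists 'X; last by rewrite hornerX.
by move=> i; rewrite coefX; case: (i == 1)%N; [apply: subring1_1|apply: subring1_0].
Qed.

End Subring.

(** Zorn's lemma, starting from the ring of integers. *)
Lemma exists_maximal_order :
  (forall n : int, n%:~R != p%:R^-1 :> F) ->
  exists A, avoids_inv A /\ forall B, A `<` B -> ~ avoids_inv B.
Proof.
move=> pZ.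
(* The empty set is admitted so that the empty chain has an upper bound. *)
pose P (A : set F) := A = set0 \/ avoids_inv A.
have [|A [PA Amax]] := @Zorn_bigcup F P.
  move=> C PC Ctot.
  have [|C0] := pselect (exists2 X, C X & X !=set0); last first.
    left; apply/seteqP; split => // x [X CX Xx].
    by apply: C0; exists X => //; exists x.
  move=> [X0 CX0 [x0 X0x0]]; right.
  have goodX X x : C X -> X x -> avoids_inv X.
    by move=> CX Xx; case: (PC X CX) => // X_0; rewrite X_0 in Xx.
  have gX0 := goodX _ _ CX0 X0x0.
  have joint x y : (\bigcup_(X in C) X) x -> (\bigcup_(X in C) X) y ->
      exists X, [/\ C X, X x & X y].
    move=> [X CX Xx] [Y CY Yy].
    by case: (Ctot X Y CX CY) => sub; [exists Y | exists X]; split => //; apply: sub.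
  split; first split.
  - by exists X0 => //; case: gX0 => -[].
  - move=> x y Ux Uy; have [X [CX Xx Xy]] := joint x y Ux Uy.
    by exists X => //; apply: (subring1B (goodX _ _ CX Xx).1).
  - move=> x y Ux Uy; have [X [CX Xx Xy]] := joint x y Ux Uy.
    by exists X => //; apply: (subring1M (goodX _ _ CX Xx).1).
  - by move=> [X CX Xp]; case: (goodX _ _ CX Xp).
have goodZ : avoids_inv [set x | exists n : int, x = n%:~R].
  split; last by move=> [n /eqP]; rewrite eq_sym (negPf (pZ n)).
  split; first by exists 1.
  - by move=> _ _ [n ->] [m ->]; exists (n - m); rewrite intrB.
  - by move=> _ _ [n ->] [m ->]; exists (n * m); rewrite intrM.
case: PA => [A0|gA]; last first.
  by exists A; split => // B AB gB; apply: (Amax B AB); right.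
exfalso; apply: (Amax [set x | exists n : int, x = n%:~R]); last by right.
rewrite A0; split; first by move=> x.
by move/(_ 1) => /=; apply; exists 1.
Qed.

Section Maximal.
Variable A : set F.
Hypothesis A_good : avoids_inv A.
Hypothesis A_max : forall B, A `<` B -> ~ avoids_inv B.
Let A_ring := A_good.1.

Lemma adjoin_inv x : ~ A x ->
  exists2 q : {poly F}, (forall i, A q`_i) & q.[x] = p%:R^-1.
Proof.
move=> nAx; apply: contrapT => nq; apply: (A_max (B := adjoin A x)).
  by split; [apply: (sub_adjoin A_ring) | move/(_ x (adjoin_gen A_ring x))].
split; first exact: (adjoin_ring A_ring).
by move=> [q Aq qE]; apply: nq; exists q.
Qed.

(** If the inverse of u = 1 + p a were missing from [A], then by maximality 1/p
    would be a polynomial in 1/u over [A]; clearing denominators puts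
    u ^+ n / p in [A], hence 1/p as well. *)
Lemma one_add_unit a : A a -> A (1 + p%:R * a)^-1 /\ 1 + p%:R * a != 0.
Proof.
move=> Aa; set u := 1 + _.
have u0 : u != 0.
  apply/eqP => u0; apply: A_good.2.
  have : p%:R * (- a) = 1 by rewrite mulrN; apply/eqP; rewrite eq_sym -addr_eq0; apply/eqP.
  move/(congr1 (fun z => p%:R^-1 * z)); rewrite mulrA mulVf // mul1r mulr1 => <-.
  exact: (subring1N A_ring).
split=> //; apply: contrapT => /adjoin_inv [q Aq qE].
have Au : A u.
  apply: (subring1D A_ring); first exact: (subring1_1 A_ring).
  by apply: (subring1M A_ring) => //; apply: (subring1_nat A_ring).
(* Multiply by u ^+ n, which is 1 modulo p. *)
have [n qn] : exists n, (size q <= n)%N by exists (size q).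
have Aun : A (u ^+ n / p%:R).
  rewrite -qE (horner_coef_wide _ qn) mulr_sumr; apply: (subring1_sum A_ring) => i _.
  rewrite exprVn mulrCA; apply: (subring1M A_ring) => //.
  rewrite -{1}(subnKC (ltnW (ltn_ord i))) exprD mulrAC mulfV ?expf_neq0 // mul1r.
  exact: (subring1X A_ring).
have [c Ac cE] : exists2 c, A c & u ^+ n = 1 + p%:R * c.
  elim: n {qn Aun} => [|n [c Ac IHn]].
    by exists 0; [apply: (subring1_0 A_ring) | rewrite mulr0 addr0].
  exists (a + c * u); last by rewrite exprSr IHn /u; ring.
  by apply: (subring1D A_ring) => //; apply: (subring1M A_ring).
apply: A_good.2.
have -> : p%:R^-1 = u ^+ n / p%:R - c by rewrite cE mulrDl mul1r mulrAC mulfV // mul1r addrK.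
exact: (subring1B A_ring).
Qed.

Definition inv_rel x n := exists2 q : {poly F},
  (forall i, A q`_i) & (size q <= n.+1)%N /\ q.[x] = p%:R^-1.

Lemma inv_rel0 x : ~ inv_rel x 0.
Proof.
move=> [q Aq [sq qE]]; apply: A_good.2; rewrite -qE.
by rewrite (horner_coef_wide _ sq) big_ord1 expr0 mulr1.
Qed.

(** In a relation 1/p = r(1/x) the constant term is p times an element of [A]
    away from 1, so it can be divided out: the top power of x becomes p times a
    combination of lower ones and lowers the degree of a relation in x. *)
Lemma inv_rel_step x n m : x != 0 -> inv_rel x n.+1 -> inv_rel x^-1 m.+1 ->
  (m <= n)%N -> inv_rel x n.
Proof.
move=> x0 [q Aq [sq qE]] [r Ar [sr rE]] mn.
have [Aw w0] := one_add_unit (subring1N A_ring (Ar 0%N)).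
set w := 1 + _ in Aw w0.
(* The second relation rewrites x ^+ m.+1 in terms of lower powers. *)
have xm : x ^+ m.+1 = w^-1 * (p%:R * \sum_(i < m.+1) r`_i.+1 * x ^+ (m - i)).
  apply: (mulfI w0); rewrite mulrA mulfV // mul1r /w mulrDl mul1r.
  have e : p%:R * r.[x^-1] * x ^+ m.+1 = x ^+ m.+1 by rewrite rE mulfV // mul1r.
  rewrite -[X in X + _]e (horner_coef_wide _ sr) big_ord_recl expr0 mulr1 mulrDr mulrDl.
  rewrite mulrN mulNr addrAC subrr add0r -mulrA; congr (_ * _).
  rewrite mulr_suml; apply: eq_bigr => i _; rewrite lift0 -mulrA; congr (_ * _).
  have -> : x ^+ m.+1 = x ^+ i.+1 * x ^+ (m - i).
    by rewrite -exprD; congr (_ ^+ _); have := ltn_ord i; lia.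
  by rewrite mulrA -exprMn mulVf // expr1n mul1r.
pose low := \poly_(i < n.+1) q`_i.
pose s := \sum_(i < m.+1) (w^-1 * r`_i.+1) *: 'X^(n - i) : {poly F}.
exists (low + (q`_n.+1 * p%:R) *: s).
  have As i : A s`_i.
    rewrite coef_sum; apply: (subring1_sum A_ring) => j _; rewrite coefZ coefXn.
    apply: (subring1M A_ring); first exact: (subring1M A_ring).
    exact: (subring1_nat A_ring).
  move=> i; rewrite coefD coefZ coef_poly; apply: (subring1D A_ring).
    by case: ifP => _ //; apply: (subring1_0 A_ring).
  apply: (subring1M A_ring) => //; apply: (subring1M A_ring) => //.
  exact: (subring1_nat A_ring).
split.
  apply: (leq_trans (size_polyD _ _)); rewrite geq_max size_poly /=.
  apply: (leq_trans (size_scale_leq _ _)); apply: (leq_trans (size_sum _ _ _)).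
  apply/bigmax_leqP => i _; apply: (leq_trans (size_scale_leq _ _)).
  by rewrite size_polyXn ltnS leq_subr.
rewrite hornerD hornerZ -qE (horner_coef_wide _ sq) big_ord_recr /= horner_poly.
congr (_ + _); rewrite -mulrA; congr (_ * _).
have -> : x ^+ n.+1 = x ^+ (n - m) * x ^+ m.+1 by rewrite -exprD; congr (_ ^+ _); lia.
rewrite xm horner_sum !mulr_sumr; apply: eq_bigr => i _.
rewrite hornerZ hornerXn.
have -> : (n - i = n - m + (m - i))%N by have := ltn_ord i; lia.
by rewrite exprD; ring.
Qed.

(** Chevalley's argument: otherwise 1/p would be a polynomial both in x and in
    1/x, and the two relations would lower each other's degree to 0. *)
Lemma maximal_valuation_ring x : x != 0 -> A x \/ A x^-1.
Proof.
move=> x0; have [|nAx] := pselect (A x); first by left.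
have [|nAx'] := pselect (A x^-1); first by right.
have rel y : ~ A y -> exists n, inv_rel y n.
  move=> /adjoin_inv [q Aq qE]; exists (size q); exists q => //.
have [n xn] := rel _ nAx; have [m xm] := rel _ nAx'; exfalso.
have [N] := ubnP (n + m)%N; elim: N => // N IHN in n m xn xm *.
case: n xn => [/inv_rel0 //|n xn]; case: m xm => [/inv_rel0 //|m xm] nmN.
have [mn|/ltnW nm] := leqP m n.
  by apply: (IHN n m.+1); [exact: inv_rel_step x0 xn xm mn | exact: xm | lia].
apply: (IHN n.+1 m) => //; last by lia.
by apply: inv_rel_step (invr_neq0 x0) xm _ nm; rewrite invrK.
Qed.

End Maximal.
End MaximalOrder.

(** * The p-adic absolute values on the algebraic numbers *)

Section PadicNumbers.
Variables (R : realType) (p : nat).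
Hypothesis p_prime : prime p.
Local Notation F := algC.
Local Notation P := (p%:R : R).

Let p_gt0 : (0 < p)%N. Proof. exact: prime_gt0. Qed.
Let pF : p%:R != 0 :> F. Proof. by rewrite pnatr_eq0 -lt0n. Qed.
Let P_gt1 : 1 < P. Proof. by rewrite ltr1n prime_gt1. Qed.
Let P_gt0 : 0 < P. Proof. exact: lt_trans P_gt1. Qed.

Lemma p_inv_not_int (n : int) : n%:~R != p%:R^-1 :> F.
Proof.
apply/eqP => nE; have : (n * p%:Z)%:~R = 1%:~R :> F.
  by rewrite intrM nE -[p%:Z%:~R]/(p%:R) mulVf.
move/intr_inj => e.
have : (p %| absz (n * p%:Z)%R)%N by rewrite abszM dvdn_mull.
by rewrite e /= dvdn1; case: p p_prime => [|[|]].
Qed.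

Section Valuation.
Variable A : set F.
Hypothesis A_good : avoids_inv p A.
Hypothesis A_max : forall B, A `<` B -> ~ avoids_inv p B.
Let A_ring := A_good.1.

Definition vunit (x : F) := [/\ x != 0, A x & A x^-1].

Lemma vunit1 : vunit 1.
Proof. by split; rewrite ?invr1 ?oner_eq0 //; apply: (subring1_1 A_ring). Qed.
Lemma vunitM x y : vunit x -> vunit y -> vunit (x * y).
Proof.
move=> [x0 Ax Ax'] [y0 Ay Ay']; split; first exact: mulf_neq0.
  exact: (subring1M A_ring).
by rewrite invfM; apply: (subring1M A_ring).
Qed.
Lemma vunitV x : vunit x -> vunit x^-1.
Proof. by move=> [x0 Ax Ax']; split; rewrite ?invr_eq0 ?invrK. Qed.
Lemma vunitX x n : vunit x -> vunit (x ^+ n).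
Proof.
move=> ux; elim: n => [|n IHn]; first exact: vunit1.
by rewrite exprS; apply: vunitM.
Qed.
Lemma vunit_div x y : vunit x -> vunit y -> vunit (x / y).
Proof. by move=> ux uy; apply: vunitM => //; apply: vunitV. Qed.

Lemma vunitN x : vunit x -> vunit (- x).
Proof. by move=> [x0 Ax Ax']; split; rewrite ?oppr_eq0 ?invrN //; apply: (subring1N A_ring). Qed.

Lemma vunit_addl u a : vunit u -> A a -> ~ vunit a -> vunit (u + a).
Proof.
move=> [u0 Au Au'] Aa na.
have s0 : u + a != 0.
  apply/eqP => e; apply: na; have -> : a = - u by apply/eqP; rewrite -addr_eq0 addrC e.
  exact: vunitN.
have As : A (u + a) by apply: (subring1D A_ring).
split=> //; have [->|a0] := eqVneq a 0; first by rewrite addr0.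
have uE : u = (u + a) * (1 - a / (u + a)) by rewrite mulrBr mulr1 mulrCA divff // mulr1 addrK.
have uE' : u = a * ((u + a) / a - 1) by rewrite mulrBr mulr1 mulrCA divff // mulr1 addrK.
case: (maximal_valuation_ring pF A_good A_max (x := a / (u + a))).
- by rewrite mulf_neq0 ?invr_eq0.
- move=> h; have -> : (u + a)^-1 = u^-1 * (1 - a / (u + a)).
    have t0 : 1 - a / (u + a) != 0 by apply: contraNneq u0 => t0; rewrite {1}uE t0 mulr0.
    have -> : u^-1 = (u + a)^-1 / (1 - a / (u + a)) by rewrite -invfM -uE.
    by rewrite divfK.
  by apply: (subring1M A_ring) => //; apply: (subring1B A_ring) => //; apply: (subring1_1 A_ring).
- rewrite invf_div => h; exfalso; apply: na; split=> //.
  have -> : a^-1 = u^-1 * ((u + a) / a - 1).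
    have t0 : (u + a) / a - 1 != 0 by apply: contraNneq u0 => t0; rewrite {1}uE' t0 mulr0.
    have -> : u^-1 = a^-1 / ((u + a) / a - 1) by rewrite -invfM -uE'.
    by rewrite divfK.
  by apply: (subring1M A_ring) => //; apply: (subring1B A_ring) => //; apply: (subring1_1 A_ring).
Qed.

(** From u k = 1 + p v one gets 1/k = u / (1 + p v). *)
Lemma vunit_nat k : coprime k p -> vunit k%:R.
Proof.
have [->|k_gt0] := posnP k.
  by rewrite /coprime gcd0n => /eqP p1; move: p_prime; rewrite p1.
move=> kp; split; first by rewrite pnatr_eq0 -lt0n.
  exact: (subring1_nat A_ring).
case: (egcdnP p k_gt0) => u v; rewrite (eqP kp) => E _.
have [Aw w0] := one_add_unit pF A_good A_max (subring1_nat A_ring v).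
have -> : k%:R^-1 = u%:R * (1 + p%:R * v%:R)^-1 :> F.
  have k0 : k%:R != 0 :> F by rewrite pnatr_eq0 -lt0n.
  apply: (mulfI k0); rewrite divff // mulrA; apply/esym/(canLR (mulfK w0)).
  by rewrite mul1r -(natrM _ k) mulnC E natrD natrM; ring.
by apply: (subring1M A_ring) => //; apply: (subring1_nat A_ring).
Qed.

Lemma vunit_pow (z : int) : vunit (p%:R ^ z) -> z = 0.
Proof.
suff H (n : nat) : vunit (p%:R ^+ n.+1) -> False.
  case: z => [[|n]|n] //; first by move/H.
  by rewrite NegzE -exprnN => /vunitV; rewrite invrK => /H.
move=> [_ _ h]; apply: A_good.2.
have -> : p%:R^-1 = p%:R ^+ n * (p%:R ^+ n.+1)^-1 :> F.
  by rewrite exprS invfM mulrCA divff ?mulr1 // expf_neq0.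
by apply: (subring1M A_ring) => //; apply: (subring1X A_ring); apply: (subring1_nat A_ring).
Qed.

Lemma pow_in_A (z : int) : A (p%:R ^ z) -> 0 <= z.
Proof.
case: z => // n; rewrite NegzE -exprnN => h; exfalso; apply: A_good.2.
have -> : p%:R^-1 = p%:R ^+ n * (p%:R ^+ n.+1)^-1 :> F.
  by rewrite exprS invfM mulrCA divff ?mulr1 // expf_neq0.
by apply: (subring1M A_ring) => //; apply: (subring1X A_ring); apply: (subring1_nat A_ring).
Qed.

Lemma nat_val n : (0 < n)%N -> vunit (n%:R / p%:R ^+ logn p n).
Proof.
move=> n0; have [m cpm nE] := pfactor_coprime p_prime n0.
have -> : n%:R / p%:R ^+ logn p n = m%:R :> F.
  by rewrite {1}nE natrM natrX mulfK // expf_neq0.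
by apply: vunit_nat; rewrite coprime_sym.
Qed.

Lemma rat_val (q : rat) : q != 0 ->
  exists2 z : int, vunit (ratr q / p%:R ^ z) & padic_abs R p q = P ^ (- z).
Proof.
move=> q0; exists ((logn p `|numq q|)%:Z - (logn p `|denq q|)%:Z); last first.
  rewrite /padic_abs (negPf q0) opprB expfzDr ?gt_eqF //.
  by rewrite -!exprnP -exprnN.
have nn : (0 < `|numq q|)%N by rewrite absz_gt0 numq_eq0.
have dd : (0 < `|denq q|)%N by rewrite absz_gt0 denq_eq0.
rewrite expfzDr // -exprnN -exprnP.
have [a aE] : exists a : bool, ratr q = (-1) ^+ a * (`|numq q|%:R / `|denq q|%:R) :> F.
  exists (numq q < 0); rewrite -{1}[q]divq_num_den rmorphM /= fmorphV /= !ratr_int.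
  rewrite mulrA; congr (_ / _).
    by rewrite {1}[numq q]intEsign intrM rmorph_sign /= .
  by rewrite -[in LHS](absz_denq q).
have -> : ratr q / (p%:R ^+ logn p `|numq q| * (p%:R ^+ logn p `|denq q|)^-1) =
   (-1) ^+ a * ((`|numq q|%:R / p%:R ^+ logn p `|numq q|) /
                (`|denq q|%:R / p%:R ^+ logn p `|denq q|)) :> F.
  by rewrite aE !invfM !invrK; ring.
have u : vunit ((-1) ^+ a) by apply: vunitX; apply: vunitN; apply: vunit1.
by apply: vunitM => //; apply: vunit_div; apply: nat_val.
Qed.

(** The terms are totally ordered by divisibility in [A], and a term which no
    other one matches up to a unit cannot be cancelled. *)
Lemma dominant_term (n : nat) (t : nat -> F) :
  (forall i j, (i < j < n)%N -> t i != 0 -> t j != 0 -> ~ vunit (t j / t i)) ->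
  (exists2 i, (i < n)%N & t i != 0) -> \sum_(i < n) t i != 0.
Proof.
move=> nu ex.
suff : (forall i, (i < n)%N -> t i = 0) \/
    exists i, [/\ (i < n)%N, t i != 0 & vunit ((\sum_(i < n) t i) / t i)].
  case=> [z|[i [_ ti [s0 _ _]]]]; first by case: ex => i /z ->; rewrite eqxx.
  by apply: contraNneq s0 => ->; rewrite mul0r.
elim: n nu {ex} => [|n IHn] nu; first by left.
rewrite big_ord_recr /=.
have [tn|tn] := eqVneq (t n) 0.
  have [i j /andP[ij jn]|z|[i [ilt ti ui]]] := IHn.
  - by apply: nu; rewrite ij ltnS ltnW.
  - by left=> i; rewrite ltnS leq_eqVlt => /predU1P[->|/z].
  - by right; exists i; rewrite tn addr0 ltnS ltnW.
have [i j /andP[ij jn]|z|[i [ilt ti ui]]] := IHn.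
- by apply: nu; rewrite ij ltnS ltnW.
- right; exists n; split=> //; rewrite big1 ?add0r ?divff //; first exact: vunit1.
  by move=> i _; apply: z.
right; have r0 : t n / t i != 0 by rewrite mulf_neq0 ?invr_eq0.
have nr : ~ vunit (t n / t i) by apply: nu => //; rewrite ilt ltnSn.
case: (maximal_valuation_ring pF A_good A_max r0) => [Ar|Ar].
  by exists i; split=> //; [rewrite ltnS ltnW | rewrite mulrDl; apply: vunit_addl].
exists n; split=> //; rewrite mulrDl divff // addrC.
have -> : (\sum_(i < n) t i) / t n = (\sum_(i < n) t i) / t i * (t n / t i)^-1.
  by rewrite invf_div -mulrA (mulrA (t i)^-1) mulVf ?mul1r.
rewrite invf_div in Ar *; apply: vunit_addl; first exact: vunit1.
  by case: ui => _ Au _; apply: (subring1M A_ring).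
move=> h; apply: nr; rewrite -invf_div; apply: vunitV.
have -> : t i / t n = ((\sum_(i < n) t i) / t i)^-1 * ((\sum_(i < n) t i) / t i * (t i / t n)).
  by rewrite mulKf //; case: ui.
by apply: vunitM => //; apply: vunitV.
Qed.

(** Two terms of an equation of x over the rationals must be unit multiples of
    each other, so a power of x is a power of p up to a unit. This makes the
    valuation real-valued. *)
Lemma power_val x : x != 0 ->
  exists nz : nat * int, (0 < nz.1)%N /\ vunit (x ^+ nz.1 / p%:R ^ nz.2).
Proof.
move=> x0; apply: contrapT => nex.
have [f f_monic fx] := algC_algebraic x.
suff : \sum_(i < size f) ratr f`_i * x ^+ i != 0.
  move: fx; rewrite /root (horner_coef_wide _ (leqnn _)) size_map_poly => /eqP fx.
  by under eq_bigr do rewrite -coef_map; rewrite fx eqxx.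
apply: (@dominant_term (size f) (fun i => ratr f`_i * x ^+ i)) => [i j /andP[ij _] ti tj u|].
- have coef_neq0 a k : ratr a * x ^+ k != 0 -> a != 0.
    by apply: contraNneq => ->; rewrite rmorph0 mul0r.
  have [fi fj] := (coef_neq0 _ _ ti, coef_neq0 _ _ tj).
  have [zi ui _] := rat_val fi; have [zj uj _] := rat_val fj.
  apply: nex; exists ((j - i)%N, zi - zj); split; rewrite /= ?subn_gt0 //.
  have := vunitM u (vunit_div ui uj); congr vunit => /=.
  have pz z : p%:R ^ z != 0 :> F by rewrite expfz_neq0.
  have -> : x ^+ j = x ^+ (j - i) * x ^+ i by rewrite -exprD subnK // ltnW.
  rewrite expfzDr // -invr_expz; field.
  by rewrite !pz expf_neq0 ?(fmorph_eq0 (ratr : rat -> algC)) ?fi ?fj.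
- exists (size f).-1; first by rewrite prednK // size_poly_gt0 monic_neq0.
  by rewrite mulf_neq0 ?expf_neq0 // fmorph_eq0 -lead_coefE (monicP f_monic) oner_eq0.
Qed.

Definition padic_exponents x (x0 : x != 0) := projT1 (cid (power_val x0)).

(** If x ^+ n is a unit times p ^ z then x has size p ^ (- z / n). *)
Definition padic_size x : R :=
  match pselect (x != 0) with
  | left x0 => P `^ (- ((padic_exponents x0).2%:~R / (padic_exponents x0).1%:R))
  | right _ => 0
  end.

Lemma pow_quotX x n (z : int) m :
  (x ^+ n / p%:R ^ z) ^+ m = x ^+ (n * m) / p%:R ^ (z * m) :> F.
Proof. by rewrite expr_div_n -exprM; congr (_ / _); rewrite exprnP exprz_exp. Qed.

Lemma padic_sizeE x n z : (0 < n)%N -> x != 0 -> vunit (x ^+ n / p%:R ^ z) ->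
  padic_size x = P `^ (- (z%:~R / n%:R)).
Proof.
move=> n0 x0 u; rewrite /padic_size; case: pselect => // x0'.
rewrite /padic_exponents; case: cid => -[n' z'] /= [n0' u'].
congr (_ `^ - _); apply/eqP; rewrite eqr_div ?pnatr_eq0 -?lt0n //.
have zz : z' * n%:Z - z * n'%:Z = 0.
  apply: vunit_pow; have := vunit_div (vunitX n' u) (vunitX n u').
  rewrite !pow_quotX mulnC; congr vunit; rewrite expfzDr // -invr_expz.
  by field; rewrite !expfz_neq0 // expf_neq0.
by move/eqP: zz; rewrite subr_eq0 => /eqP zz; rewrite -!(intrM R _ _%:Z) zz.
Qed.

Lemma padic_size_spec x : x != 0 -> exists nz : nat * int,
  [/\ (0 < nz.1)%N, vunit (x ^+ nz.1 / p%:R ^ nz.2) &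
      padic_size x = P `^ (- (nz.2%:~R / nz.1%:R))].
Proof.
move=> x0; have [[n z] [/= n0 u]] := power_val x0.
by exists (n, z); split=> //=; apply: padic_sizeE.
Qed.

Lemma padic_size0 : padic_size 0 = 0.
Proof. by rewrite /padic_size; case: pselect => // x0; case: (negP x0). Qed.

Lemma padic_size_gt0 x : x != 0 -> 0 < padic_size x.
Proof. by move=> x0; have [nz [_ _ ->]] := padic_size_spec x0; apply: powR_gt0. Qed.

Lemma padic_sizeM x y : padic_size (x * y) = padic_size x * padic_size y.
Proof.
have [->|x0] := eqVneq x 0; first by rewrite mul0r padic_size0 mul0r.
have [->|y0] := eqVneq y 0; first by rewrite mulr0 padic_size0 mulr0.
have [[n z] /= [n0 u ->]] := padic_size_spec x0.
have [[m w] /= [m0 t ->]] := padic_size_spec y0.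
rewrite (@padic_sizeE _ (n * m) (z * m%:Z + w * n%:Z)) ?muln_gt0 ?n0 ?mulf_neq0 //.
  rewrite -powRD ?(gt_eqF P_gt0) ?implybT //; congr (_ `^ _).
  rewrite natrM intrD !intrM; field.
  by rewrite !pnatr_eq0 -!lt0n n0 m0.
have := vunitM (vunitX m u) (vunitX n t); congr vunit.
rewrite !pow_quotX exprMn expfzDr // (mulnC m n).
by field; rewrite ?expf_neq0 ?expfz_neq0.
Qed.

Lemma padic_size_le1 x : x != 0 -> padic_size x <= 1 <-> A x.
Proof.
move=> x0; have [[n z] /= [n0 [u0 Au Au'] ->]] := padic_size_spec x0.
have pz : p%:R ^ z != 0 :> F by rewrite expfz_neq0.
have xnE : x ^+ n = x ^+ n / p%:R ^ z * p%:R ^ z by rewrite divfK.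
have zE : p%:R ^ z = x ^+ n * (x ^+ n / p%:R ^ z)^-1 by rewrite invf_div mulrCA divff ?mulr1 ?expf_neq0.
split=> [le1|Ax]; last first.
  have z0 : 0 <= z.
    apply: pow_in_A; rewrite zE; apply: (subring1M A_ring) => //.
    exact: (subring1X A_ring).
  rewrite -[leRHS](powRr0 P); apply: ler_powR; first exact: ltW.
  by rewrite oppr_le0 divr_ge0 ?ler0z.
have z0 : 0 <= z.
  rewrite leNgt; apply/negP => z0; move: le1; rewrite leNgt => /negP; apply.
  have n0' : n%:R != 0 :> R by rewrite pnatr_eq0 -lt0n.
  rewrite -mulNr powRrM.
  suff : 1 `^ n%:R^-1 < (P `^ (- z%:~R)) `^ n%:R^-1 by rewrite powR1.
  apply: gt0_ltr_powR.
  - by rewrite invr_gt0 ltr0n.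
  - by rewrite nnegrE.
  - by rewrite nnegrE powR_ge0.
  - rewrite -intrN powR_intmul; last exact: ltW.
    by case: {+}z z0 => // k _; rewrite NegzE opprK -exprnP exprn_egt1.
have Axn : A (x ^+ n).
  rewrite xnE; apply: (subring1M A_ring) => //; case: {+}z z0 => // k _.
  by apply: (subring1X A_ring); apply: (subring1_nat A_ring).
have [//|Ax'] := maximal_valuation_ring pF A_good A_max x0.
have -> : x = x ^+ n * x^-1 ^+ n.-1.
  by rewrite -{1}(prednK n0) exprS -mulrA -exprMn divff // expr1n mulr1.
by apply: (subring1M A_ring) => //; apply: (subring1X A_ring).
Qed.

Lemma padic_size_max x y : padic_size (x + y) <= Num.max (padic_size x) (padic_size y).
Proof.
wlog xy : x y / padic_size x <= padic_size y.
  move=> H; have [xy|/ltW yx] := leP (padic_size x) (padic_size y).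
    by have := H x y xy; rewrite (max_r xy).
  by have := H y x yx; rewrite addrC (max_r yx).
have ge0 t : 0 <= padic_size t.
  by have [->|/padic_size_gt0/ltW//] := eqVneq t 0; rewrite padic_size0.
have [y0|y0] := eqVneq y 0.
  by rewrite y0 addr0 le_max lexx.
have [s0|s0] := eqVneq (x + y) 0; first by rewrite s0 padic_size0 le_max ge0.
have sE : x + y = (x / y + 1) * y by rewrite mulrDl mul1r divfK.
rewrite sE padic_sizeM le_max; apply/orP; right.
rewrite ler_piMl //; apply/padic_size_le1; first by move: s0; rewrite sE mulf_eq0 => /norP[].
apply: (subring1D A_ring); last exact: (subring1_1 A_ring).
have [->|x0] := eqVneq x 0; first by rewrite mul0r; apply: (subring1_0 A_ring).
apply/padic_size_le1; first by rewrite mulf_neq0 ?invr_eq0.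
rewrite -(ler_pM2r (padic_size_gt0 y0)) -padic_sizeM divfK ?mul1r //.
Qed.

Lemma padic_size_rat q : padic_size (ratr q) = padic_abs R p q.
Proof.
have [->|q0] := eqVneq q 0; first by rewrite rmorph0 padic_size0 /padic_abs eqxx.
have [z u ->] := rat_val q0.
rewrite (@padic_sizeE _ 1 z) ?fmorph_eq0 ?expr1 //.
by rewrite divr1 -intrN powR_intmul // ltW.
Qed.

End Valuation.

(** The extension is read off from the valuation ring of a maximal subring that
    omits 1/p. *)
Theorem padic_absval_exists : exists w : F -> R,
  [/\ absval w, ultrametric w & forall q : rat, w (ratr q) = padic_abs R p q].
Proof.
have [A [A_good A_max]] := exists_maximal_order p_inv_not_int.
exists (padic_size A_good A_max); split; last exact: (padic_size_rat A_good A_max).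
  split.
  - move=> x; have [->|/(padic_size_gt0 A_good A_max)/ltW //] := eqVneq x 0.
    by rewrite padic_size0.
  - move=> x; split=> [x0|->]; last by rewrite padic_size0.
    by apply: contraPeq x0 => /(padic_size_gt0 A_good A_max)/gt_eqF/eqP.
  - exact: (padic_sizeM A_good A_max).
  - move=> x y; apply: (le_trans (padic_size_max A_good A_max _ _)).
    have ge0 t : 0 <= padic_size A_good A_max t.
      by have [->|/(padic_size_gt0 A_good A_max)/ltW//] := eqVneq t 0; rewrite padic_size0.
    by rewrite ge_max lerDl lerDr !ge0.
exact: (padic_size_max A_good A_max).
Qed.

End PadicNumbers.

(** * Weak approximation *)

Definition eventually_nat (P : nat -> Prop) : Prop :=
  exists N, forall k, (N <= k)%N -> P k.

Lemma eventually_and (P Q : nat -> Prop) :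
  eventually_nat P -> eventually_nat Q -> eventually_nat (fun k => P k /\ Q k).
Proof.
move=> [N hN] [M hM]; exists (maxn N M) => k; rewrite geq_max => /andP[Nk Mk].
by split; [apply: hN | apply: hM].
Qed.

Lemma eventually_all (T : eqType) (s : seq T) (P : T -> nat -> Prop) :
  (forall x, x \in s -> eventually_nat (P x)) ->
  eventually_nat (fun k => forall x, x \in s -> P x k).
Proof.
elim: s => [|a s IHs] h; first by exists 0%N.
have [|N hN] := IHs; first by move=> x xs; apply: h; rewrite inE xs orbT.
have [M hM] := h a (mem_head a s).
exists (maxn N M) => k; rewrite geq_max => /andP[Nk Mk] x.
by rewrite inE => /predU1P[->|xs]; [apply: hM | apply: hN].
Qed.

Lemma eventually_exists (P : nat -> Prop) : eventually_nat P -> exists k, P k.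
Proof. by case=> N hN; exists N; apply: hN. Qed.

Section Powers.
Import numFieldNormedType.Exports.
Variable R : realType.

Lemma eventually_exp_lt (t e : R) : 0 <= t -> t < 1 -> 0 < e ->
  eventually_nat (fun k => t ^+ k < e).
Proof.
move=> t0 t1 e0.
have /cvgrPdist_lt/(_ e e0)[N _ hN] : (t ^+ n) @[n --> \oo] --> (0 : R).
  by apply: cvg_expr; rewrite ger0_norm.
exists N => k /hN /=; rewrite sub0r normrN ger0_norm //; exact: exprn_ge0.
Qed.

Lemma eventually_exp_gt (t e : R) : 1 < t -> eventually_nat (fun k => e < t ^+ k).
Proof.
move=> t1; have t0 : 0 < t := lt_trans ltr01 t1.
have [N hN] := @eventually_exp_lt t^-1 (Num.max e 1)^-1
  ltac:(by rewrite invr_ge0 ltW) ltac:(by rewrite invf_lt1)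
  ltac:(by rewrite invr_gt0 lt_max ltr01 orbT).
exists N => k /hN; rewrite exprVn ltf_pV2 ?posrE ?exprn_gt0 //; last first.
  by rewrite lt_max ltr01 orbT.
by apply: le_lt_trans; rewrite le_max lexx.
Qed.

Lemma power_between (P a : R) : 1 < P -> 0 < a ->
  exists k : int, a < P ^ k /\ P ^ k <= P * a.
Proof.
move=> P1 a0; have P0 : 0 < P := lt_trans ltr01 P1.
have [N aN] := eventually_exists (eventually_exp_gt a^-1 P1).
have b1 : 1 <= a * P ^+ N by rewrite mulrC -ler_pdivrMr // div1r ltW.
have [k0 hk0] := eventually_exists (eventually_exp_gt (a * P ^+ N) P1).
have [k kgt kmin] := ex_minnP (ex_intro (fun k => a * P ^+ N < P ^+ k) k0 hk0).
exists (k%:Z - N%:Z); rewrite expfzDr ?gt_eqF // -invr_expz -!exprnP.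
have PN : 0 < P ^+ N by rewrite exprn_gt0.
rewrite ltr_pdivlMr // ler_pdivrMr //; split=> //.
case: k kgt kmin => [|k] kgt kmin; first by move: kgt; rewrite expr0 ltNge b1.
rewrite exprS -mulrA ler_pM2l // leNgt; apply/negP => /kmin.
by rewrite ltnn.
Qed.

End Powers.

Section Cutoff.
Variables (R : realType) (F : fieldType) (v : F -> R).
Hypothesis av : absval v.

(** For large k this is close to 1 where x has size above 1, and close to 0
    where x has size below 1. *)
Definition cutoff (x : F) (k : nat) : F := x ^+ k / (1 + x ^+ k).

Lemma cutoff_to1 x e : 1 < v x -> 0 < e ->
  eventually_nat (fun k => v (1 - cutoff x k) < e).
Proof.
move=> vx e0; have [N hN] := eventually_exp_gt (1 + e^-1) vx.
exists N => k /hN hk; have e0' : 0 < e^-1 by rewrite invr_gt0.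
have lb : e^-1 < v (1 + x ^+ k).
  have := av_lerB av (x ^+ k) (- 1); rewrite opprK (avN av) (av1 av) (avX av) (addrC _ 1).
  by apply: lt_le_trans; rewrite ltrBrDl.
have s0 : 1 + x ^+ k != 0 by apply: contraTneq lb => ->; rewrite (av0 av) -leNgt ltW.
have -> : 1 - cutoff x k = (1 + x ^+ k)^-1.
  by rewrite /cutoff -[X in X - _](divff s0) -mulrBl addrK mul1r.
by rewrite (avV av) invf_plt // posrE av_gt0.
Qed.

Lemma cutoff_to0 x e : v x < 1 -> 0 < e ->
  eventually_nat (fun k => v (cutoff x k) < e).
Proof.
move=> vx e0; have d0 : 0 < Num.min 1 e / 2 by rewrite divr_gt0 // lt_min ltr01.
have [N hN] := eventually_exp_lt (av_ge0 av x) vx d0.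
exists N => k /hN hk; have := av_lerB av 1 (- x ^+ k).
rewrite opprK (avN av) (av1 av) (avX av) => lb.
have [m1 me] : Num.min 1 e <= 1 /\ Num.min 1 e <= e by rewrite !ge_min !lexx orbT.
have lb' : 2^-1 < v (1 + x ^+ k) by lra.
have s0 : 0 < v (1 + x ^+ k) by lra.
rewrite /cutoff (av_div av) (avX av) ltr_pdivrMr //; nra.
Qed.

End Cutoff.

Section WeakApproximation.
Variables (R : realType) (K : fieldExtType rat) (f : rat -> R) (q0 : rat).
Hypothesis f_q0 : 1 < f q0.

Definition lies_above (v : K -> R) : Prop :=
  absval v /\ forall q : rat, v q%:A = f q.

(** Take x with u x < v x. A high power of v x / u x exceeds the value at [q0],
    so an integral power of that value fits between powers of u x and v x. *)
Lemma separate2 v u : lies_above v -> lies_above u -> u <> v ->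
  exists y, 1 < v y /\ u y < 1.
Proof.
move=> [av vf] [au uf] uv.
have [x xlt] : exists x, u x < v x.
  have /existsNP[x /eqP] : ~ forall x, u x = v x by move=> h; apply: uv; apply/funext.
  rewrite neq_lt => /orP[h|h]; first by exists x.
  have x0 : x != 0 by apply: contraTneq h => ->; rewrite (av0 au) (av0 av) ltxx.
  by exists x^-1; rewrite (avV au) (avV av) ltf_pV2 ?posrE ?av_gt0.
have x0 : x != 0 by apply: contraTneq xlt => ->; rewrite (av0 au) (av0 av) ltxx.
have ux0 := av_gt0 au x0; have P0 : 0 < f q0 := lt_trans ltr01 f_q0.
have [n hn] : exists n, f q0 < (v x / u x) ^+ n.
  by apply/eventually_exists/eventually_exp_gt; rewrite ltr_pdivlMr ?mul1r.
have [k [k1 k2]] := power_between f_q0 (exprn_gt0 n ux0).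
have avq (w : K -> R) : lies_above w -> w (q0%:A ^ k) = f q0 ^ k.
  move=> [aw wf]; case: k {k1 k2} => m; first by rewrite -!exprnP (avX aw) wf.
  by rewrite NegzE -!invr_expz (avV aw) -!exprnP (avX aw) wf.
exists (x ^+ n / q0%:A ^ k); rewrite (av_div av) (av_div au) !avq //.
rewrite (avX av) (avX au) ltr_pdivlMr ?ltr_pdivrMr ?exprz_gt0 // !mul1r; split=> //.
apply: (le_lt_trans k2); rewrite -ltr_pdivlMr ?exprn_gt0 //.
by rewrite -expr_div_n.
Qed.

(** One more place w is added to a separating x by means of y with
    w y < 1 < v y: multiply y by a power of x, or, if x is large at w, by a
    [cutoff] of x. *)
Lemma separate v (us : seq (K -> R)) : lies_above v ->
  (forall u, u \in us -> lies_above u /\ u <> v) ->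
  exists y, 1 < v y /\ forall u, u \in us -> u y < 1.
Proof.
move=> Lv; elim: us => [|w us IHus] h.
  by exists q0%:A; rewrite (Lv.2).
have [|x [vx ux]] := IHus; first by move=> u uus; apply: h; rewrite inE uus orbT.
have [Lw wv] := h w (mem_head w us).
have [y [vy wy]] := separate2 Lv Lw wv.
have Lu u : u \in us -> lies_above u by move=> uus; apply: (h u _).1; rewrite inE uus orbT.
have [av aw] := (Lv.1, Lw.1).
have vx0 := lt_trans ltr01 vx.
have [wx|wx] := leP (w x) 1.
  have small : eventually_nat (fun k => forall u, u \in us -> u (x ^+ k * y) < 1).
    apply: eventually_all => u uus; have au := (Lu u uus).1.
    have [N hN] := @eventually_exp_lt R (u x) (u y + 1)^-1 (av_ge0 au _) (ux u uus)
      ltac:(by rewrite invr_gt0 ltr_wpDl ?(av_ge0 au)).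
    exists N => k /hN hk; rewrite (avM au) (avX au).
    have y1 : 0 < u y + 1 by rewrite ltr_wpDl ?(av_ge0 au).
    move: hk; rewrite -div1r ltr_pdivlMr // => hk; apply: le_lt_trans hk.
    by rewrite ler_wpM2l ?exprn_ge0 ?(av_ge0 au) // lerDl.
  have [k hk] := eventually_exists small; exists (x ^+ k * y); split.
    by rewrite (avM av) (avX av); apply: (lt_le_trans vy); rewrite ler_peMl ?(av_ge0 av) // exprn_ege1 // ltW.
  move=> u; rewrite inE => /predU1P[->|/hk //].
  rewrite (avM aw) (avX aw); apply: le_lt_trans wy.
  by rewrite ler_piMl ?(av_ge0 aw) // exprn_ile1 ?(av_ge0 aw).
(* The cutoffs of x tend to 1 at v and w, and to 0 at the others. *)
have ev : eventually_nat (fun k => v (1 - cutoff x k) < (v y - 1) / v y).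
  by apply: cutoff_to1 => //; rewrite divr_gt0 ?subr_gt0 // (lt_trans ltr01).
have ew : eventually_nat (fun k => w (1 - cutoff x k) < 1 - w y).
  by apply: cutoff_to1 => //; rewrite subr_gt0.
have eu : eventually_nat (fun k => forall u, u \in us -> u (cutoff x k) < (u y + 1)^-1).
  apply: eventually_all => u uus; apply: cutoff_to0; [exact: (Lu u uus).1|exact: ux|].
  by rewrite invr_gt0 ltr_wpDl ?(av_ge0 (Lu u uus).1).
have [k [hv [hw hu]]] := eventually_exists (eventually_and ev (eventually_and ew eu)).
have split1 : cutoff x k = 1 - (1 - cutoff x k) by rewrite opprB addrC subrK.
exists (cutoff x k * y); split.
  have vy0 : 0 < v y by apply: lt_trans vy.
  rewrite (avM av); move: hv; rewrite ltr_pdivlMr // => hv.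
  have := av_lerB av 1 (1 - cutoff x k); rewrite -split1 (av1 av); nra.
move=> u; rewrite inE => /predU1P[->|uus].
  rewrite (avM aw); have := avB aw 1 (1 - cutoff x k); rewrite -split1 (av1 aw).
  have := av_ge0 aw y; have := av_ge0 aw (1 - cutoff x k); nra.
have au := (Lu u uus).1; have y1 : 0 < u y + 1 by rewrite ltr_wpDl ?(av_ge0 au).
move: (hu u uus); rewrite -div1r ltr_pdivlMr // (avM au) => hk; apply: le_lt_trans hk.
by rewrite ler_wpM2l ?(av_ge0 au) // lerDl.
Qed.

(** If t is large at v and small at the other places, then x t^k / (1 + t^k) is
    for large k close to x at v and close to zero elsewhere. *)
Lemma weak_approximation v (us : seq (K -> R)) x e : lies_above v ->
  (forall u, u \in us -> lies_above u /\ u <> v) -> 0 < e ->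
  exists y, v (x - y) < e /\ forall u, u \in us -> u y < e.
Proof.
move=> Lv Lus e0; have [t [vt ut]] := separate Lv Lus.
have small (u : K -> R) : absval u -> 0 < e / (u x + 1).
  by move=> au; rewrite divr_gt0 // ltr_wpDl ?(av_ge0 au).
have conv (u : K -> R) z : absval u -> u z < e / (u x + 1) -> u (x * z) < e.
  move=> au; have y1 : 0 < u x + 1 by rewrite ltr_wpDl ?(av_ge0 au).
  rewrite ltr_pdivlMr // mulrC => hk; apply: le_lt_trans hk.
  by rewrite (avM au) ler_wpM2r ?(av_ge0 au) // lerDl.
have av := Lv.1.
have ev := cutoff_to1 av vt (small v av).
have eu : eventually_nat (fun k => forall u, u \in us -> u (cutoff t k) < e / (u x + 1)).
  apply: eventually_all => u uus; have au := (Lus u uus).1.1.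
  by apply: cutoff_to0 => //; [apply: ut | apply: small].
have [k [hv hu]] := eventually_exists (eventually_and ev eu).
exists (x * cutoff t k); split.
  by rewrite -{1}[x]mulr1 -mulrBr; apply: conv.
by move=> u uus; apply: conv; [apply: (Lus u uus).1.1 | apply: hu].
Qed.

Lemma rational_dependence m (y : 'I_m -> K) : (\dim {:K} < m)%N ->
  exists2 c : 'I_m -> rat, (exists i, c i != 0) & \sum_i c i *: y i = 0.
Proof.
move=> lt; pose M := \matrix_(i < m, j < \dim {:K}) coord (vbasis {:K}) j (y i).
have : kermx M != 0.
  rewrite -mxrank_eq0 mxrank_ker -lt0n subn_gt0.
  exact: leq_ltn_trans (rank_leq_col _) lt.
case/rowV0Pn => c /sub_kermxP cM c0.
exists (fun i => c 0 i).
  apply: contrapT => h; case/eqP: c0; apply/rowP => i; rewrite mxE.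
  by apply/eqP/negP => /negP ci; apply: h; exists i.
have -> : \sum_i c 0 i *: y i = \sum_j (c *m M) 0 j *: (vbasis {:K})`_j.
  transitivity (\sum_i \sum_j (c 0 i * M i j) *: (vbasis {:K})`_j).
    apply: eq_bigr => i _; rewrite {1}(coord_vbasis (memvf (y i))) scaler_sumr.
    by apply: eq_bigr => j _; rewrite scalerA mxE.
  rewrite exchange_big; apply: eq_bigr => j _; rewrite mxE scaler_suml.
  by apply: eq_bigr.
by rewrite cM; apply: big1 => j _; rewrite mxE scale0r.
Qed.

(** Elements that separate the places from one another are independent over
    the rationals, which bounds the number of places above [f]. *)
Lemma places_above_bounded (s : seq (K -> R)) : uniq s ->
  (forall v, v \in s -> lies_above v) -> (size s <= \dim {:K})%N.
Proof.
move=> us Ls; rewrite leqNgt; apply/negP => big.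
pose m := size s; pose V (i : 'I_m) := nth (fun=> 0) s i.
have Vs i : V i \in s by apply: mem_nth.
have eps0 : 0 < (m.+1%:R)^-1 :> R by rewrite invr_gt0 ltr0n.
have /choice[y hy] (i : 'I_m) : exists y, V i (1 - y) < (m.+1%:R)^-1 /\
    forall u, u \in rem (V i) s -> u y < (m.+1%:R)^-1.
  apply: weak_approximation => //; first exact: Ls.
  by move=> u; rewrite mem_rem_uniq // inE => /andP[/eqP ui us']; split=> //; apply: Ls.
have hy2 i j : j != i -> V j (y i) < (m.+1%:R)^-1.
  move=> ji; apply: (hy i).2; rewrite mem_rem_uniq // inE Vs andbT.
  by rewrite nth_uniq.
have [c [i0 ci0] c0] := rational_dependence y big.
have [i imax] : exists i, forall j, f (c j) <= f (c i).
  by case: (arg_maxP (fun i => f (c i)) (isT : predT i0)) => i _ h; exists i => j; apply: h.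
have Lvi := Ls _ (Vs i); have av := Lvi.1.
have ci : 0 < f (c i).
  apply: lt_le_trans (imax i0); rewrite -Lvi.2 av_gt0 //.
  by rewrite scaler_eq0 negb_or ci0 oner_eq0.
have : f (c i) <= \sum_(j < m) f (c i) * (m.+1%:R)^-1.
  have -> : f (c i) <= \sum_(j < m) f (c i) * (m.+1%:R)^-1 =
      (V i (c i *: (1 - y i) - \sum_(j < m | j != i) c j *: y j) <=
         \sum_(j < m) f (c i) * (m.+1%:R)^-1).
    rewrite -{1}(Lvi.2 (c i)); congr (V i _ <= _).
    have : \sum_j c j *: y j = 0 by []. rewrite (bigD1 i) //= => e.
    by rewrite scalerBr -addrA -opprD e subr0.
  apply: (le_trans (avB av _ _)); rewrite [leRHS](bigD1 i) //=; apply: lerD.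
    rewrite -mulr_algl (avM av) Lvi.2 ler_pM2l //; apply: ltW; exact: (hy i).1.
  apply: (le_trans (av_sum av _ _ _)); apply: ler_sum => j ji.
  rewrite -mulr_algl (avM av) Lvi.2; apply: ler_pM; rewrite ?imax ?(av_ge0 av) //.
    by rewrite -Lvi.2 (av_ge0 av).
  by apply/ltW/hy2; rewrite eq_sym.
rewrite sumr_const card_ord -[_ *+ m]mulr_natr -mulrA.
rewrite -{1}[f (c i)]mulr1 ler_pM2l // mulrC ler_pdivlMr ?ltr0n // mul1r ler_nat.
by rewrite ltnn.
Qed.

Lemma places_above_finite : finite_set [set v : K -> R | lies_above v].
Proof.
apply: contrapT => inf; have [B Bsub Bcard] := infinite_set_fset (\dim {:K}).+1 inf.
have := @places_above_bounded (finmap.enum_fset B) (finmap.fset_uniq B).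
rewrite leqNgt Bcard => h; suff : false by [].
by apply: h => v vB; apply: Bsub.
Qed.

End WeakApproximation.

(** * Local degrees *)

Section CauchySequences.
Import numFieldNormedType.Exports.
Variables (R : realType) (K : fieldExtType rat) (v : K -> R).
Hypothesis av : absval v.
Implicit Types (u t : nat -> K) (c : nat -> rat).

Lemma null_forP u :
  null_for v u <-> forall e, 0 < e -> eventually_nat (fun n => v (u n) < e).
Proof.
split=> [/cvgrPdist_lt h e e0|h].
  have [N _ hN] := h e e0; exists N => k /hN /=.
  by rewrite sub0r normrN ger0_norm // (av_ge0 av).
rewrite /null_for; apply/cvgrPdist_lt => e e0; have [N hN] := h e e0.
exists N => // k /hN /=; by rewrite sub0r normrN ger0_norm // (av_ge0 av).
Qed.

Lemma null_for_eventually u t : null_for v u ->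
  eventually_nat (fun n => t n = u n) -> null_for v t.
Proof.
move=> /null_forP nu [M hM]; apply/null_forP => e /nu [N hN].
by exists (maxn M N) => k; rewrite geq_max => /andP[/hM -> /hN].
Qed.

Lemma null_forD u t : null_for v u -> null_for v t ->
  null_for v (fun n => u n + t n).
Proof.
move=> /null_forP nu /null_forP nt; apply/null_forP => e e0.
have e2 : 0 < e / 2 by rewrite divr_gt0.
have [N hN] := eventually_and (nu _ e2) (nt _ e2); exists N => k /hN[h1 h2].
by apply: le_lt_trans (avD av _ _) _; rewrite [ltRHS](splitr e) ltrD.
Qed.

Lemma null_forM u t M : null_for v u -> 0 < M ->
  eventually_nat (fun n => v (t n) <= M) -> null_for v (fun n => t n * u n).
Proof.
move=> /null_forP nu M0 bt; apply/null_forP => e e0.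
have e2 : 0 < e / M by rewrite divr_gt0.
have [N hN] := eventually_and (nu _ e2) bt; exists N => k /hN[h1 h2].
rewrite (avM av); move: h1; rewrite ltr_pdivlMr // mulrC; apply: le_lt_trans.
by rewrite ler_wpM2r // (av_ge0 av).
Qed.

Lemma cauchy_cst a : cauchy_for v (fun=> a).
Proof. by move=> e e0; exists 0%N => m n _ _; rewrite subrr (av0 av). Qed.

Lemma cauchyD u t : cauchy_for v u -> cauchy_for v t ->
  cauchy_for v (fun n => u n + t n).
Proof.
move=> cu ct e e0; have e2 : 0 < e / 2 by rewrite divr_gt0.
have [N hN] := cu _ e2; have [M hM] := ct _ e2.
exists (maxn N M) => m n; rewrite !geq_max => /andP[Nm Mm] /andP[Nn Mn].
rewrite opprD addrACA; apply: le_lt_trans (avD av _ _) _.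
by rewrite [ltRHS](splitr e) ltrD ?hN ?hM.
Qed.

Lemma cauchyN u : cauchy_for v u -> cauchy_for v (fun n => - u n).
Proof.
move=> cu e e0; have [N hN] := cu _ e0; exists N => m n Nm Nn.
by rewrite -opprD (avN av) hN.
Qed.

Lemma cauchy_bounded u : cauchy_for v u ->
  exists2 M, 0 < M & eventually_nat (fun n => v (u n) <= M).
Proof.
move=> cu; have [N hN] := cu 1 ltr01; exists (v (u N) + 1).
  by rewrite ltr_wpDl // (av_ge0 av).
exists N => n Nn; rewrite -lerBlDl; apply: le_trans (av_lerB av _ _) _.
exact/ltW/hN.
Qed.

Lemma cauchyM u t : cauchy_for v u -> cauchy_for v t ->
  cauchy_for v (fun n => u n * t n).
Proof.
move=> cu ct e e0.
have [M M0 [N1 h1]] := cauchy_bounded cu; have [L L0 [N2 h2]] := cauchy_bounded ct.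
have [N3 h3] := cu (e / 2 / L) ltac:(by rewrite !divr_gt0).
have [N4 h4] := ct (e / 2 / M) ltac:(by rewrite !divr_gt0).
exists (maxn (maxn N1 N2) (maxn N3 N4)) => m n.
rewrite !geq_max => /andP[/andP[a1 a2] /andP[a3 a4]] /andP[/andP[b1 b2] /andP[b3 b4]].
have -> : u m * t m - u n * t n = u m * (t m - t n) + (u m - u n) * t n by ring.
apply: le_lt_trans (avD av _ _) _; rewrite !(avM av).
have := h1 m a1; have := h2 n b2; have := h3 m n a3 b3; have := h4 m n a4 b4.
rewrite !ltr_pdivlMr // => h4' h3' h2' h1'.
have := av_ge0 av (u m); have := av_ge0 av (t n).
have := av_ge0 av (u m - u n); have := av_ge0 av (t m - t n); nra.
Qed.

Lemma cauchy_not_null u : cauchy_for v u -> ~ null_for v u ->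
  exists2 d, 0 < d & eventually_nat (fun n => d <= v (u n)).
Proof.
move=> cu nn.
have [e [e0 he]] : exists e, 0 < e /\ forall N, exists n, (N <= n)%N /\ e <= v (u n).
  apply: contrapT => h; apply: nn; apply/null_forP => e e0.
  apply: contrapT => h2; apply: h; exists e; split=> // N.
  apply: contrapT => h3; apply: h2; exists N => k Nk; rewrite ltNge; apply/negP => ke.
  by apply: h3; exists k.
have e2 : 0 < e / 2 by rewrite divr_gt0.
have [N hN] := cu _ e2; have [n [Nn en]] := he N; exists (e / 2) => //.
exists N => k Nk; have := av_lerB av (u n) (u n - u k); rewrite subKr => h.
by have := hN n k Nn Nk; lra.
Qed.

Lemma cauchyV u : cauchy_for v u -> ~ null_for v u -> cauchy_for v (fun n => (u n)^-1).
Proof.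
move=> cu nn; have [d d0 [N hN]] := cauchy_not_null cu nn.
move=> e e0; have [M hM] := cu (e * (d * d)) ltac:(by rewrite !mulr_gt0).
exists (maxn N M) => m n; rewrite !geq_max => /andP[Nm Mm] /andP[Nn Mn].
have [dm dn] := (hN m Nm, hN n Nn).
have um : u m != 0 by apply: contraTneq dm => ->; rewrite (av0 av) -ltNge.
have un : u n != 0 by apply: contraTneq dn => ->; rewrite (av0 av) -ltNge.
have -> : (u m)^-1 - (u n)^-1 = (u n - u m) / (u m * u n) by field; rewrite um un.
rewrite (av_div av) (avM av) ltr_pdivrMr ?mulr_gt0 ?av_gt0 //.
apply: lt_le_trans (hM n m Mn Mm) _; rewrite ler_pM2l //.
by apply: ler_pM => //; apply: ltW.
Qed.

End CauchySequences.

(** A finite family of constants spanning the completion, of least possible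
    size, is a basis of it: a nontrivial relation has an invertible coefficient,
    which allows one element to be discarded. *)
Section Spanning.
Variables (R : realType) (K : fieldExtType rat) (v : K -> R).
Hypothesis av : absval v.

Definition spans_completion d (e : 'I_d -> K) : Prop :=
  forall u, cauchy_for v u -> exists2 c : 'I_d -> nat -> rat,
    (forall i, rat_cauchy_for v (c i)) &
    null_for v (fun n => u n - \sum_(i < d) c i n *: e i).

Lemma spans_drop d (e : 'I_d.+1 -> K) (c : 'I_d.+1 -> nat -> rat) i0 :
  spans_completion e -> (forall i, rat_cauchy_for v (c i)) ->
  null_for v (fun n => \sum_(i < d.+1) c i n *: e i) ->
  ~ null_for v (fun n => (c i0 n)%:A) ->
  spans_completion (e \o lift i0).
Proof.
move=> sp cc cn ci0 u cu; have [a ca na] := sp u cu.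
exists (fun j n => a (lift i0 j) n - a i0 n * (c i0 n)^-1 * c (lift i0 j) n).
  move=> j; rewrite /rat_cauchy_for.
  have -> : (fun n => (a (lift i0 j) n - a i0 n * (c i0 n)^-1 * c (lift i0 j) n)%:A) =
    (fun n => (a (lift i0 j) n)%:A - (a i0 n)%:A * ((c i0 n)%:A)^-1 * (c (lift i0 j) n)%:A) :> (nat -> K).
    by apply/funext => n; rewrite -!in_algE rmorphB !rmorphM fmorphV.
  apply: (cauchyD av); first exact: ca.
  apply: (cauchyN av); apply: (cauchyM av); last exact: cc.
  by apply: (cauchyM av); [exact: ca | apply: (cauchyV av) => //; apply: cc].
have [d0 d00 [N hN]] := cauchy_not_null av (cc i0) ci0.
have [M M0 [N' hN']] := cauchy_bounded av (ca i0).
pose q n := a i0 n * (c i0 n)^-1.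
have nq : null_for v (fun n => (q n)%:A * \sum_(i < d.+1) c i n *: e i).
  apply: (null_forM av cn (M := M / d0)); first by rewrite divr_gt0.
  exists (maxn N N') => k; rewrite geq_max => /andP[/hN h1 /hN' h2].
  rewrite /q -in_algE rmorphM fmorphV /= (av_div av) ler_pdivrMr; last exact: lt_le_trans d00 h1.
  by apply: (le_trans h2); rewrite mulrAC ler_pdivlMr // ler_pM2l.
apply: (null_for_eventually av (null_forD av na nq)).
exists N => n /hN dn; have cn0 : c i0 n != 0.
  by apply: contraTneq dn => ->; rewrite scale0r (av0 av) -ltNge.
rewrite /= -addrA; congr (_ + _); rewrite mulr_algl !(bigD1_ord i0) //= scalerDr scalerA.
rewrite {1}/q divfK // opprD addrACA addNr add0r scaler_sumr -!sumrN -big_split /=.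
apply: eq_bigr => j _; rewrite scalerBl scalerA opprB addrC.
by [].
Qed.

Lemma completion_basis_exists d0 (e0 : 'I_d0 -> K) : spans_completion e0 ->
  exists d, exists e : 'I_d -> nat -> K, completion_basis v e.
Proof.
move=> sp0.
have [d /asboolP[e sp] dmin] := ex_minnP (ex_intro
  (fun d => `[< exists e : 'I_d -> K, spans_completion e >]) d0 (asboolT (ex_intro _ e0 sp0))).
exists d, (fun i _ => e i); split=> //.
  by move=> i; apply: (cauchy_cst av).
move=> c cc cn i; apply: contrapT => ci.
case: d e sp dmin c cc cn i ci => [|d] e sp dmin c cc cn i ci; first by case: i ci.
have := dmin d; rewrite ltnn => h; suff : false by []. apply: h; apply/asboolP.
by exists (e \o lift i); apply: (spans_drop sp cc cn ci).
Qed.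

End Spanning.

Lemma ler_sum2 (R : realType) (I J : finType) (F : I -> J -> R) i j :
  (forall i j, 0 <= F i j) -> F i j <= \sum_i \sum_j F i j.
Proof.
move=> F0; rewrite (bigD1 i) //= (bigD1 j) //= -addrA lerDl.
by rewrite addr_ge0 //; do ?[apply: sumr_ge0 => * //].
Qed.

Section LocalDegree.
Variables (R : realType) (K : fieldExtType rat) (C : numClosedFieldType).
Variables (w : C -> R) (f : rat -> R) (q0 : rat).
Hypotheses (aw : absval w) (w_rat : forall q, w (ratr q) = f q) (f_q0 : 1 < f q0).
Local Notation n := (\dim {:K}).
Local Notation b := (vbasis {:K}).
Variable sigma : 'I_n -> {rmorphism K -> C}.
Local Notation V := (\matrix_(i < n, j < n) sigma i b`_j).
Hypothesis V_unit : V \in unitmx.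

Definition induced i (x : K) : R := w (sigma i x).

Lemma induced_above i : lies_above f (induced i).
Proof.
split; first split.
- by move=> x; apply: (av_ge0 aw).
- move=> x; split=> [/(av_eq0 aw)/eqP|->]; last by rewrite /induced rmorph0 (av0 aw).
  by rewrite fmorph_eq0 => /eqP.
- by move=> x y; rewrite /induced rmorphM (avM aw).
- by move=> x y; rewrite /induced rmorphD (avD aw).
by move=> q; rewrite /induced alg_num_field fmorph_rat.
Qed.

(** Coordinates are recovered from the conjugates by the inverse of [V]. *)
Lemma coord_bound : exists2 M, 0 < M & forall (x : K) j,
  f (coord b j x) <= M * \sum_i induced i x.
Proof.
exists (1 + \sum_i \sum_j w (invmx V i j)).
  rewrite ltr_wpDr //; apply: sumr_ge0 => i _; apply: sumr_ge0 => j _.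
  exact: (av_ge0 aw).
move=> x j; pose c := \col_j (ratr (coord b j x) : C); pose s := \col_i sigma i x.
have sE : s = V *m c.
  apply/colP => i; rewrite !mxE {1}(coord_vbasis (memvf x)) rmorph_sum.
  apply: eq_bigr => k _; rewrite !mxE -mulr_algl rmorphM alg_num_field fmorph_rat mulrC.
  by [].
have cE : c = invmx V *m s by rewrite sE mulmxA mulVmx // mul1mx.
have -> : f (coord b j x) = w (c j 0) by rewrite mxE w_rat.
rewrite cE mxE; apply: le_trans (av_sum aw _ _ _) _.
rewrite mulrDl mul1r mulr_sumr -big_split /=; apply: ler_sum => i _.
rewrite (avM aw) [s i 0]mxE -/(induced i x) -[X in X + _]mul1r -mulrDl.
apply: ler_wpM2r; first exact: (av_ge0 aw).
apply: le_trans (ler_sum2 (F := fun i j => w (invmx V i j)) j i _) _.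
  by move=> *; apply: (av_ge0 aw).
by rewrite lerDr ler01.
Qed.

(** A sequence that is Cauchy at one place is shifted, by weak approximation,
    to one that also tends to zero at the other places; its coordinates are
    then Cauchy. *)
Lemma basis_spans_completion i0 : spans_completion (induced i0) (fun j : 'I_n => b`_j).
Proof.
move=> u cu; set v := induced i0 in cu *.
have [av vf] : lies_above f v := induced_above i0.
pose us := [seq induced i | i <- enum 'I_n & induced i != v].
have usP x : x \in us -> lies_above f x /\ x <> v.
  case/mapP => i; rewrite mem_filter => /andP[/eqP iv _] ->; split=> //.
  exact: induced_above.
have /choice[t ht] (k : nat) : exists y, v (u k - y) < (k.+1%:R)^-1 /\
    forall x, x \in us -> x y < (k.+1%:R)^-1.
  by apply: (weak_approximation f_q0); rewrite ?invr_gt0 ?ltr0n //; apply: induced_above.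
have small e : 0 < e -> eventually_nat (fun k => (k.+1%:R)^-1 < e :> R).
  move=> e0; exists (Num.bound e^-1) => k hk.
  rewrite invf_plt ?posrE // (lt_trans (archi_boundP _)) ?invr_ge0 ?ltW //.
  by rewrite ltr_nat ltnS.
have nt : null_for v (fun k => u k - t k).
  apply/(null_forP av) => e /small[N hN]; exists N => k /hN; apply: lt_trans.
  exact: (ht k).1.
have ct i : cauchy_for (induced i) t.
  have ai := (induced_above i).1.
  have [->|iv] := eqVneq (induced i) v.
    have -> : t = (fun k => u k + - (u k - t k)) by apply/funext => k; rewrite opprB addrC subrK.
    apply: (cauchyD av) => //; apply: (cauchyN av) => // e e0.
    have e2 : 0 < e / 2 by rewrite divr_gt0.
    have [N hN] := (null_forP av _).1 nt _ e2; exists N => m k /hN hm /hN hk.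
    by apply: le_lt_trans (avB av _ _) _; rewrite [ltRHS](splitr e) ltrD.
  have ius : induced i \in us by apply/mapP; exists i; rewrite // mem_filter iv mem_enum.
  move=> e e0; have e2 : 0 < e / 2 by rewrite divr_gt0.
  have [N hN] := small _ e2; exists N => m k /hN hm /hN hk.
  apply: le_lt_trans (avB ai _ _) _; rewrite [ltRHS](splitr e) ltrD //.
    by apply: lt_trans hm; apply: (ht m).2.
  by apply: lt_trans hk; apply: (ht k).2.
exists (fun j k => coord b j (t k)).
  move=> j e e0; have [M M0 hM] := coord_bound.
  have n0 : (0 < n)%N by rewrite (leq_ltn_trans _ (ltn_ord i0)).
  have e2 : 0 < e / M / n%:R by rewrite !divr_gt0 // ltr0n.
  have /eventually_exists[N hN] : eventually_nat (fun N => forall i, i \in enum 'I_n ->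
      forall m k, (N <= m)%N -> (N <= k)%N -> induced i (t m - t k) < e / M / n%:R).
    apply: eventually_all => i _; have [N hN] := ct i _ e2; exists N => N' NN' m k Nm Nk.
    by apply: hN; apply: leq_trans NN' _.
  exists N => m k Nm Nk; rewrite -scalerBl vf -linearB /=.
  apply: le_lt_trans (hM _ _) _; rewrite mulrC -ltr_pdivlMr //.
  have -> : e / M = \sum_(i < n) e / M / n%:R.
    by rewrite sumr_const card_ord -[_ *+ n]mulr_natr divfK // pnatr_eq0 -lt0n.
  apply: ltr_sum; first by apply/hasP; exists i0; rewrite ?mem_index_enum.
  by move=> i _; apply: hN => //; rewrite mem_enum.
by under eq_fun do rewrite -(coord_vbasis (memvf (t _))).
Qed.

Lemma conjugate_minor (P : pred 'I_n) : exists h : 'I_#|P| -> 'I_n,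
  \matrix_(k < #|P|, l < #|P|) sigma (enum_val k) b`_(h l) \in unitmx.
Proof.
pose W := rowsub (fun k : 'I_#|P| => enum_val k) V.
have Wfree : row_free W.
  apply/row_freeP; exists (colsub (fun k : 'I_#|P| => enum_val k) (invmx V)).
  rewrite -mxsub_mul mulmxV //; apply/matrixP => k l; rewrite !mxE.
  by rewrite (inj_eq enum_val_inj).
have Wfull : row_full W^T by rewrite /row_full mxrank_tr; exact: Wfree.
exists (fullrankfun Wfull).
set M := (X in X \in _); have -> : M = (rowsub (fullrankfun Wfull) W^T)^T.
  by apply/matrixP => k l; rewrite !mxE.
by rewrite unitmx_tr fullrowsub_unit.
Qed.

(** Elements of [K] whose conjugates form an invertible matrix cannot be
    approximated from a space of smaller dimension: a relation between their
    coordinates, normalised so that its largest coefficient is 1, would make a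
    combination of them small under all the embeddings in question at once. *)
Lemma completion_basis_ge i0 d (e : 'I_d -> nat -> K) :
  completion_basis (induced i0) e ->
  (#|[pred i | induced i == induced i0]| <= d)%N.
Proof.
set P := [pred i | _]; case=> _ sp _; rewrite leqNgt; apply/negP => dg.
have [h S_unit] := conjugate_minor P; set S := \matrix_(k, l) _ in S_unit.
set g := #|P| in h S S_unit dg *.
set v := induced i0 in sp *; have [av vf] : lies_above f v := induced_above i0.
have /choice[c hc] (k : 'I_g) : exists c : 'I_d -> nat -> rat,
    null_for v (fun m => b`_(h k) - \sum_i c i m *: e i m).
  by have [c _ nc] := sp _ (cauchy_cst av b`_(h k)); exists c.
have [M M0 hM] : exists2 M, 0 < M & forall (x : 'I_g -> rat) k,
    f (x k) <= M * v (\sum_l x l *: b`_(h l)).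
  exists (1 + \sum_k \sum_l w (invmx S k l)).
    rewrite ltr_wpDr //; apply: sumr_ge0 => k _; apply: sumr_ge0 => l _.
    exact: (av_ge0 aw).
  move=> x k; set y := \sum_l x l *: _; pose c' := \col_l (ratr (x l) : C).
  pose s := \col_l sigma (@enum_val _ P l) y.
  have sE : s = S *m c'.
    apply/colP => j; rewrite !mxE /y rmorph_sum; apply: eq_bigr => l _.
    by rewrite !mxE -mulr_algl rmorphM alg_num_field fmorph_rat mulrC.
  have cE : c' = invmx S *m s by rewrite sE mulmxA mulVmx // mul1mx.
  have -> : f (x k) = w (c' k 0) by rewrite mxE w_rat.
  rewrite cE mxE; apply: le_trans (av_sum aw _ _ _) _.
  have sv j : w (s j 0) = v y.
    rewrite mxE -/(induced (enum_val j) y).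
    by have /eqP -> : induced (enum_val j) == v := enum_valP j.
  rewrite mulrDl mul1r; under eq_bigr do rewrite (avM aw) sv.
  rewrite -mulr_suml -[leLHS]add0r; apply: lerD; first exact: (av_ge0 av).
  apply: ler_wpM2r; first exact: (av_ge0 av).
  rewrite [leRHS](bigD1 k) //= lerDl; apply: sumr_ge0 => j _; apply: sumr_ge0 => l _.
  exact: (av_ge0 aw).
have g0 : (0 < g)%N by apply: leq_ltn_trans dg.
have e0 : 0 < M^-1 / g%:R by rewrite divr_gt0 ?invr_gt0 ?ltr0n.
have [m hm] : exists m, forall k, k \in enum 'I_g ->
    v (b`_(h k) - \sum_i c k i m *: e i m) < M^-1 / g%:R.
  apply/eventually_exists/eventually_all => k _.
  exact: ((null_forP av _).1 (hc k)).
pose A := \matrix_(k < g, i < d) c k i m.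
have /rowV0Pn[x /sub_kermxP xA x0] : kermx A != 0.
  rewrite -mxrank_eq0 mxrank_ker -lt0n subn_gt0.
  exact: leq_ltn_trans (rank_leq_col _) dg.
have [k0 xk0] : exists k, x 0 k != 0.
  apply: contrapT => hx; case/eqP: x0; apply/rowP => k; rewrite mxE.
  by apply/eqP/negP => /negP xk; apply: hx; exists k.
have f_eq0 q : f q = v q%:A by rewrite vf.
have [k kmax] : exists k, forall j, f (x 0 j) <= f (x 0 k).
  by case: (arg_maxP (fun k => f (x 0 k)) (isT : predT k0)) => k _ hk; exists k => j; apply: hk.
have fk : 0 < f (x 0 k).
  by apply: lt_le_trans (kmax k0); rewrite f_eq0 av_gt0 // scaler_eq0 negb_or xk0 oner_eq0.
have := hM (fun l => x 0 l) k; rewrite leNgt => /negP; apply.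
have -> : \sum_l x 0 l *: b`_(h l) =
    \sum_l x 0 l *: (b`_(h l) - \sum_i c l i m *: e i m).
  under [RHS]eq_bigr do rewrite scalerBr; rewrite sumrB.
  suff -> : \sum_l x 0 l *: (\sum_i c l i m *: e i m) = 0 by rewrite subr0.
  transitivity (\sum_i (x *m A) 0 i *: e i m); last first.
    by rewrite xA; apply: big1 => i _; rewrite mxE scale0r.
  under eq_bigr do rewrite scaler_sumr.
  rewrite exchange_big; apply: eq_bigr => i _; rewrite mxE scaler_suml.
  by apply: eq_bigr => l _; rewrite mxE scalerA.
rewrite mulrC -ltr_pdivlMr //; apply: le_lt_trans (av_sum av _ _ _) _.
have -> : f (x 0 k) / M = \sum_(l < g) f (x 0 k) * (M^-1 / g%:R).
  by rewrite sumr_const card_ord -[_ *+ g]mulr_natr mulrA mulfVK // pnatr_eq0 -lt0n.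
apply: ltr_sum; first by apply/hasP; exists k; rewrite ?mem_index_enum.
move=> l _; rewrite -mulr_algl (avM av) vf.
apply: (@le_lt_trans _ _ (f (x 0 k) * v (b`_(h l) - \sum_i c l i m *: e i m))).
  by rewrite ler_wpM2r ?(av_ge0 av).
by rewrite ltr_pM2l // hm // mem_enum.
Qed.

(** This is the half of the equality between the local degree and the number of
    embeddings inducing the place that bounds heights from below. *)
Lemma local_degree_ge i0 :
  (#|[pred i | induced i == induced i0]| <= local_degree (induced i0))%N.
Proof.
have [av _] := induced_above i0.
have [d [e ed]] := completion_basis_exists av (@basis_spans_completion i0).
rewrite /local_degree.
have [e' /completion_basis_ge //] := xgetPex 0%N
  (ex_intro (fun d => [set d | exists e : 'I_d -> nat -> K, completion_basis (induced i0) e] d)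
     d (ex_intro _ e ed)).
Qed.

End LocalDegree.

(** * Heights and places *)

Section RationalPlaces.
Variable R : realType.

(** The places of the rationals: [None] is the archimedean one. *)
Definition rat_place (s : option nat) : bool := if s is Some p then prime p else true.

Definition rat_abs (s : option nat) : rat -> R :=
  if s is Some p then padic_abs R p else @real_abs R.

Lemma padic_abs_natE p k : (0 < k)%N -> padic_abs R p k%:R = (p%:R ^+ logn p k)^-1.
Proof.
move=> k0; rewrite /padic_abs pnatr_eq0 gtn_eqF //.
by rewrite -[k%:R]/((Posz k)%:~R) denq_int numq_int logn1 expr0 div1r.
Qed.

Lemma padic_abs_nat p k : padic_abs R p k%:R <= 1.
Proof.
have [->|k0] := posnP k; first by rewrite /padic_abs eqxx.
rewrite padic_abs_natE //; have [->|p0] := posnP p.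
  by case: (logn _ _) => [|j]; rewrite ?expr0 ?invr1 // exprS mul0r invr0.
by rewrite invf_le1 ?exprn_gt0 ?ltr0n // exprn_ege1 // ler1n.
Qed.

Lemma padic_abs_inv p : prime p -> padic_abs R p (p%:R^-1) = p%:R.
Proof.
move=> pp; have p0 := prime_gt0 pp; have pn : p%:R != 0 :> rat by rewrite pnatr_eq0 -lt0n.
rewrite /padic_abs invr_eq0 (negPf pn).
have dE : denq (p%:R^-1) = p :> int.
  by rewrite -[p%:R]/((Posz p)%:~R) denqVz // -[Posz p == 0]/(p == 0)%N -lt0n.
have -> : numq (p%:R^-1) = 1.
  by apply/eqP; rewrite -(eqr_int rat) numqE dE -[p%:~R]/(p%:R) mulVf.
by rewrite dE /= logn1 expr0 divr1 logn_prime // eqxx expr1.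
Qed.

Lemma rat_abs_big s : rat_place s -> exists q, 1 < rat_abs s q.
Proof.
case: s => [p|] /= ps.
  by exists p%:R^-1; rewrite padic_abs_inv // ltr1n prime_gt1.
by exists 2%:R; rewrite /real_abs ger0_norm // ratr_nat ltr1n.
Qed.

End RationalPlaces.

Section Bernoulli.
Variable R : realType.

Lemma bernoulli (d : R) k : 0 <= d -> 1 + k%:R * d <= (1 + d) ^+ k.
Proof.
move=> d0; elim: k => [|k IHk]; first by rewrite mul0r addr0 expr0.
rewrite exprS -natr1; have : 0 <= k%:R :> R by []; nra.
Qed.

Lemma exp_beats_linear (t : R) : 1 < t -> exists k, k.+1%:R < t ^+ k.
Proof.
move=> t1; pose d := t - 1; have d0 : 0 < d by rewrite subr_gt0.
pose k := (Num.bound (d^-1 ^+ 2) * 2)%N.+1.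
have kb : d^-1 ^+ 2 < (Num.bound (d^-1 ^+ 2))%:R :> R by rewrite archi_boundP ?exprn_ge0 // invr_ge0 ltW.
exists (k * 2)%N; rewrite exprM.
have := @bernoulli d k (ltW d0); have -> : 1 + d = t by rewrite /d addrC subrK.
move=> h.
have k2 : 2 < k%:R * d * d.
  have e : d^-1 ^+ 2 * (d * d) = 1 by field; rewrite gt_eqF.
  have kE : k%:R = (Num.bound (d^-1 ^+ 2))%:R * 2 + 1 :> R by rewrite /k -natr1 natrM.
  rewrite kE; have := mulr_gt0 d0 d0; nra.
have k0 : 0 < k%:R :> R by rewrite ltr0n.
have h1 : (1 + k%:R * d) ^+ 2 <= (t ^+ k) ^+ 2.
  by apply: lerXn2r => //; rewrite nnegrE ?exprn_ge0 ?(le_trans ler01 (ltW t1)) // addr_ge0 // mulr_ge0 // ltW.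
apply: lt_le_trans h1; rewrite -natr1 natrM expr2; nra.
Qed.

(** The k + 1 terms of (x + y) ^+ k have binomial coefficients of size at most 1,
    so v (x + y) is at most the k-th root of k + 1 times the larger size. *)
Lemma absval_ultrametric (F : fieldType) (v : F -> R) :
  absval v -> (forall n, v n%:R <= 1) -> ultrametric v.
Proof.
move=> av vn x y; set M := Num.max _ _; rewrite leNgt; apply/negP => Mlt.
have M0 : 0 < M.
  rewrite lt_neqAle le_max (av_ge0 av) andbT; apply/eqP => M0.
  have := Mlt; rewrite -M0 => h.
  have x0 : v x <= 0 by rewrite M0 /M le_max lexx.
  have y0 : v y <= 0 by rewrite M0 /M le_max lexx orbT.
  by have := avD av x y; lra.
have t1 : 1 < v (x + y) / M by rewrite ltr_pdivlMr // mul1r.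
have [k] := exp_beats_linear t1; apply/negP; rewrite -leNgt.
rewrite expr_div_n ler_pdivrMr ?exprn_gt0 // -(avX av) exprDn.
apply: le_trans (av_sum av _ _ _) _.
have -> : k.+1%:R * M ^+ k = \sum_(i < k.+1) M ^+ k by rewrite sumr_const card_ord mulr_natl.
apply: ler_sum => i _; rewrite -mulr_natr !(avM av) !(avX av).
rewrite -[leRHS]mulr1; apply: ler_pM => //; rewrite ?mulr_ge0 ?exprn_ge0 ?(av_ge0 av) //.
have ik : (i <= k)%N by rewrite -ltnS.
rewrite -[in leRHS](subnK ik) exprD; apply: ler_pM; rewrite ?exprn_ge0 ?(av_ge0 av) //.
  by apply: lerXn2r; rewrite ?nnegrE ?(av_ge0 av) ?(ltW M0) // le_max lexx.
by apply: lerXn2r; rewrite ?nnegrE ?(av_ge0 av) ?(ltW M0) // le_max lexx orbT.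
Qed.

End Bernoulli.

Section HeightBound.
Variables (R : realType) (K : fieldExtType rat).
Local Notation n := (\dim {:K}).

Lemma absval_equiv (v : K -> R) : absval v <-> is_absolute_value v.
Proof. by split=> -[h1 h2 h3 h4]; split. Qed.

Lemma placesP (v : K -> R) :
  places v <-> exists2 s, rat_place s & lies_above (rat_abs R s) v.
Proof.
split.
  by move=> [/absval_equiv av [h|[p pp h]]]; [exists None | exists (Some p)].
move=> [[p|] /= ps [/absval_equiv av h]]; split=> //; last by left.
by right; exists p.
Qed.

Lemma padic_place_ultrametric p (v : K -> R) :
  lies_above (padic_abs R p) v -> ultrametric v.
Proof.
move=> [av vf]; apply: absval_ultrametric => // k.
by rewrite -(rmorph_nat (in_alg K)) vf padic_abs_nat.
Qed.

(** An element is integral at all but finitely many places: at the primes that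
    do not occur in the coefficients of an equation satisfied by it. *)
Lemma integral_almost_everywhere (a : K) : exists2 N : nat, (0 < N)%N &
  forall p v, prime p -> lies_above (padic_abs R p) v -> ~~ (p %| N)%N -> v a <= 1.
Proof.
have [c [i0 ci0] c0] := rational_dependence (fun i : 'I_n.+1 => a ^+ i) (ltnSn _).
pose N := (\prod_(i < n.+1 | c i != 0%R) (`|numq (c i)| * `|denq (c i)|))%N.
exists N.
  apply: prodn_cond_gt0 => i ci; rewrite muln_gt0 !absz_gt0 numq_eq0 ci /=.
  exact: denq_neq0.
move=> p v pp Lv pN; have um := padic_place_ultrametric Lv; have [av vf] := Lv.
have fc i : c i != 0 -> v (c i)%:A = 1.
  move=> ci; rewrite vf /padic_abs (negPf ci).
  have : ~~ (p %| `|numq (c i)| * `|denq (c i)|)%N.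
    by apply: contra pN => h; rewrite /N (bigD1 i) //=; apply: dvdn_mulr.
  rewrite Euclid_dvdM // negb_or => /andP[h1 h2].
  by rewrite !logn_coprime ?prime_coprime // !expr0 divr1.
rewrite leNgt; apply/negP => va.
have [j cj jmax] := @arg_maxnP 'I_n.+1 i0 (fun i => c i != 0) (fun i => nat_of_ord i) ci0.
have va0 : 0 <= v a := av_ge0 av a.
have e : c j *: a ^+ j = - \sum_(i < n.+1 | i != j) c i *: a ^+ i.
  by apply/eqP; rewrite -addr_eq0; move: c0; rewrite (bigD1 j) //= => ->.
have [j0|j0] := posnP j.
  have : c j *: a ^+ j == 0.
    rewrite e oppr_eq0; apply/eqP/big1 => i ij.
    have [->|/jmax] := eqVneq (c i) 0; first by rewrite scale0r.
    by rewrite /= j0 leqn0 => /eqP i_0; case/eqP: ij; apply/val_inj; rewrite /= i_0 j0.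
  by rewrite scaler_eq0 (negPf cj) j0 expr0 oner_eq0.
have : v (c j *: a ^+ j) <= v a ^+ j.-1.
  rewrite e (avN av); apply: (um_sum av um); first exact: exprn_ge0.
  move=> i ij; have [->|ci] := eqVneq (c i) 0.
    by rewrite scale0r (av0 av) exprn_ge0.
  rewrite -mulr_algl (avM av) fc // mul1r (avX av).
  apply: ler_weXn2l; first exact: ltW.
  by rewrite -ltnS prednK // ltn_neqAle ij; apply: jmax.
rewrite -mulr_algl (avM av) fc // mul1r (avX av) -{1}(prednK j0) exprS.
by rewrite ger_pMl ?exprn_gt0 ?(lt_trans ltr01 va) // leNgt va.
Qed.

Definition height_factor (a : K) (v : K -> R) : R :=
  Num.max 1 (v a) `^ ((local_degree v)%:R / n%:R).

Lemma height_factor_ge1 a v : 1 <= height_factor a v.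
Proof.
have m1 : 1 <= Num.max 1 (v a) by rewrite le_max lexx.
by rewrite -(powRr0 (Num.max 1 (v a))); apply: ler_powR => //; rewrite divr_ge0.
Qed.

(** By definition the product over the places would be 1 if infinitely many
    factors were not trivial. *)
Lemma height_support_finite a :
  finite_set (@places R K `&` [set v | height_factor a v <> 1]).
Proof.
have [N N0 hN] := integral_almost_everywhere a.
have fin s : rat_place s -> finite_set [set v : K -> R | lies_above (rat_abs R s) v].
  by move=> /(rat_abs_big R)[q hq]; exact: (@places_above_finite R K (rat_abs R s) q hq).
pose S := None :: [seq Some p | p <- primes N].
apply: (@sub_finite_set _ _ (\bigcup_(s in [set` S]) [set v | lies_above (rat_abs R s) v])).
  move=> v [/placesP[s ss Lv] /= h]; exists s => //=.
  case: s ss Lv => [p|] /= ps Lv; last by rewrite inE.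
  rewrite inE /=; apply/mapP; exists p => //; rewrite mem_primes ps N0 /=.
  apply/negPn/negP => /(hN p v ps Lv) va1; apply: h.
  by rewrite /height_factor max_l // powR1.
apply: bigcup_finite; first exact: finite_seq.
move=> s /=; rewrite inE => /predU1P[->|/mapP[p pN ->]]; first exact: fin.
by apply: fin; move: pN; rewrite /= mem_primes => /andP[].
Qed.

Lemma height_ge_partial a (U : seq (K -> R)) : uniq U ->
  (forall v, v \in U -> places v) ->
  \prod_(v <- U) height_factor a v <= weil_height R a.
Proof.
move=> Uu Up; have [r rE] := (finite_seqP _).1 (height_support_finite a).
have rP v : v \in r -> places v.
  by move=> vr; have [] : (@places R K `&` [set v | height_factor a v <> 1]) v by rewrite rE.
have sub : \prod_(v <- U) height_factor a v <= \prod_(v <- undup (r ++ U)) height_factor a v.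
  have e : \prod_(v <- undup (r ++ U) | v \in U) height_factor a v =
      \prod_(v <- U) height_factor a v.
    rewrite -big_filter; apply/perm_big/uniq_perm => [||v].
    - by apply: filter_uniq; apply: undup_uniq.
    - exact: Uu.
    - by rewrite mem_filter mem_undup mem_cat; case: (v \in U); rewrite ?orbT.
  rewrite [leRHS](bigID (fun v => v \in U)) /= e ler_peMr //.
    by apply: prodr_ge0 => v _; apply: le_trans (height_factor_ge1 a v).
  by elim/big_rec: _ => // v x _ x1; apply: mulr_ege1 => //; apply: height_factor_ge1.
have rUP v : v \in undup (r ++ U) -> places v.
  by rewrite mem_undup mem_cat => /orP[/rP|/Up].
apply: (le_trans sub); rewrite /weil_height (@fsbigE _ _ _ _ _ (undup (r ++ U))).
- rewrite [leRHS]big_rmcond_in //= => v /rUP pv.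
  by rewrite notin_setE => /(_ pv).
- exact: undup_uniq.
- exact: rUP.
- move=> v pv vr; apply: contrapT => h; move: vr; rewrite mem_undup mem_cat => /negP; apply.
  apply/orP; left; suff : [set` r] v by []. by rewrite -rE.
Qed.

Lemma weil_height_ge1 (a : K) : 1 <= weil_height R a.
Proof. by apply: le_trans (height_ge_partial a (U := [::]) _ _) => //; rewrite big_nil. Qed.

(** A place occurs with an exponent at least equal to the number of indices that
    give it, so every index may be counted once. *)
Lemma height_ge_families (a : K) (T : eqType) (S : seq T) (fam : T -> 'I_n -> K -> R) :
  uniq S ->
  (forall s i, s \in S -> places (fam s i)) ->
  (forall s i, s \in S ->
     (#|[pred j | fam s j == fam s i]| <= local_degree (fam s i))%N) ->
  (forall s t i j, s \in S -> t \in S -> fam s i = fam t j -> s = t) ->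
  \prod_(s <- S) \prod_i Num.max 1 (fam s i a) <= weil_height R a ^+ n.
Proof.
move=> Su famP famd famdisj.
pose r := flatten [seq [seq fam s i | i <- enum 'I_n] | s <- S].
have n0 : (0 < n)%N := adim_gt0 {:K}%AS.
have rP v : v \in r -> exists s i, s \in S /\ v = fam s i.
  by case/flatten_mapP => s sS /mapP[i _ ->]; exists s, i.
have count_r v : v \in r -> (count_mem v r <= local_degree v)%N.
  move=> /rP[s [i [sS ->]]]; apply: leq_trans (famd s i sS).
  rewrite count_flatten -map_comp sumnE big_map (bigD1_seq s) //=.
  rewrite big_seq_cond big1 ?addn0; last first.
    move=> t /andP[tS ts]; apply/eqP; rewrite -leqn0 leqNgt -has_count.
    by apply: contra ts => /hasP[_ /mapP[j _ ->] /= /eqP h]; apply/eqP; apply: famdisj tS sS h.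
  rewrite count_map cardE enumT [in leqRHS]/enum_mem size_filter; apply: eq_leq.
  by apply: eq_count => j; rewrite /= inE.
have -> : \prod_(s <- S) \prod_i Num.max 1 (fam s i a) = \prod_(v <- r) Num.max 1 (v a).
  rewrite big_flatten big_map; apply: eq_bigr => s _.
  by rewrite big_map big_enum.
rewrite -big_undup_iterop_count.
apply: (@le_trans _ _ ((\prod_(v <- undup r) height_factor a v) ^+ n)); last first.
  apply: lerXn2r; rewrite ?nnegrE.
  - by apply: prodr_ge0 => v _; apply: le_trans (height_factor_ge1 a v).
  - exact: le_trans ler01 (weil_height_ge1 a).
  - apply: height_ge_partial; first exact: undup_uniq.
    by move=> v; rewrite mem_undup => /rP[s [i [sS ->]]]; apply: famP.
rewrite -prodrXl big_seq [leRHS]big_seq; apply: ler_prod => v.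
rewrite mem_undup => vr; have m1 : 1 <= Num.max 1 (v a) by rewrite le_max lexx.
rewrite -[iterop _ _ _ _]/(Num.max 1 (v a) ^+ count_mem v r).
rewrite exprn_ge0 ?(le_trans ler01) //= /height_factor.
rewrite -[leRHS]powR_mulrn ?powR_ge0 // -powRrM divfK ?pnatr_eq0 -?lt0n //.
rewrite -(powR_mulrn _ (le_trans ler01 m1)).
by apply: ler_powR => //; rewrite ler_nat; apply: count_r.
Qed.

End HeightBound.

(** * Unramified primes *)

Section ValueGroup.
Variables (R : realType) (C : numClosedFieldType) (w : C -> R) (p : nat).
Hypotheses (p_prime : prime p) (aw : absval w) (um : ultrametric w).
Hypothesis w_rat : forall q, w (ratr q) = padic_abs R p q.
Local Notation P := (p%:R : R).

Let P_gt1 : 1 < P. Proof. by rewrite ltr1n prime_gt1. Qed.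
Let P_gt0 : 0 < P. Proof. exact: lt_trans P_gt1. Qed.

Definition integral_value (x : C) : Prop := exists z : int, w x = P ^ z.

Lemma w_nat k : (0 < k)%N -> w k%:R = (P ^+ logn p k)^-1.
Proof.
by move=> k0; rewrite -(ratr_nat C) w_rat padic_abs_natE.
Qed.

Lemma w_p : w p%:R = P^-1.
Proof. by rewrite w_nat ?prime_gt0 // logn_prime // eqxx expr1. Qed.

Lemma w_coprime k : coprime p k -> w k%:R = 1.
Proof.
move=> pk; have k0 : (0 < k)%N.
  by case: k pk => //; rewrite /coprime gcdn0 => /eqP p1; move: p_prime; rewrite p1.
by rewrite w_nat // logn_coprime // expr0 invr1.
Qed.

Lemma integral_value_rat q : q != 0 -> integral_value (ratr q).
Proof.
move=> q0; rewrite /integral_value w_rat /padic_abs (negPf q0).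
exists ((logn p `|denq q|)%:Z - (logn p `|numq q|)%:Z).
by rewrite expfzDr ?gt_eqF // -invr_expz -!exprnP.
Qed.

Lemma integral_valueM x y : integral_value x -> integral_value y -> integral_value (x * y).
Proof. by move=> [z zE] [t tE]; exists (z + t); rewrite (avM aw) zE tE expfzDr // gt_eqF. Qed.

Lemma integral_valueV x : integral_value x -> integral_value x^-1.
Proof. by move=> [z zE]; exists (- z); rewrite (avV aw) zE invr_expz. Qed.

Section Powers.
Variables (t : C) (b : nat).
Hypotheses (b_gt0 : (0 < b)%N) (wt : w t ^+ b = P^-1).

(** Raise to the power b: the exponents of p become z b - i. *)
Lemma value_residue x y i j : integral_value x -> integral_value y ->
  (i < b)%N -> (j < b)%N -> w (x * t ^+ i) = w (y * t ^+ j) -> i = j.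
Proof.
move=> [z zE] [z' zE'] ib jb; rewrite !(avM aw) !(avX aw) zE zE'.
have powE (s : int) k : (P ^ s * w t ^+ k) ^+ b = P ^ (s * b%:Z - k%:Z).
  rewrite exprMn -exprM mulnC exprM wt exprVn expfzDr ?gt_eqF // -invr_expz.
  by rewrite [(P ^ s) ^+ b]exprnP exprz_exp.
move/(congr1 (fun r => r ^+ b)); rewrite !powE => /ieexprIz e.
have {}e : z * b%:Z - i%:Z = z' * b%:Z - j%:Z by apply: e; rewrite // gt_eqF.
have b1 (s s' : int) : s < s' -> s * b%:Z + b%:Z <= s' * b%:Z.
  move=> yy; have -> : s' = s + 1 + (s' - s - 1) by ring.
  rewrite mulrDl mulrDl mul1r lerDl mulr_ge0 //; lia.
have [/b1|/b1|zz] := ltgtP z z'; [lia | lia | rewrite zz in e; lia].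
Qed.

(** The sizes of the terms lie in different classes modulo the powers of p. *)
Lemma terms_le (a : 'I_b -> C) : (forall i, a i = 0 \/ integral_value (a i)) ->
  forall i : 'I_b, w (a i * t ^+ i) <= w (\sum_j a j * t ^+ j).
Proof.
move=> ia; apply: (um_sum_distinct aw um (t := fun i : 'I_b => a i * t ^+ i)) => i j ij ti.
have [ai0|vi] := ia i; first by rewrite ai0 mul0r eqxx in ti.
have [aj0|vj] := ia j.
  by move=> e; case/eqP: ti; apply/(av_eq0 aw); rewrite e aj0 mul0r (av0 aw).
by move=> e; case/eqP: ij; apply/val_inj/(value_residue vi vj _ _ e).
Qed.

End Powers.
End ValueGroup.

Section Frobenius.

Lemma exprD_prime (S : comNzRingType) (p : nat) (x y : S) : prime p ->
  exists z, (x + y) ^+ p = x ^+ p + y ^+ p + p%:R * z.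
Proof.
move=> pp; have p0 := prime_gt0 pp.
exists (\sum_(1 <= i < p) (x ^+ (p - i) * y ^+ i) *+ ('C(p, i) %/ p)).
rewrite exprDn -(big_mkord predT (fun i => (x ^+ (p - i) * y ^+ i) *+ 'C(p, i))).
rewrite (big_cat_nat (n := 1)) //= big_nat1 bin0 subn0 expr0 mulr1 mulr1n.
rewrite (big_cat_nat (n := p)) //= big_nat1 subnn binn expr0 mul1r mulr1n.
rewrite (addrC _ (y ^+ p)) addrA; congr (_ + _).
rewrite mulr_sumr; apply: eq_big_nat => i ip.
by rewrite mulr_natl -mulrnA divnK // prime_dvd_bin.
Qed.

Lemma exprD_prime_power (S : comNzRingType) (p f : nat) (x y : S) : prime p ->
  exists z, (x + y) ^+ (p ^ f) = x ^+ (p ^ f) + y ^+ (p ^ f) + p%:R * z.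
Proof.
move=> pp; elim: f => [|f [z IHf]]; first by exists 0; rewrite !expr1 mulr0 addr0.
rewrite expnSr !exprM IHf.
have [z1 ->] := exprD_prime (x ^+ (p ^ f) + y ^+ (p ^ f)) (p%:R * z) pp.
have [z2 ->] := exprD_prime (x ^+ (p ^ f)) (y ^+ (p ^ f)) pp.
exists (z1 + z2 + p%:R ^+ p.-1 * z ^+ p).
have pE : (p%:R : S) ^+ p = p%:R * p%:R ^+ p.-1 by rewrite -exprS prednK ?prime_gt0.
rewrite exprMn pE; ring.
Qed.

End Frobenius.

Section Unramified.
Variables (R : realType) (C : numClosedFieldType) (w : C -> R) (p : nat).
Hypotheses (p_prime : prime p) (aw : absval w) (um : ultrametric w).
Hypothesis w_rat : forall q, w (ratr q) = padic_abs R p q.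
Local Notation P := (p%:R : R).
Variables (eta : C) (m A : nat).
Hypotheses (m_gt0 : (0 < m)%N) (eta_m : eta ^+ m = A%:R) (p_mA : coprime p (m * A)).
Local Notation ev g := (map_poly (intr : int -> C) g).[eta].

Let P_gt1 : 1 < P. Proof. by rewrite ltr1n prime_gt1. Qed.
Let P_gt0 : 0 < P. Proof. exact: lt_trans P_gt1. Qed.
Let pC : p%:R != 0 :> C. Proof. by rewrite pnatr_eq0 -lt0n prime_gt0. Qed.

(** The exponent makes eta ^+ (p ^ f) equal to eta times a power of
    A ^ (p - 1), which is 1 modulo p. *)
Lemma frobenius_exponent : exists f, [/\ (0 < f)%N, (m %| p ^ f - 1)%N &
  (p.-1 %| (p ^ f - 1) %/ m)%N].
Proof.
have p1 : (0 < p.-1)%N by rewrite -subn1 subn_gt0 prime_gt1.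
have mp0 : (0 < m * p.-1)%N by rewrite muln_gt0 m_gt0.
have cop : coprime p (m * p.-1).
  move: p_mA; rewrite !coprimeMr => /andP[-> _] /=.
  by rewrite coprimenP ?prime_gt0.
have e := Euler_exp_totient cop.
have pf : (0 < p ^ totient (m * p.-1))%N by rewrite expn_gt0 prime_gt0.
have d : (m * p.-1 %| p ^ totient (m * p.-1) - 1)%N.
  by rewrite -eqn_mod_dvd //; apply/eqP.
exists (totient (m * p.-1)); split; first by rewrite totient_gt0.
  exact: dvdn_trans (dvdn_mulr _ (dvdnn m)) d.
by rewrite dvdn_divRL ?(dvdn_trans (dvdn_mulr _ (dvdnn m)) d) // mulnC.
Qed.

(** A power Q of p can be chosen so that raising to the power Q is the identity
    modulo p on the ring generated by eta: this is where p being prime to m A,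
    hence unramified, is used. *)
Lemma frobenius_trivial : exists2 Q, (1 < Q)%N & forall g : {poly int},
  exists h : {poly int}, ev g ^+ Q - ev g = p%:R * ev h.
Proof.
have [f [f0 mQ pQ]] := frobenius_exponent.
have Q1 : (1 < p ^ f)%N by rewrite (leq_ltn_trans f0) // ltn_expl // prime_gt1.
exists (p ^ f)%N => // g.
have fermat (c : int) : exists d : int, c ^+ (p ^ f) - c = p%:Z * d.
  elim/int_rect: c => [|n [d dE]|n [d dE]].
  - by exists 0; rewrite expr0n gtn_eqF ?subr0 ?mulr0 // ltnW.
  - have [z zE] := exprD_prime_power f n%:Z 1 p_prime.
    have -> : n.+1%:Z = n%:Z + 1 by lia.
    by exists (d + z); rewrite zE expr1n mulrDr -dE natz; ring.
  - have [z] := exprD_prime_power f (- n.+1%:Z) 1 p_prime.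
    have -> : - n.+1%:Z + 1 = - n%:Z by lia.
    rewrite expr1n natz => zE; exists (d - z); rewrite mulrBr -dE zE.
    have -> : - n.+1%:Z = - n%:Z - 1 by lia.
    ring.
have [k kE] : exists k : nat, (A ^ ((p ^ f - 1) %/ m) = 1 + p * k)%N.
  have cpA : coprime A p by move: p_mA; rewrite coprimeMr coprime_sym => /andP[_]; rewrite coprime_sym.
  have [e ->] := dvdnP pQ; rewrite mulnC expnM.
  have := Euler_exp_totient cpA; rewrite totient_prime // => h.
  exists ((A ^ p.-1) ^ e %/ p)%N; rewrite addnC mulnC.
  rewrite {1}(divn_eq ((A ^ p.-1) ^ e) p); congr (_ + _)%N.
  by rewrite -modnXm h modnXm exp1n modn_small // prime_gt1.
have etaQ : eta ^+ (p ^ f) = eta * (1 + p%:R * k%:R).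
  have -> : (p ^ f = (m * ((p ^ f - 1) %/ m)).+1)%N.
    by rewrite mulnC divnK // subn1 prednK // ltnW.
  by rewrite exprS exprM eta_m -natrX kE natrD natrM.
elim/poly_ind: g => [|g c [h hE]].
  by exists 0; rewrite !rmorph0 horner0 expr0n gtn_eqF ?subr0 ?mulr0 // ltnW.
have [z zE] := exprD_prime_power f (g * 'X) c%:P p_prime.
have [d dE] := fermat c.
exists (h * 'X^(p ^ f) + g * 'X * (k%:R)%:P + d%:P + z).
have evM a b : ev (a * b) = ev a * ev b by rewrite rmorphM hornerM.
have evD a b : ev (a + b) = ev a + ev b by rewrite rmorphD hornerD.
have evC c' : ev c'%:P = c'%:~R by rewrite map_polyC hornerC.
have evX : ev 'X = eta by rewrite map_polyX hornerX.
have evE a N : ev (a ^+ N) = ev a ^+ N by rewrite rmorphXn horner_exp.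
have evN N : ev N%:R = N%:R by rewrite rmorph_nat -polyC_natr hornerC.
rewrite -evE zE !(evD, evM, evE, evC, evX, evN) etaQ.
have {}dE : c%:~R ^+ (p ^ f) = c%:~R + p%:R * d%:~R :> C.
  by apply/eqP; rewrite addrC -subr_eq -rmorphXn -rmorphB dE rmorphM.
have {}hE : ev g ^+ (p ^ f) = ev g + p%:R * ev h.
  by apply/eqP; rewrite addrC -subr_eq hE.
rewrite exprMn etaQ dE hE -[(k%:R)%:~R]/(k%:R%:~R); rewrite natz -[(Posz k)%:~R]/(k%:R).
ring.
Qed.

Lemma w_eta : w eta = 1.
Proof.
have := congr1 w eta_m; rewrite (avX aw) (w_coprime p_prime w_rat); last first.
  by move: p_mA; rewrite coprimeMr => /andP[].
by move/eqP; rewrite pexpr_eq1 ?(av_ge0 aw) // => /eqP.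
Qed.

Lemma w_ev_le1 g : w (ev g) <= 1.
Proof.
rewrite horner_coef; apply: (um_sum aw um) => // i _.
by rewrite coef_map (avM aw) (avX aw) w_eta expr1n mulr1 um_int.
Qed.

(** If y has size less than 1 then y ^+ (Q - 1) - 1 has size 1, and
    (y ^+ Q - y) / p lies in the same ring and is p times larger than y. Repeating
    this leads to size 1 since the ring consists of elements of size at most 1. *)
Lemma ev_value g : ev g != 0 -> integral_value w p (ev g).
Proof.
have [Q Q1 frob] := frobenius_trivial.
move=> g0; have wg0 := av_gt0 aw g0.
have [N hN] := eventually_exists (eventually_exp_gt (w (ev g))^-1 P_gt1).
elim: N g g0 wg0 hN => [|N IHN] g g0 wg0 hN.
  exfalso; move: hN; rewrite expr0 invf_lt1 // => h.
  by have := w_ev_le1 g; rewrite leNgt h.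
have [h hE] := frob g.
have [w1|w1] := eqVneq (w (ev g)) 1; first by exists 0; rewrite w1 expr0z.
have wlt : w (ev g) < 1 by rewrite lt_neqAle w1 w_ev_le1.
have wh : w (ev h) = P * w (ev g).
  have : w (ev g ^+ Q - ev g) = w (ev g).
    rewrite (um_strict aw um) (avN aw) // (avX aw) -(prednK (ltnW Q1)) exprS.
    rewrite gtr_pMr // exprn_ilt1 ?(av_ge0 aw) //.
    by rewrite -lt0n -subn1 subn_gt0.
  by rewrite hE (avM aw) (w_p p_prime w_rat) => <-; rewrite mulrA divff ?mul1r // gt_eqF.
have wh0 : 0 < w (ev h) by rewrite wh mulr_gt0.
have [z zE] : integral_value w p (ev h).
  apply: IHN => //; first by apply: contraTneq wh0 => ->; rewrite (av0 aw) ltxx.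
  by rewrite wh invfM ltr_pdivrMl // -exprS.
have P0 : P != 0 by rewrite gt_eqF.
by exists (z - 1); rewrite expfzDr // -zE wh exprN1 mulrAC divff ?mul1r.
Qed.

(** This expresses that p is unramified in the field generated by eta: up to a
    rational factor every element is an integral polynomial in eta. *)
Lemma unramified (q : {poly rat}) : (map_poly ratr q).[eta] = 0 \/
  integral_value w p (map_poly ratr q).[eta].
Proof.
have [->|y0] := eqVneq (map_poly (ratr : rat -> C) q).[eta] 0; [by left | right].
have [g [c [c0 qE]]] : exists (g : {poly int}) (c : int), c != 0 /\
    q = c%:~R^-1 *: map_poly intr g.
  have [g [a a0 gE]] := rat_poly_scale q.
  by exists g, a.
have yE : (map_poly ratr q).[eta] = c%:~R^-1 * ev g.
  rewrite qE map_polyZ hornerZ fmorphV rmorph_int -map_poly_comp; congr (_ * _.[_]).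
  by apply: eq_map_poly => z; rewrite /= ratr_int.
rewrite yE in y0 *; move: y0; rewrite mulf_eq0 => /norP[_ g0].
apply: (integral_valueM p_prime aw); last exact: ev_value.
apply: (integral_valueV aw); rewrite -ratr_int.
by apply: (integral_value_rat p_prime w_rat); rewrite intr_eq0.
Qed.

End Unramified.

(** * Conjugates and radical fields *)

Section Conjugates.
Variables (K : fieldExtType rat) (C : numClosedFieldType).
Local Notation n := (\dim {:K}).
Local Notation b := (vbasis {:K}).
Variable sigma : 'I_n -> {rmorphism K -> C}.

Definition conj_mx (e : 'I_n -> K) : 'M[C]_n := \matrix_(i, j) sigma i (e j).

Lemma rmorph_ratZ (s : {rmorphism K -> C}) c x : s (c *: x) = ratr c * s x.
Proof. by rewrite -mulr_algl rmorphM alg_num_field fmorph_rat. Qed.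

Lemma conj_mx_lin (e e' : 'I_n -> K) (N : 'M[rat]_n) :
  (forall j, e' j = \sum_k N j k *: e k) ->
  conj_mx e' = conj_mx e *m (map_mx ratr N)^T.
Proof.
move=> eE; apply/matrixP => i j; rewrite !mxE eE rmorph_sum; apply: eq_bigr => k _.
by rewrite !mxE rmorph_ratZ mulrC.
Qed.

Lemma conj_mx_vbasis e : conj_mx e \in unitmx -> conj_mx (fun j => b`_j) \in unitmx.
Proof.
rewrite (@conj_mx_lin (fun j => b`_j) e (\matrix_(j, k) coord b k (e j))).
  by rewrite unitmx_mul => /andP[].
by move=> j; under eq_bigr do rewrite mxE; exact: (coord_vbasis (memvf (e j))).
Qed.

Lemma conj_mx_basis (e : n.-tuple K) : basis_of {:K} e ->
  conj_mx (fun j => b`_j) \in unitmx -> conj_mx (fun j => e`_j) \in unitmx.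
Proof.
move=> eb; rewrite (@conj_mx_lin (fun j => e`_j) _ (\matrix_(j, k) coord e k b`_j)).
  by rewrite unitmx_mul => /andP[].
by move=> j; under eq_bigr do rewrite mxE; exact: (coord_basis eb (memvf b`_j)).
Qed.

(** The matrix of conjugates diagonalises every multiplication map, so traces
    and norms are sums and products over the embeddings. *)
Lemma conj_mult (e : 'I_n -> K) (a : K) (M : 'M[rat]_n) :
  conj_mx e \in unitmx -> (forall i, a * e i = \sum_j M i j *: e j) ->
  ratr (\tr M) = \sum_i sigma i a /\ ratr (\det M) = \prod_i sigma i a.
Proof.
move=> W_unit aE; set W := conj_mx e in W_unit.
pose d := diag_mx (\row_i sigma i a).
have WM : W *m (map_mx ratr M)^T = d *m W.
  rewrite -(conj_mx_lin (e' := fun i => a * e i)) //; apply/matrixP => i j.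
  by rewrite mul_diag_mx !mxE rmorphM.
have ME : (map_mx ratr M)^T = invmx W *m (d *m W) by rewrite -WM mulKmx.
split.
  rewrite -trace_map_mx -mxtrace_tr ME mxtrace_mulC mulmxK //.
  by rewrite mxtrace_diag; apply: eq_bigr => i _; rewrite mxE.
rewrite -det_map_mx -det_tr ME !det_mulmx mulrCA -det_mulmx mulVmx // det1 mulr1.
by rewrite det_diag; apply: eq_bigr => i _; rewrite mxE.
Qed.

Definition mult_mx (a : K) : 'M[rat]_n := \matrix_(i, j) coord b j (a * b`_i).

Definition field_norm (a : K) : rat := \det (mult_mx a).

Hypothesis sigma_unit : conj_mx (fun j => b`_j) \in unitmx.

Lemma mult_mxE a (i : 'I_n) : a * b`_i = \sum_j mult_mx a i j *: b`_j.
Proof. by under eq_bigr do rewrite mxE; exact: (coord_vbasis (memvf (a * b`_i))). Qed.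

Lemma field_trace_conj a : ratr (field_trace a) = \sum_i sigma i a.
Proof. exact: (conj_mult sigma_unit (mult_mxE a)).1. Qed.

Lemma field_norm_conj a : ratr (field_norm a) = \prod_i sigma i a.
Proof. exact: (conj_mult sigma_unit (mult_mxE a)).2. Qed.

End Conjugates.

Section Roots.
Variable C : numClosedFieldType.

Lemma primitive_root_exists k : (0 < k)%N -> exists z : C, k.-primitive_root z.
Proof.
pose p : {poly C} := 'X^k - 1; have [r Dp] := closed_field_poly_normal p.
move=> k_gt0; rewrite (monicP _) ?monicXnsubC // scale1r in Dp.
have rn1 : all k.-unity_root r by apply/allP => z; rewrite -root_prod_XsubC -Dp.
have sz_r : (k < (size r).+1)%N by rewrite -(size_prod_XsubC r id) -Dp size_XnsubC.
have [|z] := hasP (has_prim_root k_gt0 rn1 _ sz_r); last by exists z.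
by rewrite -separable_prod_XsubC -Dp separable_Xn_sub_1 // pnatr_eq0 -lt0n.
Qed.

End Roots.

Section RadicalField.
Variables (L : fieldExtType rat) (theta : L) (a : nat).
Local Notation n := (\dim {:L}).
Definition power_basis : n.-tuple L := [tuple theta ^+ i | i < n].
Hypotheses (a_gt0 : (0 < a)%N) (theta_n : theta ^+ n = a%:R) (pow_free : free power_basis).

Lemma power_basisE (i : 'I_n) : power_basis`_i = theta ^+ i.
Proof. by rewrite -tnth_nth tnth_mktuple. Qed.

Lemma power_basisP : basis_of {:L} power_basis.
Proof. by rewrite basisEfree pow_free subvf size_tuple leqnn. Qed.

Definition poly_of (x : L) : {poly rat} := \sum_(k < n) coord power_basis k x *: 'X^k.

Lemma poly_ofK x : horner_alg theta (poly_of x) = x.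
Proof.
rewrite /poly_of linear_sum [RHS](coord_basis power_basisP (memvf x)).
by apply: eq_bigr => k _; rewrite linearZ rmorphXn /= horner_algX power_basisE ?mulr_algl.
Qed.

Lemma alg_eval_small (q : {poly rat}) : (size q <= n)%N -> horner_alg theta q = 0 -> q = 0.
Proof.
move=> sq q0; have qE : q = \sum_(i < n) q`_i *: 'X^i.
  apply/polyP => k; rewrite -poly_def coef_poly; case: ltnP => // nk.
  by rewrite nth_default // (leq_trans sq).
have c0 : forall i : 'I_n, q`_i = 0.
  apply: ((@freeP _ _ _ power_basis) pow_free (fun i : 'I_n => q`_i)).
  rewrite -[RHS]q0 [in RHS]qE linear_sum; apply: eq_bigr => i _.
  by rewrite linearZ rmorphXn /= horner_algX power_basisE ?mulr_algl.
by rewrite qE big1 // => i _; rewrite c0 scale0r.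
Qed.

Section Embedding.
Variables (C : numClosedFieldType) (z : C).
Hypothesis z_n : z ^+ n = a%:R.

Definition ev_at (q : {poly rat}) : C := (map_poly ratr q).[z].

Lemma ev_atB q r : ev_at (q - r) = ev_at q - ev_at r.
Proof. by rewrite /ev_at rmorphB hornerD hornerN. Qed.
Lemma ev_atM q r : ev_at (q * r) = ev_at q * ev_at r.
Proof. by rewrite /ev_at rmorphM hornerM. Qed.

(** A polynomial vanishing at [theta] is a multiple of X ^ n - a, because its
    remainder is a relation between the powers of [theta]. *)
Lemma ev_at_kernel (q : {poly rat}) : horner_alg theta q = 0 -> ev_at q = 0.
Proof.
move=> q0; pose M : {poly rat} := 'X^n - (a%:R)%:P.
have n0 : (0 < n)%N := adim_gt0 {:L}%AS.
have M0 : M != 0 by apply: monic_neq0; apply: monicXnsubC.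
have Mth : horner_alg theta M = 0.
  by rewrite rmorphB rmorphXn /= horner_algX horner_algC theta_n scaler_nat subrr.
have Mz : ev_at M = 0.
  rewrite ev_atB /ev_at map_polyXn hornerXn map_polyC hornerC z_n /=.
  by rewrite ratr_nat subrr.
have r0 : q %% M = 0.
  apply: alg_eval_small.
    by rewrite -ltnS -(size_XnsubC (a%:R : rat) n0) ltn_modp.
  have : horner_alg theta (q %/ M * M + q %% M) = 0 by rewrite -divp_eq.
  by rewrite rmorphD rmorphM /= Mth mulr0 add0r.
by rewrite (divp_eq q M) r0 addr0 ev_atM Mz mulr0.
Qed.

Lemma ev_at_eq (q r : {poly rat}) : horner_alg theta q = horner_alg theta r -> ev_at q = ev_at r.
Proof.
move=> e; apply/eqP; rewrite -subr_eq0 -ev_atB; apply/eqP/ev_at_kernel.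
by rewrite rmorphB /= e subrr.
Qed.

Lemma embedding_exists :
  exists s : {rmorphism L -> C}, forall q, s (horner_alg theta q) = ev_at q.
Proof.
pose f (x : L) := ev_at (poly_of x).
have fB : zmod_morphism f.
  by move=> x y; rewrite /f -ev_atB; apply: ev_at_eq; rewrite rmorphB /= !poly_ofK.
have fM : monoid_morphism f.
  split; last first.
    by move=> x y; rewrite /f -ev_atM; apply: ev_at_eq; rewrite rmorphM /= !poly_ofK.
  rewrite /f (_ : 1 = ev_at 1); last by rewrite /ev_at rmorph1 hornerC.
  by apply: ev_at_eq; rewrite poly_ofK rmorph1.
pose fA := GRing.isZmodMorphism.Build L C f fB.
pose fR := GRing.isMonoidMorphism.Build L C f fM.
pose s : {rmorphism L -> C} := HB.pack f fA fR.
by exists s => q; apply: ev_at_eq; rewrite poly_ofK.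
Qed.

End Embedding.

Section AllEmbeddings.
Variables (C : numClosedFieldType).

(** The conjugates of the powers of [theta] form a Vandermonde matrix in [n]
    distinct roots of [a]. The embeddings are indexed by natural numbers, with
    period [n], for the sake of products over shifted indices. *)
Lemma radical_embeddings : exists (z zeta : C) (sigma : nat -> {rmorphism L -> C}),
  [/\ z ^+ n = a%:R, n.-primitive_root zeta,
      forall i q, sigma i (horner_alg theta q) = ev_at (zeta ^+ i * z) q &
      conj_mx (fun i : 'I_n => sigma i) (fun j => (vbasis {:L})`_j) \in unitmx].
Proof.
have n0 : (0 < n)%N := adim_gt0 {:L}%AS.
have [zeta prim] := primitive_root_exists C n0.
pose z : C := n.-root a%:R.
have zn : z ^+ n = a%:R by rewrite rootCK.
have zin i : (zeta ^+ i * z) ^+ n = a%:R.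
  by rewrite exprMn -exprM mulnC exprM (prim_expr_order prim) expr1n mul1r.
have /choice[sigma hs] i := @embedding_exists C _ (zin i).
exists z, zeta, sigma; split=> //.
apply: (@conj_mx_vbasis _ _ _ (fun i => power_basis`_i)).
pose r : 'rV[C]_n := \row_i (zeta ^+ i * z).
have -> : conj_mx (fun i : 'I_n => sigma i) (fun i => power_basis`_i) = (Vandermonde n r)^T.
  apply/matrixP => i j; rewrite !mxE power_basisE.
  have -> : theta ^+ j = horner_alg theta 'X^j by rewrite rmorphXn /= horner_algX.
  by rewrite hs /ev_at map_polyXn hornerXn.
rewrite unitmx_tr unitmxE det_Vandermonde unitfE.
apply/prodf_neq0 => i _; apply/prodf_neq0 => j ij; rewrite !mxE -mulrBl mulf_neq0 //.
  rewrite subr_eq0 (eq_prim_root_expr prim) !modn_small // eq_sym.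
  by rewrite neq_ltn ij.
apply/eqP => z0; move: zn; rewrite z0 expr0n gtn_eqF // => /esym/eqP.
by rewrite pnatr_eq0 gtn_eqF.
Qed.

End AllEmbeddings.
End RadicalField.

(** * Ramification in radical fields *)

Section RadicalFieldExists.
Variables (R : realType) (m b p : nat).
Hypotheses (m_gt0 : (0 < m)%N) (b_gt0 : (0 < b)%N) (p_prime : prime p) (p_neq2 : p != 2).
Local Notation D := (m * b)%N.
Local Notation a := (2 * p ^ m)%N.

Let a_gt0 : (0 < a)%N. Proof. by rewrite muln_gt0 expn_gt0 (prime_gt0 p_prime). Qed.
Let D_gt0 : (0 < D)%N. Proof. by rewrite muln_gt0 m_gt0 b_gt0. Qed.

(** The powers of a root of X ^ D - 2 p ^ m are independent because their
    2-adic sizes lie in different classes modulo the powers of 2: the 2-adic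
    form of Eisenstein's criterion. *)
Lemma radical_field_exists : exists (L : fieldExtType rat) (iota : {rmorphism L -> algC})
  (theta : L), [/\ \dim {:L} = D, theta ^+ (\dim {:L}) = a%:R,
    <<1; theta>>%VS = {:L}%VS & free (power_basis theta)].
Proof.
pose t0 : algC := D.-root a%:R.
have t0D : t0 ^+ D = a%:R by rewrite rootCK.
have [L [iota [s1]]] := num_field_exists [:: t0].
case: s1 => [|theta [|]] //= [it0]; rewrite adjoin_seq1 => gen.
have thD : theta ^+ D = a%:R.
  by apply: (fmorph_inj iota); rewrite rmorphXn /= it0 t0D rmorph_nat.
have indep N : N = D -> free [tuple theta ^+ i | i < N].
  move=> ->; apply/freeP => c c0 i.
  have [w [aw um w_rat]] := padic_absval_exists R (isT : prime 2).
  have wt : w t0 ^+ D = (2%:R)^-1.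
    rewrite -(avX aw) t0D (w_nat w_rat) //.
    rewrite lognM ?expn_gt0 ?prime_gt0 // lognX (logn_prime 2 p_prime) eq_sym (negPf p_neq2).
    by rewrite muln0 addn0 expr1.
  have := terms_le (isT : prime 2) aw um D_gt0 wt (a := fun i => ratr (c i)).
  have -> : \sum_j (ratr (c j) : algC) * t0 ^+ j = 0.
    have := congr1 iota c0; rewrite rmorph0 rmorph_sum => e; rewrite -[RHS]e.
    apply: eq_bigr => j _.
    by rewrite rmorph_ratZ -tnth_nth tnth_mktuple rmorphXn /= it0.
  rewrite (av0 aw) => /(_ _ i) le0.
  have /(av_eq0 aw)/eqP : w (ratr (c i) * t0 ^+ i) = 0.
    apply/eqP; rewrite eq_le (av_ge0 aw) andbT; apply: le0 => j.
    have [->|cj] := eqVneq (c j) 0; [by left; rewrite rmorph0 | right].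
    exact: (integral_value_rat (isT : prime 2) w_rat).
  rewrite mulf_eq0 fmorph_eq0 => /orP[/eqP //|]; rewrite expf_eq0 => /andP[_ /eqP t00].
  by move: t0D; rewrite t00 expr0n gtn_eqF // => /esym/eqP; rewrite pnatr_eq0 gtn_eqF.
have dimD : \dim {:L} = D.
  apply/eqP; rewrite eqn_leq; apply/andP; split.
    rewrite -gen dim_Fadjoin dimv1 muln1 -ltnS -size_minPoly -(size_XnsubC (a%:R : L) D_gt0).
    apply: dvdp_leq; first by apply: monic_neq0; apply: monicXnsubC.
    apply: minPoly_dvdp; last by rewrite rootE !hornerE thD subrr.
    by rewrite rpredB ?rpredX ?polyOverX // polyOverC rpred_nat.
  have /eqP := indep D erefl; rewrite size_tuple => <-.
  by apply: dimvS; apply: subvf.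
exists L, iota, theta; split=> //; first by rewrite dimD.
by rewrite /power_basis; apply: indep.
Qed.

End RadicalFieldExists.

Section RamifiedBound.
Variables (R : realType) (C : numClosedFieldType) (w : C -> R) (p m b : nat).
Hypotheses (p_prime : prime p) (aw : absval w) (um : ultrametric w).
Hypothesis w_rat : forall q, w (ratr q) = padic_abs R p q.
Hypotheses (m_gt0 : (0 < m)%N) (b_gt0 : (0 < b)%N) (p_m2 : coprime p (m * 2)).
Local Notation P := (p%:R : R).
Variables (z om : C).
Hypotheses (zD : z ^+ (m * b) = (2 * p ^ m)%:R) (om_b : om ^+ b = 1).

Let P_gt1 : 1 < P. Proof. by rewrite ltr1n prime_gt1. Qed.
Let P_gt0 : 0 < P. Proof. exact: lt_trans P_gt1. Qed.
Let pC : p%:R != 0 :> C. Proof. by rewrite pnatr_eq0 -lt0n prime_gt0. Qed.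

Lemma w_root : w z ^+ b = P^-1.
Proof.
have e : (w z ^+ b) ^+ m = (P^-1) ^+ m.
  rewrite -exprM mulnC -(avX aw) zD natrM natrX (avM aw) (avX aw) (w_p p_prime w_rat).
  rewrite (w_coprime p_prime w_rat) ?mul1r //.
  by move: p_m2; rewrite coprimeMr => /andP[].
by move/eqP: e; rewrite eqrXn2 ?exprn_ge0 ?(av_ge0 aw) ?invr_ge0 ?(ltW P_gt0) // => /eqP.
Qed.

Lemma w_root_le1 : w z <= 1.
Proof.
rewrite leNgt; apply/negP => w1; have : 1 < w z ^+ b by rewrite exprn_egt1 // -lt0n.
by rewrite w_root invf_gt1 // ltNge (ltW P_gt1).
Qed.

Lemma w_om : w om = 1.
Proof.
have /eqP := congr1 w om_b; rewrite (avX aw) (av1 aw).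
by rewrite pexpr_eq1 ?(av_ge0 aw) // => /eqP.
Qed.

Lemma residue_decomposition (q : {poly rat}) : exists A : nat -> {poly rat},
  forall y : C, ev_at y q = \sum_(i < b) ev_at (y ^+ b) (A i) * y ^+ i.
Proof.
case: b b_gt0 => // b' _; elim/poly_ind: q => [|q c [A hA]].
  exists (fun=> 0) => y; rewrite /ev_at rmorph0 horner0.
  by rewrite big1 // => i _; rewrite ?rmorph0 horner0 mul0r.
exists (fun i => if i is i'.+1 then A i' else A b' * 'X + c%:P) => y.
have evE r : ev_at r (q * 'X + c%:P) = ev_at r q * r + ratr c.
  by rewrite /ev_at rmorphD rmorphM /= map_polyX map_polyC !hornerE.
rewrite evE hA big_ord_recr [in RHS]big_ord_recl /= expr0 mulr1.
have -> : ev_at (y ^+ b'.+1) (A b' * 'X + c%:P) = ev_at (y ^+ b'.+1) (A b') * y ^+ b'.+1 + ratr c.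
  by rewrite /ev_at rmorphD rmorphM /= map_polyX map_polyC !hornerE.
rewrite [RHS]addrC addrA mulrDl mulr_suml -mulrA -exprSr; congr (_ + _ + _).
by apply: eq_bigr => i _; rewrite -mulrA -exprSr.
Qed.

(** Write the element as a sum of a_i z ^ i with coefficients from the field of
    eta = z ^ b / p, where p is unramified since eta ^ m = 2. If the sum is
    integral then so is each a_i, and replacing z by om z only changes terms that
    are divisible by z. *)
Lemma ev_close (q : {poly rat}) : w (ev_at z q) <= 1 ->
  w (ev_at z q - ev_at (om * z) q) <= w z.
Proof.
have [A hA] := residue_decomposition q.
pose eta := z ^+ b / p%:R.
have eta_m : eta ^+ m = 2%:R.
  by rewrite expr_div_n -exprM mulnC zD natrM natrX mulfK // expf_neq0.
have iv (i : 'I_b) : ev_at (z ^+ b) (A i) = 0 \/ integral_value w p (ev_at (z ^+ b) (A i)).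
  have -> : ev_at (z ^+ b) (A i) = ev_at eta (A i \Po (p%:R *: 'X)).
    rewrite /ev_at map_comp_poly horner_comp map_polyZ map_polyX hornerZ hornerX /= ratr_nat.
    by rewrite /eta mulrC divfK.
  exact: (unramified p_prime aw um w_rat m_gt0 eta_m p_m2).
rewrite [in X in X -> _]hA => q1.
have ai1 (i : 'I_b) : w (ev_at (z ^+ b) (A i)) <= 1.
  have [->|[k kE]] := iv i; first by rewrite (av0 aw).
  have h := le_trans (terms_le p_prime aw um b_gt0 w_root iv i) q1.
  rewrite kE; case: k kE => [[|k]|k] kE; rewrite ?expr0z //.
    exfalso; move: h; rewrite (avM aw) (avX aw) kE leNgt => /negP; apply.
    rewrite -(@ltr_pXn2r _ b) ?nnegrE ?mulr_ge0 ?exprn_ge0 ?(av_ge0 aw) ?(ltW P_gt0) //.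
    have e : (w z ^+ i) ^+ b = (P ^+ i)^-1 by rewrite -exprM mulnC exprM w_root exprVn.
    rewrite expr1n exprMn e -[P ^ _]/(P ^+ k.+1) -exprM.
    rewrite ltr_pdivlMr ?exprn_gt0 // mul1r ltr_eXn2l //.
    by rewrite mulSn ltn_addr.
  by rewrite NegzE -exprnN invf_le1 ?exprn_gt0 // exprn_ege1 // ltW.
rewrite !hA exprMn om_b mul1r -sumrB; apply: (um_sum aw um); first exact: (av_ge0 aw).
move=> i _; rewrite -mulrBr (avM aw) exprMn.
have -> : z ^+ i - om ^+ i * z ^+ i = (1 - om ^+ i) * z ^+ i by rewrite mulrBl mul1r.
rewrite (avM aw) (avX aw).
have [i0|i0] := posnP i; first by rewrite i0 expr0 subrr (av0 aw) mul0r mulr0 (av_ge0 aw).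
have o1 : w (1 - om ^+ i) <= 1.
  by apply: (le_trans (umB aw um _ _)); rewrite (av1 aw) (avX aw) w_om expr1n maxxx.
have z1 : w z ^+ i <= w z.
  by rewrite -(prednK i0) exprS ler_piMr ?(av_ge0 aw) // exprn_ile1 ?(av_ge0 aw) // w_root_le1.
apply: le_trans z1; rewrite mulrA ler_piMl ?exprn_ge0 ?(av_ge0 aw) //.
by rewrite mulr_ile1 ?(av_ge0 aw).
Qed.

(** The case of a non-integral element reduces to that of its inverse. *)
Lemma ramified_bound (L : fieldExtType rat) (s s' : {rmorphism L -> C}) :
  (forall x, exists q, s x = ev_at z q /\ s' x = ev_at (om * z) q) ->
  forall x, w (s x - s' x) <= w z * (Num.max 1 (w (s x)) * Num.max 1 (w (s' x))).
Proof.
move=> ss x.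
have m1 (y : C) : 1 <= Num.max 1 (w y) by rewrite le_max lexx.
have [x1|x1] := leP (w (s x)) 1.
  have [q [sE s'E]] := ss x.
  have : w (s x - s' x) <= w z by rewrite sE s'E ev_close // -sE.
  move/le_trans; apply; rewrite ler_peMr ?(av_ge0 aw) // mulr_ege1 //.
have x0 : x != 0 by apply: contraTneq x1 => ->; rewrite rmorph0 (av0 aw) -leNgt.
have [s0 s0'] : s x != 0 /\ s' x != 0 by rewrite !fmorph_eq0.
have [q [sE s'E]] := ss x^-1.
have h : w (s x^-1 - s' x^-1) <= w z.
  rewrite sE s'E ev_close // -sE fmorphV (avV aw) invf_le1 ?(ltW x1) //.
  exact: lt_trans x1.
have -> : s x - s' x = - ((s x^-1 - s' x^-1) * (s x * s' x)).
  by rewrite !fmorphV; field; rewrite s0 s0'.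
rewrite (avN aw) (avM aw); apply: ler_pM; rewrite ?(av_ge0 aw) // (avM aw).
by apply: ler_pM; rewrite ?(av_ge0 aw) // le_max lexx orbT.
Qed.

End RamifiedBound.

(** * The relative different *)

Section RelativeDifferent.
Variable b : nat.
Hypothesis b_prime : prime b.

(** Multiplication by s permutes the nonzero residues modulo the prime b. *)
Lemma prod_prim_root_pow (C : numClosedFieldType) (om : C) (F : C -> C) s :
  b.-primitive_root om -> (0 < s < b)%N ->
  \prod_(1 <= k < b) F (om ^+ s ^+ k) = \prod_(1 <= k < b) F (om ^+ k).
Proof.
move=> prim /andP[s0 sb].
have b0 : (0 < b)%N := prime_gt0 b_prime.
have sk k : (0 < k < b)%N -> (s * k %% b != 0)%N.
  move=> /andP[k0 kb]; rewrite -/(b %| s * k)%N Euclid_dvdM // negb_or.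
  by rewrite !gtnNdvd.
have uniq_pow f : {in index_iota 1 b &, injective f} ->
    (forall k, k \in index_iota 1 b -> (f k < b)%N) ->
    uniq [seq om ^+ f k | k <- index_iota 1 b].
  move=> fi fb; rewrite map_inj_in_uniq ?iota_uniq // => i j ib jb /eqP.
  rewrite (eq_prim_root_expr prim) !modn_small ?fb // => /eqP; exact: fi.
rewrite -[LHS](big_map (fun k => om ^+ s ^+ k) predT F) -[RHS](big_map (fun k => om ^+ k) predT F).
have -> : [seq om ^+ s ^+ k | k <- index_iota 1 b] =
    [seq om ^+ (s * k %% b)%N | k <- index_iota 1 b].
  by apply: eq_map => k; rewrite -exprM (prim_expr_mod prim).
have u1 : uniq [seq om ^+ (s * k %% b)%N | k <- index_iota 1 b].
  apply: uniq_pow => [i j|k _]; last by rewrite ltn_pmod.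
  rewrite !mem_index_iota => /andP[_ ib] /andP[_ jb] e.
  wlog ij : i j ib jb e / (i <= j)%N.
    move=> W; have [/W ->//|/ltnW /W h] := leqP i j; by rewrite h.
  have : (b %| s * (j - i))%N by rewrite mulnBr -eqn_mod_dvd ?leq_mul2l ?ij ?orbT // e.
  rewrite Euclid_dvdM // gtnNdvd //= => d; apply/eqP; rewrite eqn_leq ij /= -subn_eq0.
  by apply: contraTT d; rewrite -lt0n => h; rewrite gtnNdvd // (leq_ltn_trans (leq_subr _ _)).
have u2 : uniq [seq om ^+ k | k <- index_iota 1 b].
  by apply: uniq_pow => // k; rewrite mem_index_iota => /andP[].
apply: perm_big; apply: uniq_perm => //.
have sub : {subset [seq om ^+ (s * k %% b)%N | k <- index_iota 1 b] <=
                   [seq om ^+ k | k <- index_iota 1 b]}.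
  move=> _ /mapP[k kb ->]; apply: map_f; rewrite mem_index_iota lt0n ltn_pmod // andbT.
  by apply: sk; rewrite -mem_index_iota.
by have [|_ //] := uniq_min_size u1 sub; rewrite !size_map.
Qed.

Lemma sum_prim_root_pow (C : numClosedFieldType) (om : C) l : b.-primitive_root om ->
  \sum_(1 <= s < b) om ^+ s ^+ l = if (b %| l)%N then b.-1%:R else -1.
Proof.
move=> prim; have b0 : (0 < b)%N := prime_gt0 b_prime.
have e s : om ^+ s ^+ l = (om ^+ l) ^+ s by rewrite -!exprM mulnC.
under eq_bigr do rewrite e.
case: ifPn => bl.
  have -> : om ^+ l = 1 by apply/eqP; rewrite -(prim_order_dvd prim).
  under eq_bigr do rewrite expr1n.
  by rewrite sumr_const_nat subn1.
have o1 : om ^+ l - 1 != 0 by rewrite subr_eq0 -(prim_order_dvd prim).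
have : (om ^+ l - 1) * (\sum_(i < b) (om ^+ l) ^+ i) = 0.
  by rewrite -subrX1 -exprM mulnC exprM (prim_expr_order prim) expr1n subrr.
move/eqP; rewrite mulf_eq0 (negPf o1) /= -(big_mkord predT (fun i => (om ^+ l) ^+ i)).
by rewrite (big_ltn b0) expr0 addrC addr_eq0 => /eqP.
Qed.

(** The conjugates of A over the subfield fixed by y -> om y give a product
    that is a polynomial in y with rational coefficients: each coefficient is a
    polynomial in om taking the same value at all primitive roots of unity, hence
    equal to its average over them. *)
Lemma relative_different (A : {poly rat}) : exists B : {poly rat},
  forall (C : numClosedFieldType) (om y : C), b.-primitive_root om ->
    ev_at y B = \prod_(1 <= k < b) (ev_at y A - ev_at (om ^+ k * y) A).
Proof.
pose tw k : {poly {poly rat}} := \poly_(i < size A) (A`_i *: 'X^(k * i)).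
pose G := \prod_(1 <= k < b) (tw 0 - tw k).
pose kap l : rat := if (b %| l)%N then b.-1%:R else -1.
exists (\poly_(j < size G) (\sum_(l < size G`_j) G`_j`_l * kap l / b.-1%:R)) => C om y prim.
have b0 : (0 < b.-1)%N by rewrite -subn1 subn_gt0 prime_gt1.
have b1 : b.-1%:R != 0 :> C by rewrite pnatr_eq0 -lt0n.
pose ev2 r (H : {poly {poly rat}}) : C := (map_poly (horner_eval r \o map_poly ratr) H).[y].
have tw_ev r k : ev2 r (tw k) = ev_at (r ^+ k * y) A.
  rewrite /ev2 /tw /ev_at [RHS]horner_coef size_map_poly.
  rewrite (@horner_coef_wide _ (size A)); last first.
    exact: leq_trans (size_poly _ _) (size_poly _ _).
  apply: eq_bigr => i _; rewrite !coef_map coef_poly ltn_ord /= /horner_eval.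
  by rewrite map_polyZ map_polyXn !hornerE exprMn -exprM mulrA.
have G_ev r : ev2 r G = \prod_(1 <= k < b) (ev_at y A - ev_at (r ^+ k * y) A).
  rewrite /ev2 /G rmorph_prod horner_prod; apply: eq_bigr => k _.
  by rewrite rmorphB hornerD hornerN -!/(ev2 _ _) !tw_ev expr0 mul1r.
apply: (mulIf b1).
transitivity (\sum_(1 <= s < b) ev2 (om ^+ s) G); last first.
  rewrite (eq_big_nat _ _ (F2 := fun=> ev2 om G)) ?sumr_const_nat ?subn1 ?G_ev ?mulr_natr //.
  move=> s sb; rewrite !G_ev.
  exact: (prod_prim_root_pow (fun t => ev_at y A - ev_at (t * y) A) prim sb).
have ev2E r : ev2 r G = \sum_(j < size G) \sum_(l < size G`_j) ratr G`_j`_l * r ^+ l * y ^+ j.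
  rewrite /ev2 (@horner_coef_wide _ (size G)) ?size_poly //.
  apply: eq_bigr => j _; rewrite coef_map /= /horner_eval horner_coef size_map_poly mulr_suml.
  by apply: eq_bigr => l _; rewrite coef_map.
under [RHS]eq_bigr do rewrite ev2E.
rewrite exchange_big /= /ev_at (@horner_coef_wide _ (size G)); last first.
  exact: leq_trans (size_poly _ _) (size_poly _ _).
rewrite mulr_suml; apply: eq_bigr => j _.
rewrite exchange_big /= coef_map coef_poly ltn_ord /= rmorph_sum !mulr_suml.
apply: eq_bigr => l _; rewrite -mulr_suml -mulr_sumr (sum_prim_root_pow _ prim).
have -> : (if (b %| l)%N then b.-1%:R else -1) = ratr (kap l) :> C.
  by rewrite /kap; case: ifP => _; rewrite ?ratr_nat // rmorphN1.
by rewrite fmorph_div !rmorphM /= ratr_nat mulrAC divfK.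
Qed.

End RelativeDifferent.

(** * Local bounds on the relative different *)

Lemma prod_periodic (R : comNzRingType) (f : nat -> R) n c : (forall i, f (i + n)%N = f i) ->
  \prod_(i < n) f (i + c)%N = \prod_(i < n) f i.
Proof.
move=> per; elim: c => [|c IHc]; first by apply: eq_bigr => i _; rewrite addn0.
rewrite -{}IHc; case: n per => [|n] per; first by rewrite !big_ord0.
rewrite big_ord_recr [RHS]big_ord_recl /= mulrC addnS add0n.
congr (_ * _); first by rewrite -addSn addnC per.
by apply: eq_bigr => i _; rewrite addnS.
Qed.

Section HeightLowerBound.
Variables (R : realType) (m b p : nat).
Hypotheses (m_gt0 : (0 < m)%N) (b_prime : prime b) (p_prime : prime p).
Hypothesis p_m2 : coprime p (m * 2).
Local Notation P := (p%:R : R).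
Local Notation a := (2 * p ^ m)%N.
Variables (L : fieldExtType rat) (theta : L).
Local Notation n := (\dim {:L}).
Hypotheses (L_dim : n = (m * b)%N) (theta_n : theta ^+ n = a%:R).
Hypothesis pow_free : free (power_basis theta).

Let a_gt0 : (0 < a)%N. Proof. by rewrite muln_gt0 expn_gt0 (prime_gt0 p_prime). Qed.

(** The factor gained or lost at each place of the rationals when comparing the
    relative different of an element with its height. *)
Definition defect (s : option nat) : R :=
  if s is Some l then (if l == p then (P ^+ (m * b.-1))^-1 else 1)
  else 2%:R ^+ (n * b.-1).

Section OnePlace.
Variables (C : numClosedFieldType) (w : C -> R).
Hypothesis aw : absval w.
Variables (z zeta : C) (sigma : nat -> {rmorphism L -> C}) (alpha x : L) (c : R).
Hypothesis zeta_prim : n.-primitive_root zeta.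
Hypothesis sigma_ev : forall i q, sigma i (horner_alg theta q) = ev_at (zeta ^+ i * z) q.
Hypothesis x_conj : forall i,
  sigma i x = \prod_(1 <= k < b) (sigma i alpha - sigma (i + m * k)%N alpha).
Local Notation M i := (Num.max 1 (w (sigma i alpha))).
Hypothesis diff_bound : forall i k,
  w (sigma i alpha - sigma (i + m * k)%N alpha) <= c * (M i * M (i + m * k)%N).

Lemma sigma_periodic i y : sigma (i + n)%N y = sigma i y.
Proof.
rewrite -(poly_ofK pow_free y) !sigma_ev.
by rewrite exprD (prim_expr_order zeta_prim) mulr1.
Qed.

(** Every conjugate of [alpha] occurs 2 (b - 1) times among the differences. *)
Lemma different_bound :
  \prod_(i < n) w (sigma i x) <= c ^+ (n * b.-1) * (\prod_(i < n) M i) ^+ (2 * b.-1).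
Proof.
have M0 i : 0 <= M i by rewrite le_max ler01.
apply: (@le_trans _ _ (\prod_(i < n) \prod_(1 <= k < b) (c * (M i * M (i + m * k)%N)))).
  apply: ler_prod => i _; rewrite (av_ge0 aw) /= x_conj (av_prod aw).
  by apply: ler_prod => k _; rewrite (av_ge0 aw) diff_bound.
rewrite le_eqVlt; apply/orP; left; apply/eqP.
have cst (y : R) : \prod_(1 <= k < b) y = y ^+ b.-1 by rewrite prodr_const_nat subn1.
under eq_bigr do rewrite big_split /= big_split /= !cst.
rewrite !big_split /= prodr_const card_ord -exprM mulnC; congr (_ * _).
rewrite prodrXl exchange_big /=.
have per i : M (i + n)%N = M i by rewrite sigma_periodic.
have shift k : \prod_(i < n) M (i + m * k)%N = \prod_(i < n) M i.
  exact: (@prod_periodic _ (fun i => M i) n _ per).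
under [X in _ * X = _]eq_bigr do rewrite shift.
by rewrite cst -exprD addnn mul2n.
Qed.

End OnePlace.

(** The relative different of [alpha] over the subfield generated by theta ^ b is
    given by the same element in every algebraically closed field, which allows
    its sizes at different places to be compared. *)
Lemma radical_different (alpha : L) : exists x : L,
  forall (C : numClosedFieldType) (z zeta : C) (sigma : nat -> {rmorphism L -> C}),
    n.-primitive_root zeta ->
    (forall i q, sigma i (horner_alg theta q) = ev_at (zeta ^+ i * z) q) ->
    forall i, sigma i x = \prod_(1 <= k < b) (sigma i alpha - sigma (i + m * k)%N alpha).
Proof.
have [B hB] := relative_different b_prime (poly_of theta alpha).
exists (horner_alg theta B) => C z zeta sigma prim hs i.
have prim_m : b.-primitive_root (zeta ^+ m).
  have bn : (b %| n)%N by rewrite L_dim dvdn_mull.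
  have := dvdn_prim_root prim bn.
  by rewrite {1}L_dim mulnK // prime_gt0.
rewrite hs (hB _ _ _ prim_m); apply: eq_bigr => k _.
have ha j : sigma j alpha = ev_at (zeta ^+ j * z) (poly_of theta alpha).
  by rewrite -hs (poly_ofK pow_free).
rewrite !ha; congr (_ - ev_at _ _).
by rewrite exprD exprM mulrA [_ ^+ i * _]mulrC.
Qed.

(** What the places above [s] contribute to the height of [alpha], and the bound
    on the norm of its relative different [x] in terms of this contribution. *)
Definition place_family (s : option nat) (alpha x : L) (fam : 'I_n -> L -> R) : Prop :=
  [/\ forall i, lies_above (rat_abs R s) (fam i),
      forall i, (#|[pred j | fam j == fam i]| <= local_degree (fam i))%N &
      rat_abs R s (field_norm x) <=
        defect s * (\prod_i Num.max 1 (fam i alpha)) ^+ (2 * b.-1)].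

Lemma place_family_of (s : option nat) (C : numClosedFieldType) (w : C -> R) (c : R) alpha x :
  rat_place s -> absval w -> (forall q, w (ratr q) = rat_abs R s q) ->
  c ^+ (n * b.-1) = defect s ->
  (forall (z zeta : C) (sigma : nat -> {rmorphism L -> C}),
    n.-primitive_root zeta ->
    (forall i q, sigma i (horner_alg theta q) = ev_at (zeta ^+ i * z) q) ->
    forall i, sigma i x = \prod_(1 <= k < b) (sigma i alpha - sigma (i + m * k)%N alpha)) ->
  (forall (z om : C) (t t' : {rmorphism L -> C}), z ^+ n = a%:R -> om ^+ b = 1 ->
    (forall q, t (horner_alg theta q) = ev_at z q) ->
    (forall q, t' (horner_alg theta q) = ev_at (om * z) q) ->
    w (t alpha - t' alpha) <= c * (Num.max 1 (w (t alpha)) * Num.max 1 (w (t' alpha)))) ->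
  exists fam, place_family s alpha x fam.
Proof.
move=> ss aw w_rat cE hx hb; have [q0 q0_big] := rat_abs_big R ss.
have [z [zeta [sigma [zn prim hs V_unit]]]] := radical_embeddings a_gt0 theta_n pow_free C.
exists (induced w (fun i : 'I_n => sigma i)); split.
- by move=> i; apply: (induced_above aw w_rat).
- by move=> i; apply: (local_degree_ge aw w_rat q0_big).
rewrite -w_rat (field_norm_conj V_unit) (av_prod aw) -cE /induced.
apply: (different_bound aw prim hs (hx _ _ _ prim hs)) => i k.
apply: (hb (zeta ^+ i * z) ((zeta ^+ m) ^+ k)).
- by rewrite exprMn -exprM mulnC exprM (prim_expr_order prim) expr1n mul1r.
- have -> : ((zeta ^+ m) ^+ k) ^+ b = (zeta ^+ n) ^+ k.
    by rewrite -!exprM; congr (_ ^+ _); rewrite L_dim; ring.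
  by rewrite (prim_expr_order prim) expr1n.
- by move=> q; apply: hs.
- by move=> q; rewrite hs exprD exprM mulrA [_ ^+ i * _]mulrC.
Qed.

Lemma normc_absval : absval (@Normc.normc R).
Proof.
split.
- by case=> u v; apply: sqrtr_ge0.
- by move=> u; split=> [/Normc.eq0_normc|->] //; apply: Normc.normc0.
- exact: Normc.normcM.
- exact: le_normcD.
Qed.

Lemma normc_rat q : @Normc.normc R (ratr q) = @real_abs R q.
Proof.
have -> : ratr q = (ratr q)%:C%C :> R[i] by rewrite -(fmorph_rat (real_complex R)).
by rewrite /= expr0n addr0 sqrtr_sqr /real_abs ratr_norm.
Qed.

(** The constant is 2 at the archimedean place, the size of [theta] at p by
    [ramified_bound], and 1 elsewhere by the ultrametric inequality. *)
Lemma local_bound s alpha x : rat_place s ->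
  (forall (C : numClosedFieldType) (z zeta : C) (sigma : nat -> {rmorphism L -> C}),
    n.-primitive_root zeta ->
    (forall i q, sigma i (horner_alg theta q) = ev_at (zeta ^+ i * z) q) ->
    forall i, sigma i x = \prod_(1 <= k < b) (sigma i alpha - sigma (i + m * k)%N alpha)) ->
  exists fam, place_family s alpha x fam.
Proof.
move=> ss hx; have m1 (y : R) : 1 <= Num.max 1 y by rewrite le_max lexx.
case: s ss => [l|] ss; last first.
  apply: (place_family_of ss normc_absval normc_rat (c := 2%:R)) => //; first exact: hx.
  move=> z om t t' _ _ _ _; apply: le_trans (avB normc_absval _ _) _.
  set u := Normc.normc _; set v := Normc.normc _.
  have u1 : u <= Num.max 1 u by rewrite le_max lexx orbT.
  have v1 : v <= Num.max 1 v by rewrite le_max lexx orbT.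
  have := m1 u; have := m1 v; nra.
have [w [aw um w_rat]] := padic_absval_exists R ss.
have [lp|lp] := eqVneq l p.
  pose z0 : algC := n.-root a%:R.
  have n0 : (0 < n)%N := adim_gt0 {:L}%AS.
  have z0n : z0 ^+ n = a%:R by rewrite rootCK.
  subst l.
  have wz z : z ^+ n = a%:R -> w z = w z0.
    move=> zn; apply/eqP; rewrite -(@eqrXn2 _ n) ?(av_ge0 aw) //.
    by rewrite -!(avX aw) zn z0n.
  have b0 := prime_gt0 b_prime.
  apply: (place_family_of ss aw w_rat (c := w z0)) => //.
  - rewrite /= eqxx L_dim mulnAC mulnC exprM.
    rewrite L_dim in z0n; rewrite (w_root p_prime aw w_rat m_gt0 p_m2 z0n).
    by rewrite exprVn.
  - exact: hx.
  - move=> z om t t' zn om_b tE t'E.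
    rewrite -(wz z zn); rewrite L_dim in zn.
    apply: (ramified_bound p_prime aw um w_rat m_gt0 b0 p_m2 zn om_b) => y.
    by exists (poly_of theta y); rewrite -tE -t'E (poly_ofK pow_free).
apply: (place_family_of ss aw w_rat (c := 1)) => //.
- by rewrite /= (negPf lp) expr1n.
- exact: hx.
move=> z om t t' _ _ _ _; rewrite mul1r; apply: le_trans (umB aw um _ _) _.
set u := w _; set v := w _; have := m1 u; have := m1 v; rewrite ge_max => v1 u1.
have u2 : u <= Num.max 1 u by rewrite le_max lexx orbT.
have v2 : v <= Num.max 1 v by rewrite le_max lexx orbT.
by apply/andP; split; nra.
Qed.

End HeightLowerBound.

(** * The product formula and the height of a generator *)

Section ProductFormula.
Variable R : realType.

Lemma prod_primes_logn k N : (0 < N)%N -> (k %| N)%N ->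
  (\prod_(l <- primes N) l ^ logn l k)%N = k.
Proof.
move=> N0 kN; have k0 : (0 < k)%N := dvdn_gt0 N0 kN.
rewrite [RHS](prod_prime_decomp k0) prime_decompE big_map /= (bigID (mem (primes k))) /=.
rewrite [X in (_ * X)%N]big1 ?muln1; last first.
  by move=> l; rewrite -logn_gt0 -eqn0Ngt => /eqP ->.
rewrite -big_filter; apply/perm_big/uniq_perm; rewrite ?filter_uniq ?primes_uniq // => l.
rewrite mem_filter /= andb_idr // !mem_primes => /and3P[-> _ lk].
by rewrite N0 (dvdn_trans lk kN).
Qed.

Lemma rat_product_formula q N : q != 0 -> (0 < N)%N ->
  (`|numq q| %| N)%N -> (`|denq q| %| N)%N ->
  \prod_(s <- None :: [seq Some l | l <- primes N]) rat_abs R s q = 1.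
Proof.
move=> q0 N0 numN denN; rewrite big_cons big_map /= /padic_abs (negPf q0).
rewrite prodf_div.
have e k : (k %| N)%N -> \prod_(l <- primes N) (l%:R ^+ logn l k : R) = k%:R.
  move=> kN; rewrite -[in RHS](prod_primes_logn N0 kN) natr_prod.
  by apply: eq_bigr => l _; rewrite natrX.
rewrite !e // /real_abs.
have -> : `|q| = (`|numq q|%N)%:R / (`|denq q|%N)%:R.
  by rewrite -{1}[q]divq_num_den normf_div -!intr_norm -!abszE.
rewrite fmorph_div /= !ratr_nat mulrA divfK ?divff // pnatr_eq0 absz_eq0.
  by rewrite numq_eq0.
exact: denq_neq0.
Qed.

Lemma rat_abs_inj s t : rat_place s -> rat_place t -> rat_abs R s =1 rat_abs R t -> s = t.
Proof.
have arch l : rat_abs R None 2%:R = rat_abs R (Some l) 2%:R -> False.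
  have := padic_abs_nat R l 2; rewrite /= /real_abs => le1 e; move: le1; rewrite -e.
  by rewrite ger0_norm // ratr_nat lern1.
have self l : prime l -> padic_abs R l l%:R = l%:R^-1.
  by move=> lp; rewrite padic_abs_natE ?prime_gt0 // logn_prime // eqxx expr1.
have other l k : prime l -> prime k -> k != l -> padic_abs R k l%:R = 1.
  move=> lp kp kl; rewrite padic_abs_natE ?prime_gt0 // logn_prime // (negPf kl).
  by rewrite expr0 invr1.
case: s t => [l|] [k|] //= lp kp e.
- have [->//|lk] := eqVneq l k; have := e l%:R; rewrite self // other 1?eq_sym //.
  move/eqP; rewrite invr_eq1 pnatr_eq1 => /eqP l1.
  by move: (prime_gt1 lp); rewrite l1.
- by case: (arch l); rewrite /= e.
- by case: (arch k); rewrite /= e.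
Qed.

End ProductFormula.

Lemma generator_separates (L : fieldExtType rat) (C : numClosedFieldType)
  (t t' : {rmorphism L -> C}) (alpha : L) :
  <<1; alpha>>%VS = {:L}%VS -> t alpha = t' alpha -> t =1 t'.
Proof.
move=> gen e y; have : y \in <<1; alpha>>%VS by rewrite gen memvf.
move/Fadjoin_polyP => [q /polyOverP qQ ->].
have coef_eq i : t q`_i = t' q`_i.
  by have /vlineP[c ->] := qQ i; rewrite !rmorph_ratZ !rmorph1.
rewrite -!horner_map /= e; congr _.[_]; apply/polyP => i.
by rewrite !coef_map; apply: coef_eq.
Qed.

Section GeneratorHeight.
Variables (R : realType) (m b p : nat).
Hypotheses (m_gt0 : (0 < m)%N) (b_prime : prime b) (p_prime : prime p).
Hypothesis p_m2 : coprime p (m * 2).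
Local Notation P := (p%:R : R).
Variables (L : fieldExtType rat) (theta : L).
Local Notation n := (\dim {:L}).
Hypotheses (L_dim : n = (m * b)%N) (theta_n : theta ^+ n = (2 * p ^ m)%:R).
Hypotheses (pow_free : free (power_basis theta)).

(** A generator has distinct images under distinct embeddings. *)
Lemma different_neq0 alpha x : <<1; alpha>>%VS = {:L}%VS ->
  (forall (C : numClosedFieldType) (z zeta : C) (sigma : nat -> {rmorphism L -> C}),
    n.-primitive_root zeta ->
    (forall i q, sigma i (horner_alg theta q) = ev_at (zeta ^+ i * z) q) ->
    forall i, sigma i x = \prod_(1 <= k < b) (sigma i alpha - sigma (i + m * k)%N alpha)) ->
  x != 0.
Proof.
move=> gen hx; have a0 : (0 < 2 * p ^ m)%N by rewrite muln_gt0 expn_gt0 (prime_gt0 p_prime).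
have [z [zeta [sigma [zn prim hs _]]]] := radical_embeddings a0 theta_n pow_free algC.
have z0 : z != 0.
  apply/eqP => z0; move: zn; rewrite z0 expr0n gtn_eqF ?adim_gt0 // => /esym/eqP.
  by rewrite pnatr_eq0 gtn_eqF.
rewrite -(fmorph_eq0 (sigma 0%N)) (hx _ _ _ _ prim hs) big_nat_cond.
elim/big_ind: _ => [|u v u0 v0|k /andP[/andP[k0 kb] _]]; rewrite ?oner_eq0 ?mulf_neq0 //.
rewrite subr_eq0; apply/eqP => /(generator_separates gen)/(_ theta).
have -> : theta = horner_alg theta 'X by rewrite horner_algX.
rewrite !hs /ev_at map_polyX !hornerX => /(mulIf z0)/eqP.
rewrite (eq_prim_root_expr prim) add0n mod0n eq_sym L_dim -/(m * b %| m * k)%N.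
by rewrite dvdn_pmul2l // gtnNdvd.
Qed.

(** The product formula for the norm of the relative different bounds the height
    of a generator from below: at all places but p it is bounded by the height,
    and at p there is an extra factor coming from ramification. *)
Lemma generator_height alpha : <<1; alpha>>%VS = {:L}%VS ->
  P ^+ (m * b.-1) <= 2%:R ^+ (n * b.-1) * weil_height R alpha ^+ (n * (2 * b.-1)).
Proof.
move=> gen; have [x hx] := radical_different b_prime L_dim pow_free alpha.
have x0 := different_neq0 gen hx.
have P0 : 0 < P by rewrite ltr0n prime_gt0.
have a0 : (0 < 2 * p ^ m)%N by rewrite muln_gt0 expn_gt0 (prime_gt0 p_prime).
have q0 : field_norm x != 0.
  have [z [zeta [sigma [zn prim hs V_unit]]]] := radical_embeddings a0 theta_n pow_free algC.
  apply/eqP => q0; have := field_norm_conj V_unit x; rewrite q0 rmorph0 => /esym/eqP.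
  by apply/negP/prodf_neq0 => i _; rewrite fmorph_eq0.
set q := field_norm x in q0.
pose N := (p * (`|numq q| * `|denq q|))%N.
have N0 : (0 < N)%N.
  by rewrite !muln_gt0 prime_gt0 // !absz_gt0 numq_eq0 q0 denq_neq0.
pose S := None :: [seq Some l | l <- primes N].
have SP s : s \in S -> rat_place s.
  by rewrite inE => /predU1P[->//|/mapP[l + ->]]; rewrite mem_primes => /andP[].
have SU : uniq S.
  rewrite /= map_inj_uniq ?primes_uniq ?andbT; last by move=> ? ? [].
  by apply/mapP => -[].
have /choice[fam hfam] (s : option nat) : exists fam : 'I_n -> L -> R, s \in S -> place_family m b p s alpha x fam.
  have [sS|sS] := boolP (s \in S); last by exists (fun _ _ => 0) => sS'; case/negP: sS.
  have [fam hf] := local_bound R m_gt0 b_prime p_prime p_m2 L_dim theta_n pow_free (SP s sS) hx.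
  by exists fam.
have HH : \prod_(s <- S) \prod_i Num.max 1 (fam s i alpha) <= weil_height R alpha ^+ n.
  apply: height_ge_families => //.
  - by move=> s i sS; apply/placesP; exists s; [apply: SP | case: (hfam s sS)].
  - by move=> s i sS; case: (hfam s sS).
  - move=> s t i j sS tS e; apply: (@rat_abs_inj R); try exact: SP.
    move=> c; have [/(_ i)[_ h1] _ _] := hfam s sS; have [/(_ j)[_ h2] _ _] := hfam t tS.
    by rewrite -h1 -h2 e.
have m1 (y : R) : 1 <= Num.max 1 y by rewrite le_max lexx.
have prod_ge0 s : 0 <= \prod_i Num.max 1 (fam s i alpha).
  by apply: prodr_ge0 => i _; apply: le_trans (m1 _).
have prod1 : \prod_(s <- S) rat_abs R s q = 1.
  apply: rat_product_formula; rewrite ?q0 ?N0 //.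
    by rewrite /N dvdn_mull // dvdn_mulr.
  by rewrite /N !dvdn_mull.
have : 1 <= \prod_(s <- S) (defect R m b p L s * (\prod_i Num.max 1 (fam s i alpha)) ^+ (2 * b.-1)).
  rewrite -[leLHS]prod1 big_seq [leRHS]big_seq; apply: ler_prod => s sS.
  case: (hfam s sS) => hl _ -> ; rewrite andbT.
  have i0 : 'I_n := Ordinal (adim_gt0 {:L}%AS).
  have [av <-] := hl i0; exact: (av_ge0 av).
rewrite big_split /= prodrXl.
have -> : \prod_(s <- S) defect R m b p L s = 2%:R ^+ (n * b.-1) / P ^+ (m * b.-1).
  rewrite big_cons big_map /=; congr (_ * _).
  have pN : p \in primes N by rewrite mem_primes p_prime N0 dvdn_mulr.
  rewrite (bigD1_seq p) ?primes_uniq //= eqxx big1 ?mulr1 // => l lp.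
  by rewrite (negPf lp).
move=> h; rewrite (exprM (weil_height R alpha)).
have Pm : 0 < P ^+ (m * b.-1) by rewrite exprn_gt0.
rewrite mulrAC ler_pdivlMr // mul1r in h; apply: (le_trans h).
rewrite ler_wpM2l ?exprn_ge0 //; apply: lerXn2r; rewrite ?nnegrE //.
  by apply: prodr_ge0 => s _.
by apply: le_trans HH; apply: prodr_ge0 => s _.
Qed.

End GeneratorHeight.

(** * Discriminants *)

Section IntegralBases.
Variables (L : fieldExtType rat) (C : numClosedFieldType).
Local Notation n := (\dim {:L}).
Variable sigma : 'I_n -> {rmorphism L -> C}.
Hypothesis V_unit : conj_mx sigma (fun j => (vbasis {:L})`_j) \in unitmx.
Variable w : n.-tuple L.
Hypothesis w_int : integral_basis w.
Local Notation W := (conj_mx sigma (fun j => w`_j)).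

Lemma integral_basis_coords (e : 'I_n -> L) : (forall k, ring_of_integers (e k)) ->
  exists Z : 'M[int]_n, forall k, e k = \sum_j (map_mx intr Z : 'M[rat]_n) k j *: w`_j.
Proof.
move=> eI; have [_ _ wspan] := w_int.
have /choice[z zE] k : exists z : 'I_n -> int, e k = \sum_i (tnth w i) *~ z i by apply: wspan.
exists (\matrix_(k, j) z k j) => k; rewrite zE; apply: eq_bigr => j _.
by rewrite !mxE (tnth_nth 0) scaler_int.
Qed.

Lemma integral_basis_unit : W \in unitmx.
Proof. by have [wb _ _] := w_int; apply: conj_mx_basis. Qed.

Lemma basis_discriminant_conj : ratr (basis_discriminant w) = (\det W) ^+ 2.
Proof.
rewrite /basis_discriminant -det_map_mx expr2 -[X in _ = X * _]det_tr -det_mulmx; congr (\det _).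
apply/matrixP => i j; rewrite !mxE /= (field_trace_conj V_unit); apply: eq_bigr => k _.
by rewrite !mxE rmorphM /= !(tnth_nth 0).
Qed.

(** Traces may be computed in the basis w, in which multiplication by an integer
    has an integral matrix. *)
Lemma trace_integral i j : exists c : int, field_trace (tnth w i * tnth w j) = c%:~R.
Proof.
have [_ wI _] := w_int; set a := _ * _.
have [Z ZE] : exists Z : 'M[int]_n, forall k : 'I_n,
    a * w`_k = \sum_j (map_mx intr Z : 'M[rat]_n) k j *: w`_j.
  apply: integral_basis_coords => k; rewrite -tnth_nth /a.
  by do 2?apply: integral_mul; apply: wI.
exists (\tr Z); apply: (fmorph_inj (ratr : rat -> C)).
rewrite /= (field_trace_conj V_unit) -(conj_mult integral_basis_unit ZE).1.
by rewrite trace_map_mx.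
Qed.

Lemma basis_discriminant_int : exists c : int, basis_discriminant w = c%:~R.
Proof.
have /choice[z zE] i : exists z : 'I_n -> int, forall j,
    field_trace (tnth w i * tnth w j) = (z j)%:~R.
  by have /choice[z zE] := trace_integral i; exists z.
exists (\det (\matrix_(i, j) z i j)); rewrite -det_map_mx; congr (\det _).
by apply/matrixP => i j; rewrite !mxE zE.
Qed.

(** The matrix from w to e is an integral matrix of nonzero determinant. *)
Lemma basis_discriminant_le (e : 'I_n -> L) : (forall k, ring_of_integers (e k)) ->
  \det (conj_mx sigma e) != 0 ->
  `|ratr (basis_discriminant w)| <= `|\det (conj_mx sigma e)| ^+ 2.
Proof.
move=> /integral_basis_coords[Z ZE] e0.
have eW := conj_mx_lin sigma ZE.
have dE : \det (conj_mx sigma e) = \det W * (\det Z)%:~R.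
  rewrite eW det_mulmx det_tr -map_mx_comp; congr (_ * _).
  by rewrite -det_map_mx; congr (\det _); apply/matrixP => i j; rewrite !mxE /= ratr_int.
rewrite basis_discriminant_conj dE normrX normrM exprMn ler_peMr ?exprn_ge0 //.
rewrite exprn_ege1 // -intr_norm ler1z -gtz0_ge1 normr_gt0.
by apply: contra_neq e0 => Z0; rewrite dE Z0 mulr0.
Qed.

End IntegralBases.

Lemma discriminant_int (L : fieldExtType rat) (C : numClosedFieldType)
  (sigma : 'I_(\dim {:L}) -> {rmorphism L -> C}) :
  conj_mx sigma (fun j => (vbasis {:L})`_j) \in unitmx ->
  exists c : int, discriminant L = c%:~R.
Proof.
move=> V_unit; rewrite /discriminant; case: xgetP => [_ -> [w wI <-]|_].
  exact: (basis_discriminant_int V_unit wI).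
by exists 0.
Qed.

Lemma sum_div_block m b : (0 < b)%N ->
  (2 * (\sum_(k < m * b) k %/ b) + b * m = b * m * m)%N.
Proof.
move=> b0; elim: m => [|m IHm]; first by rewrite mul0n big_ord0 !muln0.
have -> : (\sum_(k < m.+1 * b) k %/ b = \sum_(k < m * b) k %/ b + b * m)%N.
  rewrite -(big_mkord predT (fun k => k %/ b)%N) mulSn addnC.
  rewrite (@big_cat_nat _ _ _ (m * b)) ?leq_addr //= big_mkord; congr (_ + _)%N.
  rewrite -{1}[(m * b)%N]add0n big_addn addKn big_mkord.
  under eq_bigr => i _ do rewrite divnDMl // divn_small // add0n.
  by rewrite sum_nat_const card_ord.
by move: IHm; lia.
Qed.

Section RadicalDiscriminant.
Variables (m b p : nat).
Hypotheses (m_gt0 : (0 < m)%N) (b_gt0 : (0 < b)%N) (p_prime : prime p).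
Variables (L : fieldExtType rat) (theta : L).
Local Notation n := (\dim {:L}).
Local Notation a := (2 * p ^ m)%N.
Hypotheses (L_dim : n = (m * b)%N) (theta_n : theta ^+ n = a%:R).
Hypotheses (pow_free : free (power_basis theta)).

Let p_gt0 : (0 < p)%N. Proof. exact: prime_gt0. Qed.
Let a_gt0 : (0 < a)%N. Proof. by rewrite muln_gt0 expn_gt0 p_gt0. Qed.

(** With eta = theta ^ b / p, these are the products eta ^ j theta ^ i. *)
Definition order_basis (k : 'I_n) : L := (p%:R ^+ (k %/ b) : rat)^-1 *: theta ^+ k.

Lemma order_basis_integral k : ring_of_integers (order_basis k).
Proof.
pose j := (k %/ b)%N; pose N := (2 ^ k * p ^ (m * k - j * n))%N.
have le : (j * n <= m * k)%N.
  have -> : (j * n = m * (j * b))%N by rewrite L_dim mulnCA.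
  by rewrite leq_mul2l /j leq_divM orbT.
have eN : order_basis k ^+ n = N%:R.
  have c0 : (p%:R ^+ j) ^+ n != 0 :> rat by rewrite !expf_neq0 // pnatr_eq0 -lt0n.
  rewrite /order_basis -/j exprZn exprVn (exprAC theta) theta_n.
  have -> : (a%:R : L) ^+ k = ((p ^ j) ^ n * N)%:R.
    by rewrite -natrX /N expnMn -!expnM mulnCA -expnD subnKC.
  by rewrite -scaler_nat scalerA natrM !natrX mulKf // scaler_nat.
exists ('X^n - N%:R%:P); first by apply: monicXnsubC; apply: adim_gt0.
by rewrite rmorphB /= map_polyXn map_polyC /= rootE !hornerE eN rmorph_nat subrr.
Qed.

(** All conjugates of the k-th element have the same absolute value r k, so the
    Leibniz formula bounds the determinant by n! times the product of the r k. *)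
Lemma order_basis_det (C : numClosedFieldType) (z zeta : C) (sigma : nat -> {rmorphism L -> C}) :
  z ^+ n = a%:R -> n.-primitive_root zeta ->
  (forall i q, sigma i (horner_alg theta q) = ev_at (zeta ^+ i * z) q) ->
  `|\det (conj_mx (fun i : 'I_n => sigma i) order_basis)| ^+ 2 <=
    (n`! ^ 2 * 2 ^ n.-1 * p ^ (m * b.-1))%:R.
Proof.
move=> zn prim hs; set We := conj_mx _ _.
have p0 : p%:R != 0 :> C by rewrite pnatr_eq0 -lt0n.
pose r (k : nat) : C := `|z| ^+ k / p%:R ^+ (k %/ b).
have zeta1 : `|zeta| = 1.
  have /eqP := congr1 Num.norm (prim_expr_order prim); rewrite normrX normr1.
  by rewrite pexpr_eq1 ?adim_gt0 // => /eqP.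
have Wr i k : `|We i k| = r k.
  rewrite !mxE rmorph_ratZ rmorphXn -[in sigma i _](horner_algX theta) hs.
  rewrite /ev_at map_polyX hornerX normrM fmorphV rmorphXn /= ratr_nat normfV !normrX.
  by rewrite normrM normrX zeta1 expr1n mul1r normr_nat /r mulrC.
have r0 k : 0 <= r k by rewrite divr_ge0 ?exprn_ge0.
have det_le : `|\det We| <= n`!%:R * \prod_(k < n) r k.
  rewrite /determinant; apply: le_trans (ler_norm_sum _ _ _) _.
  have -> : n`!%:R * \prod_(k < n) r k = \sum_(s : 'S_n) \prod_(k < n) r k.
    by rewrite sumr_const card_Sn mulr_natl.
  apply: ler_sum => s _; rewrite normrM normrX normrN1 expr1n mul1r normr_prod.
  under eq_bigr do rewrite Wr.
  by rewrite [leRHS](reindex_inj (@perm_inj _ s)).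
have prod_r : (\prod_(k < n) r k) ^+ 2 = (2 ^ n.-1 * p ^ (m * b.-1))%:R.
  have zz : `|z| ^+ n = a%:R by rewrite -normrX zn normr_nat.
  have sumk : ((\sum_(k < n) k) * 2 = n * n.-1)%N.
    rewrite -(big_mkord predT id) bin2_sum bin2 muln2.
    rewrite -[RHS]odd_double_half.
    by case: n => // k; rewrite /= oddM /= andNb.
  rewrite prodf_div !prodrXr expr_div_n -!exprM sumk exprM zz.
  apply: (canLR (mulfK _)); first by rewrite expf_neq0.
  rewrite -natrX -natrX -natrM; congr _%:R.
  have e : (m * n.-1 = m * b.-1 + (\sum_(k < n) k %/ b) * 2)%N.
    have := sum_div_block m b_gt0; rewrite L_dim.
    set s := (\sum_(k < _) _)%N => sE.
    move: (b_gt0) (m_gt0) sE; case: (b) => // b' _; case: (m) => // m' _ /=; nia.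
  by rewrite expnMn -expnM e expnD mulnA.
rewrite -mulnA natrM natrX -prod_r -exprMn; apply: lerXn2r; rewrite ?nnegrE //.
by rewrite mulr_ge0 //; apply: prodr_ge0.
Qed.

Lemma radical_discriminant :
  (exists c : int, discriminant L = c%:~R) /\
  `|discriminant L| <= (n`! ^ 2 * 2 ^ n.-1 * p ^ (m * b.-1))%:R.
Proof.
have [z [zeta [sigma [zn prim hs V_unit]]]] := radical_embeddings a_gt0 theta_n pow_free algC.
split; first exact: discriminant_int V_unit.
rewrite /discriminant; case: xgetP => [_ -> [w wI <-]|_]; last by rewrite normr0.
rewrite -(ler_rat algC) ratr_norm ratr_nat.
apply: le_trans (order_basis_det zn prim hs).
apply: basis_discriminant_le => //; first exact: order_basis_integral.
have := conj_mx_basis (power_basisP pow_free) V_unit.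
have -> : conj_mx (fun i : 'I_n => sigma i) order_basis =
    conj_mx (fun i : 'I_n => sigma i) (fun j => (power_basis theta)`_j) *m
    (map_mx ratr (diag_mx (\row_(k < n) (p%:R ^+ (k %/ b) : rat)^-1)))^T.
  apply: conj_mx_lin => k; rewrite (bigD1 k) //= big1 ?addr0.
    by rewrite !mxE eqxx power_basisE.
  by move=> j jk; rewrite !mxE eq_sym (negPf jk) scale0r.
rewrite unitmxE unitfE det_mulmx => h; apply: mulf_neq0 => //.
rewrite det_tr map_diag_mx det_diag /=.
apply/prodf_neq0 => i _; rewrite !mxE fmorph_eq0 invr_neq0 // expf_neq0 //.
by rewrite pnatr_eq0 -lt0n.
Qed.

End RadicalDiscriminant.

(** * Comparison of exponents *)

Section Comparison.
Variable R : realType.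

Lemma powR_le_root (E : nat) (c2 Y h : R) : (0 < E)%N -> 0 < c2 -> 0 <= Y -> 0 <= h ->
  Y <= c2 * h ^+ E -> (Y / c2) `^ E%:R^-1 <= h.
Proof.
move=> E0 c20 Y0 h0 Yh; have En0 : E%:R != 0 :> R by rewrite pnatr_eq0 -lt0n.
have -> : h = (h ^+ E) `^ E%:R^-1 by rewrite -powR_mulrn // -powRrM mulfV // powRr1.
apply: ge0_ler_powR; rewrite ?nnegrE ?invr_ge0 ?ler0n ?exprn_ge0 ?divr_ge0 ?(ltW c20) //.
by rewrite ler_pdivrMr // mulrC.
Qed.

(** For gamma > 0 the right side divided by the left one is at least a positive
    constant times Y ^ (1 / E - gamma). The case d = 0 allows for the convention 0 ^ 0 = 1. *)
Lemma powR_lt_root (E : nat) (gamma C1 c2 : R) : (0 < E)%N -> gamma < E%:R^-1 ->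
  0 < C1 -> 0 < c2 -> exists K, forall Y d : R, K < Y ->
    d = 0 \/ 1 <= d -> d <= C1 * Y -> d `^ gamma < (Y / c2) `^ E%:R^-1.
Proof.
move=> E0 gE C10 c20; pose g := gamma * E%:R.
have ER : 0 < E%:R :> R by rewrite ltr0n.
have En0 : E%:R != 0 :> R by rewrite gt_eqF.
have g1 : 0 < 1 - g by rewrite subr_gt0 /g -ltr_pdivlMr // div1r.
exists (Num.max c2 ((C1 `^ g * c2) `^ (1 - g)^-1)) => Y d.
rewrite gt_max => /andP[Yc YK] dcase dY.
have Y0 : 0 < Y := lt_trans c20 Yc.
have X0 : 0 < Y / c2 by rewrite divr_gt0.
have [g0|g0] := leP gamma 0.
  have d1 : d `^ gamma <= 1.
    case: dcase => [->|d1]; first by rewrite /powR eqxx; case: (gamma == 0).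
    by rewrite -(powRr0 d) ler_powR.
  apply: (le_lt_trans d1).
  suff : 1 `^ E%:R^-1 < (Y / c2) `^ E%:R^-1 by rewrite powR1.
  apply: gt0_ltr_powR; rewrite ?nnegrE ?invr_gt0 ?(ltW X0) //.
  by rewrite ltr_pdivlMr // mul1r.
have d0 : 0 <= d by case: dcase => [->//|]; apply: le_trans.
apply: (@le_lt_trans _ _ ((C1 * Y) `^ gamma)).
  by apply: ge0_ler_powR; rewrite ?nnegrE ?(ltW g0) // mulr_ge0 // ltW.
have -> : gamma = g * E%:R^-1 by rewrite /g mulfK.
rewrite powRrM; apply: gt0_ltr_powR; rewrite ?nnegrE ?invr_gt0 ?powR_ge0 ?(ltW X0) //.
rewrite powRM ?(ltW C10) ?(ltW Y0) // ltr_pdivlMr // mulrAC.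
have e : Y = Y `^ g * Y `^ (1 - g).
  by rewrite -powRD ?(gt_eqF Y0) ?implybT // addrC subrK powRr1 // ltW.
rewrite [ltRHS]e mulrC ltr_pM2l ?powR_gt0 //.
have K0 : 0 < C1 `^ g * c2 by rewrite mulr_gt0 // powR_gt0.
have -> : C1 `^ g * c2 = ((C1 `^ g * c2) `^ (1 - g)^-1) `^ (1 - g).
  by rewrite -powRrM mulVf ?gt_eqF // powRr1 // ltW.
by apply: gt0_ltr_powR; rewrite ?nnegrE ?powR_ge0 // ltW.
Qed.

Lemma exponent_bound (D b : nat) (gamma : R) : (0 < D)%N -> (1 < b)%N ->
  gamma < (if (b <= 3)%N then 1 / (D%:R * (b%:R + 1))
     else 1 / (2 * D%:R * (b%:R + 1)) + 1 / (D%:R * b%:R ^+ 2 * (b%:R + 1))) ->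
  gamma < (D * (2 * b.-1))%:R^-1.
Proof.
move=> D0 b1 /lt_le_trans; apply.
have d0 : 0 < D%:R :> R by rewrite ltr0n.
case: b b1 => [|[|b]] // _; rewrite /= natrM natrM -[b.+2]addn2 natrD.
case: ifP => [b3|_].
  have [->|->] : b = 0%N \/ b = 1%N by lia.
    rewrite div1r ?mulr0n ?mulr1n lef_pV2 ?posrE; nra.
  rewrite div1r ?mulr0n ?mulr1n lef_pV2 ?posrE; nra.
have : 0 <= b%:R :> R by [].
set x := b%:R => x0.
have e1 : b.+1%:R = x + 1 :> R by rewrite -natr1.
rewrite e1 -subr_ge0.
have -> : (D%:R * (2 * (x + 1)))^-1 - (1 / (2 * D%:R * (x + 2 + 1)) +
     1 / (D%:R * (x + 2) ^+ 2 * (x + 2 + 1))) =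
   (2 * (x + 2) ^+ 2 - 2 * (x + 2) + 2) /
     (2 * D%:R * (x + 1) * (x + 2) ^+ 2 * (x + 3)) :> R.
  by field; rewrite !gt_eqF //; nra.
apply: divr_ge0; first by nra.
by rewrite !mulr_ge0 ?exprn_ge0 //; lra.
Qed.

End Comparison.

(** * The family of radical fields *)

Section Family.
Variables (R : realType) (m b : nat).
Hypotheses (m_gt0 : (0 < m)%N) (b_prime : prime b).
Local Notation D := (m * b)%N.

(** The number field attached to p, together with the set of algebraic numbers
    that it is identified with. *)
Definition radical_subfield p (S : set algC) (L : fieldExtType rat)
    (iota : {rmorphism L -> algC}) (theta : L) : Prop :=
  [/\ S = range iota, \dim {:L} = D, theta ^+ (\dim {:L}) = (2 * p ^ m)%:R,
      <<1; theta>>%VS = {:L}%VS & free (power_basis theta)].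

Let b_gt0 : (0 < b)%N. Proof. exact: prime_gt0. Qed.

(** The generator attached to p has a p-adic size which is not an integral power
    of p, while p is unramified in the field attached to another prime. *)
Lemma radical_subfield_inj p p' S L L' iota iota' theta theta' :
  prime p -> prime p' -> (2 * D < p)%N ->
  @radical_subfield p S L iota theta -> @radical_subfield p' S L' iota' theta' -> p = p'.
Proof.
move=> pp pp' pD [SE dimL thn _ _] [SE' dimL' thn' _ free'].
have [//|pp_neq] := eqVneq p p'.
have [w [aw um w_rat]] := padic_absval_exists R pp.
pose t := iota theta; pose t' := iota' theta'.
have tD : t ^+ D = (2 * p ^ m)%:R by rewrite -dimL -rmorphXn thn rmorph_nat.
have tD' : t' ^+ D = (2 * p' ^ m)%:R by rewrite -dimL' -rmorphXn thn' rmorph_nat.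
have D0 : (0 < D)%N by rewrite muln_gt0 m_gt0 b_gt0.
have cop2D : coprime p (D * 2).
  have D2 : (D * 2 < p)%N by rewrite mulnC.
  by rewrite prime_coprime // gtnNdvd // muln_gt0 D0.
have copD : coprime p (D * (2 * p' ^ m)).
  rewrite mulnA coprimeMr cop2D coprimeXr //.
  by rewrite prime_coprime // dvdn_prime2.
have [q qE] : exists q, t = (map_poly ratr q).[t'].
  have : S t by rewrite SE; exists theta.
  rewrite SE' => -[y _ <-]; exists (poly_of theta' y).
  rewrite -{1}(poly_ofK free' y) /horner_alg /horner_morph -horner_map -map_poly_comp.
  congr _.[_]; apply: eq_map_poly => c /=.
  by rewrite alg_num_field fmorph_rat.
have t0 : t != 0.
  apply/eqP => t00; move: tD; rewrite t00 expr0n gtn_eqF // => /esym/eqP.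
  by rewrite pnatr_eq0 muln_eq0 expn_eq0 /= eqn0Ngt prime_gt0.
have [tz|[z zE]] := unramified pp aw um w_rat D0 tD' copD q.
  by rewrite qE tz eqxx in t0.
have P0 : 0 < p%:R :> R by rewrite ltr0n prime_gt0.
have p_m2 : coprime p (m * 2).
  by move: cop2D; rewrite !coprimeMr => /andP[/andP[-> _] ->].
have := w_root pp aw w_rat m_gt0 p_m2 tD; rewrite qE zE exprnP exprz_exp -exprN1.
move/ieexprIz => e; have {}e : z * b%:Z = -1 by apply: e => //; rewrite gt_eqF // ltr1n prime_gt1.
have b_dvd1 : (b %| 1)%N by have := congr1 absz e; rewrite abszM /= => <-; rewrite dvdn_mull.
by move: (prime_gt1 b_prime); move: b_dvd1; rewrite dvdn1 => /eqP ->.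
Qed.

Lemma radical_subfield_large : forall gamma : R,
  gamma < (D * (2 * b.-1))%:R^-1 -> exists K : R, forall p S L iota theta, prime p ->
    (2 * D < p)%N -> K < p%:R -> @radical_subfield p S L iota theta ->
    ratr `|discriminant L| `^ gamma < delta R L.
Proof.
move=> gamma gE; have b1 : (0 < b.-1)%N by rewrite -subn1 subn_gt0 prime_gt1.
have E0 : (0 < D * (2 * b.-1))%N by rewrite !muln_gt0 m_gt0 b_gt0 b1.
pose C1 : R := (D`! ^ 2 * 2 ^ D.-1)%:R; pose c2 : R := 2%:R ^+ (D * b.-1).
have C10 : 0 < C1 by rewrite ltr0n muln_gt0 !expn_gt0 fact_gt0.
have c20 : 0 < c2 by rewrite exprn_gt0.
have [K hK] := powR_lt_root E0 gE C10 c20.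
exists K => p S L iota theta pp pD Kp [_ dimL thn gen free].
have p0 : (0 < p)%N := prime_gt0 pp.
have p_m2 : coprime p (m * 2).
  have m2 : (m * 2 < p)%N by apply: leq_ltn_trans pD; rewrite mulnC leq_mul2l leq_pmulr.
  by rewrite prime_coprime // gtnNdvd // muln_gt0 m_gt0.
pose Y : R := p%:R ^+ (m * b.-1).
have KY : K < Y.
  apply: (lt_le_trans Kp); rewrite /Y -{1}[p%:R]expr1 ler_weXn2l ?ler1n //.
  by rewrite muln_gt0 m_gt0.
pose d : R := ratr `|discriminant L|.
have [[c cE] dle] := radical_discriminant m_gt0 b_gt0 pp dimL thn free.
have dcase : d = 0 \/ 1 <= d.
  rewrite /d cE -intr_norm ratr_int.
  have [->|c0] := eqVneq c 0; [by left | right].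
  by rewrite ler1z -gtz0_ge1 normr_gt0.
have dY : d <= C1 * Y.
  move: dle; rewrite -(ler_rat R) ratr_nat dimL natrM natrX; exact.
apply: lt_le_trans (hK Y d KY dcase dY) _.
rewrite /delta; apply: lb_le_inf.
  by exists (weil_height R theta); exists theta.
move=> _ [alpha gena <-].
have H1 := weil_height_ge1 R alpha.
apply: powR_le_root => //; [by rewrite exprn_ge0 | exact: le_trans ler01 H1 |].
by have := generator_height R m_gt0 b_prime pp p_m2 dimL thn free gena; rewrite dimL.
Qed.

End Family.

Lemma primes_beyond (N k : nat) : exists r : seq nat,
  [/\ uniq r, size r = k & forall p, p \in r -> prime p /\ (N < p)%N].
Proof.
elim: k => [|k [r [ur sr hr]]]; first by exists [::].
have [p pgt pp] := prime_above (N + \sum_(i <- r) i).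
exists (p :: r); split=> /=; rewrite ?sr // ?ur ?andbT.
  apply/negP => pr; move: pgt; rewrite (big_rem p) //= addnCA -[X in (_ < X)%N]addn0 ltn_add2l ltn0.
  by [].
move=> l; rewrite inE => /predU1P[->|/hr //]; split=> //.
exact: leq_ltn_trans (leq_addr _ _) pgt.
Qed.

Theorem theorem1p2 (R : realType) (D b : nat) (gamma : R)
  (D_gt1 : (1 < D)%N)
  (b_dvd : (b %| D)%N) (b_gt1 : (1 < b)%N)
  (b_min : forall d : nat, (d %| D)%N -> (1 < d)%N -> (b <= d)%N)
  (gamma_lt : gamma <
     if (b <= 3)%N then 1 / (D%:R * (b%:R + 1))
     else 1 / (2 * D%:R * (b%:R + 1)) + 1 / (D%:R * b%:R ^+ 2 * (b%:R + 1))) :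
  infinite_set [set S : set algC | exists L : fieldExtType rat,
    [/\ exists iota : {rmorphism L -> algC}, S = range iota,
        \dim {:L} = D
      & delta R L > ratr `|discriminant L| `^ gamma]].
Proof.
have b_prime : prime b.
  have pb := pdiv_prime b_gt1; have pb1 := prime_gt1 pb.
  have := b_min _ (dvdn_trans (pdiv_dvd b) b_dvd) pb1.
  by rewrite leq_eqVlt ltnNge pdiv_leq ?(ltnW b_gt1) // orbF => /eqP ->.
have D_gt0 : (0 < D)%N := ltnW D_gt1.
have gE := exponent_bound D_gt0 b_gt1 gamma_lt.
have [m DE] := dvdnP b_dvd.
have m_gt0 : (0 < m)%N by move: D_gt0; rewrite DE muln_gt0 => /andP[].
rewrite DE in gE.
have [K hK] := radical_subfield_large m_gt0 b_prime gE.
pose N := maxn (2 * (m * b)) (Num.bound `|K|).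
have hN p : (N < p)%N -> (2 * (m * b) < p)%N /\ K < p%:R.
  rewrite gtn_max => /andP[p1 p2]; split=> //.
  by apply: (le_lt_trans (ler_norm K)); apply: lt_trans (archi_boundP (normr_ge0 K)) _; rewrite ltr_nat.
have ex p : exists S : set algC, prime p -> p != 2 ->
    exists L iota theta, @radical_subfield m b p S L iota theta.
  have [pp|np] := boolP (prime p); last by exists set0.
  have [->|p2] := eqVneq p 2%N; first by exists set0.
  have [L [iota [theta [h1 h2 h3 h4]]]] := radical_field_exists R m_gt0 (prime_gt0 b_prime) pp p2.
  by exists (range iota) => _ _; exists L, iota, theta.
have /choice[S hS] := ex.
move=> fin; have [s sE] := (finite_seqP _).1 fin.
have [r [ur sr hr]] := primes_beyond N (size s).+1.
have field_of p : p \in r -> exists L iota theta, @radical_subfield m b p (S p) L iota theta.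
  move=> /hr[pp /hN[p1 _]]; apply: hS => //.
  by apply: contraTneq p1 => ->; rewrite -leqNgt leq_pmulr // muln_gt0 m_gt0 ltnW.
have : (size [seq S p | p <- r] <= size s)%N.
  apply: uniq_leq_size.
    rewrite map_inj_in_uniq // => p p' pr pr' e.
    have [[pp /hN[p1 _]] [pp' _]] := (hr p pr, hr p' pr').
    have [L [iota [theta h]]] := field_of p pr.
    have [L' [iota' [theta' h']]] := field_of p' pr'; rewrite -e in h'.
    exact: (radical_subfield_inj R m_gt0 b_prime pp pp' p1 h h').
  move=> _ /mapP[p pr ->]; suff : [set` s] (S p) by [].
  rewrite -sE; have [L [iota [theta h]]] := field_of p pr; exists L.
  have [pp /hN[p1 p2]] := hr p pr; have [h1 h2 _ _ _] := h.
  by split; [exists iota | rewrite DE | apply: (hK p (S p) L iota theta)].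
by rewrite size_map sr ltnn.
Qed.
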